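(* Let $\mathbf{K}=(K_1,\dots,K_n)\in\mathcal{F}_0^n$. For $\vec\phi\in\Phi^n$ or $\vec\phi\in\Psi^n$, one has $$\Omega_{\vec\phi}^{orlicz}(T\mathbf{K})=\Omega_{\vec\phi}^{orlicz}(\mathbf{K}),\qquad G_{\vec\phi}^{orlicz}(T\mathbf{K})=G_{\vec\phi}^{orlicz}(\mathbf{K}),\qquad\forall\,T\in SL(n).$$
   Context: A convex body is a convex compact subset of $\mathbb{R}^n$ with nonempty interior. $\mathcal{K}_0$ is the set of convex bodies with the origin in their interior; $h_K(u)=\max_{x\in K}\langle x,u\rangle$ is the support function; $K^\circ=\{y:\langle x,y\rangle\le 1\ \forall x\in K\}$ is the polar body; $|\cdot|$ is volume; $\omega_n$ is the volume of the unit Euclidean ball $B_2^n$; $S(K,\cdot)$ is the (classical) surface area measure of $K$ on $S^{n-1}$; $\sigma$ is spherical measure on $S^{n-1}$. $\mathcal{F}_0$ is the set of $K\in\mathcal{K}_0$ having a curvature function $f_K$, i.e. $S(K,\cdot)$ is absolutely continuous with respect to $\sigma$ with $dS(K,u)=f_K(u)\,d\sigma(u)$. $\mathcal{S}_0$ is the set of star bodies about the origin: sets $L$ containing the segment from $0$ to each of their points and whose radial function $\rho_L(u)=\max\{\lambda:\lambda u\in L\}$ is continuous and positive on $S^{n-1}$. $SL(n)$ is the set of linear maps $T$ of $\mathbb{R}^n$ with $|\det T|=1$ (absolute value of the determinant); $T\mathbf{K}=(TK_1,\dots,TK_n)$. With $F_\phi(t)=\phi(t^{-1/n})$: $\Phi$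 is the set of $\phi:(0,\infty)\to(0,\infty)$ such that $F_\phi$ is either constant or strictly convex; $\Psi$ is the set of $\phi:(0,\infty)\to(0,\infty)$ such that $F_\phi$ is either constant or increasing and strictly concave. $\vec\phi=(\phi_1,\dots,\phi_n)\in\Phi^n$ (resp. $\Psi^n$) means each $\phi_i\in\Phi$ (resp. $\Psi$). For $\mathbf{K}\in\mathcal{F}_0^n$, $\mathbf{Q}=(Q_1,\dots,Q_n)\in\mathcal{K}_0^n$, $\mathbf{L}=(L_1,\dots,L_n)\in\mathcal{S}_0^n$, $\mathbf{L}^\circ=(L_1^\circ,\dots,L_n^\circ)$, $$V_{\vec\phi}(\mathbf{K};\mathbf{Q})=\frac1n\int_{S^{n-1}}\prod_{i=1}^n\Big[\phi_i\Big(\frac{h_{Q_i}}{h_{K_i}}\Big)h_{K_i}f_{K_i}\Big]^{1/n}d\sigma,\quad V_{\vec\phi}(\mathbf{K};\mathbf{L}^\circ)=\frac1n\int_{S^{n-1}}\prod_{i=1}^n\Big[\phi_i\Big(\frac{1}{\rho_{L_i}h_{K_i}}\Big)h_{K_i}f_{K_i}\Big]^{1/n}d\sigma.$$ For $\vec\phi\in\Phi^n$: $\Omega_{\vec\phi}^{orlicz}(\mathbf{K})=\inf\{nV_{\vec\phi}(\mathbf{K};\mathbf{L}^\circ):\mathbf{L}\in\mathcal{S}_0^n,|L_1|=\dots=|L_n|=\omega_n\}$, $G_{\vec\phi}^{orlicz}(\mathbf{K})=\inf\{nV_{\vec\phi}(\mathbf{K};\mathbf{Q}):\mathbf{Q}\in\mathcal{K}_0^n,|Q_1^\circ|=\dots=|Q_n^\circ|=\omega_n\}$;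 for $\vec\phi\in\Psi^n$ replace $\inf$ by $\sup$ (value $+\infty$ allowed). *)

(* Defs.v *)
From HB Require Import structures.
From mathcomp Require Import all_boot all_order all_algebra.
From mathcomp Require Import all_classical all_reals all_analysis.
From mathcomp Require Import measurable_realfun.

Set Implicit Arguments.
Unset Strict Implicit.
Unset Printing Implicit Defensive.

Import Order.TTheory GRing.Theory Num.Theory.
Import numFieldNormedType.Exports.

Local Open Scope classical_set_scope.
Local Open Scope ring_scope.

(* The library norm on 'rV[R]_n is the sup norm. It induces the usual topology,
   so the library notions of open, compact and interior are used as they are,
   but lengths are measured with [enorm]. *)
Definition dotp (R : realType) (n : nat) (x y : 'rV[R]_n) : R :=
  \sum_i x ord0 i * y ord0 i.

Definition enorm (R : realType) (n : nat) (x : 'rV[R]_n) : R :=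
  Num.sqrt (dotp x x).

Definition eball (R : realType) (n : nat) : set 'rV[R]_n :=
  [set x | enorm x <= 1].

Definition sphere (R : realType) (n : nat) : set 'rV[R]_n :=
  [set u | enorm u = 1].

(* R^n with its Borel sigma-algebra. *)
Notation borelRn R n := (g_sigma_algebraType (@open 'rV[R]_n)).

Section borel_rV.
Context (R : realType).

Lemma continuous_measurable_rV n (f : 'rV[R]_n -> R) : continuous f ->
  measurable_fun [set: borelRn R n] f.
Proof.
move=> cf; apply: (measurability _ (RGenOpens.measurableE R)) => //.
move=> _ [_ [a [b ->]] <-]; rewrite setTI.
apply: sub_sigma_algebra; apply: open_comp => [x _|]; first exact: cf.
exact: interval_open.
Qed.

Lemma measurable_coord n (i : 'I_n) :
  measurable_fun [set: borelRn R n] (fun x : borelRn R n => (x : 'rV[R]_n) ord0 i).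
Proof. by apply: continuous_measurable_rV; exact: coord_continuous. Qed.

Lemma measurable_fun_rV d (T : measurableType d) n (f : T -> 'rV[R]_n) :
  (forall i, measurable_fun [set: T] (fun t => f t ord0 i)) ->
  measurable_fun [set: T] (f : T -> borelRn R n).
Proof.
move=> mf; apply: (@measurability _ _ T (borelRn R n) _ f (@open 'rV[R]_n)) => //.
move=> _ [U oU <-]; rewrite setTI.
pose rbox (c : 'rV[rat]_n * rat) :=
  [set x : 'rV[R]_n | forall i, `|x ord0 i - ratr (c.1 ord0 i)| < ratr c.2].
pose F c := if `[< rbox c `<=` U >] then f @^-1` rbox c else set0.
have -> : f @^-1` U = \bigcup_c F c.
  apply/seteqP; split => [t /= Uft|t [c _]]; last first.
    by rewrite /F; case: asboolP => // rU /rU.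
  have [e /= e0 eU] : exists2 e : R, 0 < e & ball (f t) e `<=` U.
    by have /nbhs_ballP := open_nbhs_nbhs (conj oU Uft).
  have [q] := rat_in_itvoo (divr_gt0 e0 (ltr0n R 2)).
  rewrite in_itv/= => /andP[q0 qe].
  have cP i : exists p : rat, `|f t ord0 i - ratr p| < ratr q.
    have /rat_in_itvoo[p] : f t ord0 i - ratr q < f t ord0 i + ratr q.
      by rewrite ltrD2l gtrN.
    by rewrite in_itv/= => pI; exists p; rewrite ltr_distlC.
  have [c cE] := choice cP.
  exists (\row_i c i, q) => //; rewrite /F; case: asboolP => [_|[]].
    by move=> i; rewrite mxE.
  move=> x /= xq; apply: eU; split => // i j; rewrite ord1.
  rewrite /ball/= (splitr e) (le_lt_trans (ler_distD (ratr (c j)) _ _))//.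
  rewrite ltrD//; first exact: lt_trans (cE j) qe.
  by apply: lt_trans qe; have := xq j; rewrite mxE distrC.
apply: countable_bigcupT_measurable => [|c]; first exact: countableP.
rewrite /F; case: asboolP => // _.
rewrite (_ : _ @^-1` _ = \bigcap_i
    ((fun t => f t ord0 i) @^-1` ball (ratr (c.1 ord0 i) : R) (ratr c.2))).
  apply: fin_bigcap_measurable => // i _; rewrite -[X in measurable X]setTI.
  by apply: mf => //; exact: measurable_ball.
apply/seteqP; split => t /= h i; first by move=> _; rewrite /ball/= distrC.
by have := h i Logic.I; rewrite /ball/= distrC.
Qed.

Lemma measurable_enorm n : measurable_fun [set: borelRn R n] (@enorm R n).
Proof.
rewrite (_ : @enorm R n = (@powR R)^~ 2^-1 \o (fun x => dotp x x)); last first.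
  apply/funext => x /=; rewrite powR12_sqrt//.
  by apply: sumr_ge0 => i _; rewrite -expr2 sqr_ge0.
apply: measurableT_comp => //; apply: measurable_sum => i.
by apply: measurable_funM; exact: measurable_coord.
Qed.

End borel_rV.

(* Lebesgue measure on R^n, as an iterated product of [lebesgue_measure]. *)
Section lebesgue_rV.
Context (R : realType).

Definition cons_rV n (p : R * borelRn R n) : borelRn R n.+1 :=
  row_mx (p.1)%:M (p.2 : 'rV[R]_n).

Lemma measurable_cons_rV n : measurable_fun [set: R * borelRn R n] (@cons_rV n).
Proof.
apply: measurable_fun_rV => i; case: (split_ordP (i : 'I_(1 + n))) => j ->.
  rewrite (_ : (fun _ => _) = fst); first exact: measurable_fst.
  apply/funext => -[x v]; apply: etrans (row_mxEl x%:M (v : 'rV_n) _ j) _.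
  by rewrite (ord1 j) mxE mulr1n.
rewrite (_ : (fun _ => _) =
    (fun x : borelRn R n => (x : 'rV[R]_n) ord0 j) \o snd).
  by apply: (measurableT_comp (measurable_coord j)); exact: measurable_snd.
by apply/funext => -[x v]; exact: (row_mxEr x%:M (v : 'rV_n) _ j).
Qed.

Definition behead_rV n (x : borelRn R n.+1) : R * borelRn R n :=
  ((x : 'rV[R]_n.+1) ord0 ord0, \row_j (x : 'rV[R]_n.+1) ord0 (lift ord0 j)).

Lemma cons_rVK n : cancel (@cons_rV n) (@behead_rV n).
Proof.
move=> [x v]; rewrite /behead_rV /cons_rV; congr pair.
  transitivity ((row_mx x%:M (v : 'rV_n) : 'rV_(1 + n)) ord0 (lshift n ord0)).
    by congr (fun_of_matrix _ _ _); exact: val_inj.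
  by rewrite row_mxEl mxE mulr1n.
apply/rowP => j; rewrite mxE.
transitivity ((row_mx x%:M (v : 'rV_n) : 'rV_(1 + n)) ord0 (rshift 1 j)).
  by congr (fun_of_matrix _ _ _); exact: val_inj.
by rewrite row_mxEr.
Qed.

Lemma measurable_behead_rV n :
  measurable_fun [set: borelRn R n.+1] (@behead_rV n).
Proof.
apply: measurable_fun_pair; first exact: measurable_coord.
apply: measurable_fun_rV => j.
rewrite (_ : (fun _ => _) =
    (fun x : borelRn R n.+1 => (x : 'rV[R]_n.+1) ord0 (lift ord0 j))).
  exact: measurable_coord.
by apply/funext => x; rewrite mxE.
Qed.

Section lebesgue_rV_succ.
Variables (n : nat) (m : {sigma_finite_measure set (borelRn R n) -> \bar R}).

Definition lebesgue_rV_succ : set (borelRn R n.+1) -> \bar R :=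
  pushforward (@lebesgue_measure R \x m)%E (@cons_rV n).

HB.instance Definition _ := Measure.copy lebesgue_rV_succ
  (measure_function_pushforward__canonical__measure_function_Measure
     (@lebesgue_measure R \x m)%E (@measurable_cons_rV n)).

Lemma lebesgue_rV_succ_sigma_finite : sigma_finite setT lebesgue_rV_succ.
Proof.
have /sigma_finiteP[F [TF ndF mF]] := sigma_finiteT (@lebesgue_measure R).
have /sigma_finiteP[G [TG ndG mG]] := sigma_finiteT m.
exists (fun k => @behead_rV n @^-1` (F k `*` G k)) => [|k].
  apply/esym; rewrite -subTset => x _.
  have [i _ Fi] : (\bigcup_i F i) (behead_rV x).1 by rewrite -TF.
  have [j _ Gj] : (\bigcup_i G i) (behead_rV x).2 by rewrite -TG.
  exists (maxn i j) => //; split.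
    by move: Fi; exact/subsetPset/ndF/leq_maxl.
  by move: Gj; exact/subsetPset/ndG/leq_maxr.
have [mFk Fk] := mF k; have [mGk Gk] := mG k; split.
  rewrite -[X in measurable X]setTI; apply: measurable_behead_rV => //.
  exact: measurableX.
rewrite /lebesgue_rV_succ /pushforward -comp_preimage.
rewrite (_ : _ \o _ = id) ?preimage_id; last first.
  by apply/funext => p; exact: cons_rVK.
by rewrite product_measure1E// lte_mul_pinfty// ge0_fin_numE.
Qed.

HB.instance Definition _ := Measure_isSigmaFinite.Build _ _ _
  lebesgue_rV_succ lebesgue_rV_succ_sigma_finite.

End lebesgue_rV_succ.

Fixpoint lebesgue_rV n : {sigma_finite_measure set (borelRn R n) -> \bar R} :=
  if n is k.+1 then lebesgue_rV_succ (lebesgue_rV k)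
  else @dirac _ (borelRn R 0) (0 : 'rV[R]_0) R.

End lebesgue_rV.

Definition omega (R : realType) (n : nat) : \bar R := lebesgue_rV R n (@eball R n).

(* Spherical measure: sigma(A) is n times the volume of the cone
   {t u | 0 < t <= 1, u in A}, i.e. the surface area of A. It is a Borel measure
   on R^n carried by the unit sphere. *)
Section spherical_measure.
Context (R : realType) (n : nat).

Definition direction (x : borelRn R n) : borelRn R n :=
  (enorm (x : 'rV[R]_n))^-1 *: (x : 'rV[R]_n).

Definition punctured_eball : set (borelRn R n) :=
  [set x | 0 < enorm (x : 'rV[R]_n) <= 1].

Definition spherical_measure (A : set (borelRn R n)) : \bar R :=
  (n%:R%:E * lebesgue_rV R n (direction @^-1` A `&` punctured_eball))%E.

Lemma measurable_direction : measurable_fun [set: borelRn R n] direction.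
Proof.
apply: measurable_fun_rV => i.
rewrite (_ : (fun _ => _) = (fun x : borelRn R n =>
    ((@powR R)^~ (- 1) \o @enorm R n) x * (x : 'rV[R]_n) ord0 i)); last first.
  by apply/funext => x /=; rewrite mxE powR_inv1// sqrtr_ge0.
apply: measurable_funM; last exact: measurable_coord.
by apply: measurableT_comp; [exact: measurable_powR|exact: measurable_enorm].
Qed.

Lemma measurable_punctured_eball : measurable punctured_eball.
Proof.
rewrite (_ : punctured_eball = @enorm R n @^-1` `]0, 1]%classic); last first.
  by apply/seteqP; split => x /=; rewrite in_itv.
by rewrite -[X in measurable X]setTI; exact: measurable_enorm.
Qed.

HB.instance Definition _ := Measure.copy spherical_measure
  (mscale (n%:R)%:nng
    (measure_function_pushforward__canonical__measure_function_Measure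
      (mrestr (lebesgue_rV R n) measurable_punctured_eball)
      measurable_direction)).

End spherical_measure.

(* d-dimensional Hausdorff measure, normalised so as to agree with Lebesgue
   measure on R^d. The empty set is singled out because 0 ^+ 0 = 1. *)
Section hausdorff_measure.
Context (R : realType) (n : nat).

Definition ediam (U : set 'rV[R]_n) : R :=
  sup [set enorm (p.1 - p.2) | p in U `*` U].

Definition hausdorff_weight (d : nat) (U : set 'rV[R]_n) : R :=
  if `[< U = set0 >] then 0 else fine (omega R d) * (ediam U / 2) ^+ d.

Definition hausdorff_premeasure (d : nat) (delta : R) (A : set 'rV[R]_n) : \bar R :=
  ereal_inf [set (\sum_(0 <= i <oo) (hausdorff_weight d (U i))%:E)%E |
    U in [set U : nat -> set 'rV[R]_n | A `<=` \bigcup_i U i /\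
      forall i x y, U i x -> U i y -> enorm (x - y) <= delta]].

Definition hausdorff_measure (d : nat) (A : set 'rV[R]_n) : \bar R :=
  ereal_sup [set hausdorff_premeasure d delta A |
    delta in [set delta : R | 0 < delta]].

End hausdorff_measure.

Section bodies.
Context (R : realType) (n : nat).
Implicit Types (K L Q : set 'rV[R]_n) (T : 'M[R]_n) (f : 'rV[R]_n -> R).

Definition is_convex_body K : Prop :=
  [/\ convex_set K, compact K & K° !=set0].

Definition is_K0 K : Prop := is_convex_body K /\ K° 0.

Definition support_fun K (u : 'rV[R]_n) : R := sup [set dotp x u | x in K].

Definition polar K : set 'rV[R]_n :=
  [set y | forall x, K x -> dotp x y <= 1].

Definition radial L (u : 'rV[R]_n) : R :=
  sup [set lambda : R | L (lambda *: u)].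

(* The second clause says that the supremum defining [radial L] is a maximum. *)
Definition is_S0 L : Prop :=
  [/\ forall x (t : R), L x -> 0 <= t <= 1 -> L (t *: x),
      forall u, sphere u -> L (radial L u *: u) /\
        has_ubound [set lambda : R | L (lambda *: u)],
      {within @sphere R n, continuous (radial L)}
    & forall u, sphere u -> 0 < radial L u].

(* S(K, A) is the (n-1)-dimensional Hausdorff measure of the set of boundary
   points of K having an outer unit normal vector in A. *)
Definition surface_area_measure K (A : set 'rV[R]_n) : \bar R :=
  hausdorff_measure n.-1
    [set x | (K `\` K°) x /\
      exists2 u, (A `&` @sphere R n) u & dotp x u = support_fun K u].

Definition is_curvature_fun K f : Prop :=
  [/\ measurable_fun (@sphere R n : set (borelRn R n)) f,
      forall u, sphere u -> 0 <= f u
    & forall A : set (borelRn R n), measurable A -> A `<=` @sphere R n ->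
        surface_area_measure K A =
        (\int[@spherical_measure R n]_(u in A) (f u)%:E)%E].

Definition is_F0 K : Prop := is_K0 K /\ exists f, is_curvature_fun K f.

(* f_K is only determined up to a sigma-null set: a version is chosen. *)
Definition curvature_fun K : 'rV[R]_n -> R :=
  xget (fun=> 0) [set f | is_curvature_fun K f].

Definition lin_image T K : set 'rV[R]_n := [set x *m T^T | x in K].

Definition SL T : Prop := `|\det T| = 1.

End bodies.

Section orlicz_classes.
Context (R : realType) (n : nat).
Implicit Types (phi F : R -> R).

Definition F_of phi (t : R) : R := phi (t `^ (- n%:R^-1)).

Definition pos_constant F : Prop := exists c : R, forall t, 0 < t -> F t = c.

Definition pos_strictly_convex F : Prop :=
  forall x y t : R, 0 < x -> 0 < y -> x != y -> 0 < t < 1 ->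
    F (t * x + (1 - t) * y) < t * F x + (1 - t) * F y.

Definition pos_strictly_concave F : Prop :=
  forall x y t : R, 0 < x -> 0 < y -> x != y -> 0 < t < 1 ->
    t * F x + (1 - t) * F y < F (t * x + (1 - t) * y).

Definition pos_increasing F : Prop :=
  forall x y : R, 0 < x -> x < y -> F x < F y.

Definition is_Phi phi : Prop :=
  (forall t, 0 < t -> 0 < phi t) /\
  (pos_constant (F_of phi) \/ pos_strictly_convex (F_of phi)).

Definition is_Psi phi : Prop :=
  (forall t, 0 < t -> 0 < phi t) /\
  (pos_constant (F_of phi) \/
   (pos_increasing (F_of phi) /\ pos_strictly_concave (F_of phi))).

End orlicz_classes.

Section orlicz_functionals.
Context (R : realType) (n : nat).
Implicit Types (phi : 'I_n -> R -> R) (K L Q : 'I_n -> set 'rV[R]_n).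

(* Common form of V_phi(K; Q) and V_phi(K; L^o): [q i u] is the argument of
   [phi i]. *)
Definition V_gen phi K (q : 'I_n -> 'rV[R]_n -> R) : \bar R :=
  ((n%:R^-1)%:E * \int[@spherical_measure R n]_(u in @sphere R n)
    (\prod_(i < n) ((phi i (q i u) * support_fun (K i) u *
                     curvature_fun (K i) u) `^ n%:R^-1))%:E)%E.

Definition V_body phi K Q : \bar R :=
  V_gen phi K (fun i u => support_fun (Q i) u / support_fun (K i) u).

Definition V_star phi K L : \bar R :=
  V_gen phi K (fun i u => 1 / (radial (L i) u * support_fun (K i) u)).

Definition Omega_values phi K : set (\bar R) :=
  [set (n%:R%:E * V_star phi K L)%E | L in [set L : 'I_n -> set 'rV[R]_n |
    forall i, is_S0 (L i) /\ lebesgue_rV R n (L i) = omega R n]].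

Definition G_values phi K : set (\bar R) :=
  [set (n%:R%:E * V_body phi K Q)%E | Q in [set Q : 'I_n -> set 'rV[R]_n |
    forall i, is_K0 (Q i) /\ lebesgue_rV R n (polar (Q i)) = omega R n]].

(* The infima are the definitions for phi in Phi^n, the suprema those for phi
   in Psi^n. *)
Definition Omega_inf phi K : \bar R := ereal_inf (Omega_values phi K).
Definition Omega_sup phi K : \bar R := ereal_sup (Omega_values phi K).
Definition G_inf phi K : \bar R := ereal_inf (G_values phi K).
Definition G_sup phi K : \bar R := ereal_sup (G_values phi K).

End orlicz_functionals.

(* Main.v *)
(* Let g u be the direction of T^t u. Both h_{TQ}(u) = |T^t u| h_Q(g u) and
   1 / rho_{T^-t L}(u) = |T^t u| / rho_L(g u) hold, so the arguments of the phi_i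
   are carried along by g. The theorem then reduces to
     f_{TK}(u) = |T^t u|^-(n+1) f_K(g u) sigma-a.e. and
     sigma(g B) = \int_B |T^t u|^-n dsigma(u),
   because the powers of |T^t u| in the integrand, 1 - (n+1), match the Jacobian
   of g; taking T^-1 turns the inclusion between the sets of values into an
   equality.
   For the formula for f_{TK}: near a boundary point with normal v, the boundary
   of K is nearly contained in the hyperplane orthogonal to v, so T multiplies
   its (n-1)-dimensional Hausdorff measure by a factor close to the one for the
   hyperplane, which is |T^-t v|. Summing over the pieces of the boundary given
   by a fine grid of normals yields H(T X_B) = \int_B |T^-t v| f_K(v) dsigma(v),
   where X_B is the set of boundary points having a normal in B. Overlaps of the
   X_B are Hausdorff null since S(K, .) is a measure, and the error of the local
   comparison is multiplicative, so it disappears in the limit. On a hyperplane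
   the scaling of Hausdorff measure follows from Caratheodory's criterion and the
   uniqueness, up to a constant, of translation invariant measures. *)
Require Import Defs.
From HB Require Import structures.
From mathcomp Require Import all_boot all_order all_algebra.
From mathcomp Require Import fingroup perm.
From mathcomp Require Import all_classical all_reals all_analysis.
From mathcomp Require Import measurable_realfun.
From mathcomp Require Import ring lra.

Set Implicit Arguments.
Unset Strict Implicit.
Unset Printing Implicit Defensive.

Import Order.TTheory GRing.Theory Num.Theory.
Import numFieldNormedType.Exports.

Local Open Scope classical_set_scope.
Local Open Scope ring_scope.

(** For a general Borel set B of normals, the set X_B of boundary points is not visibly Borel, so
    additivity of Hausdorff measure on such sets is not at hand. The estimate of H(T X_B) from above
    rests on subadditivity and is proved for every B. The estimate from below is proved for the
    whole sphere cut into half-open grid cells: each cell of the sphere is a countable union of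
    compact sets, and so are the corresponding X_B and T X_B. Finiteness of the total mass and
    passage to the complement then give equality for every B. The version of f_{TK} selected by
    [curvature_fun] is arbitrary, so the formula for it holds almost everywhere only. This takes a
    finite surface area, and exchanging versions under the integral takes Borel measurability of the
    integrands; the latter comes from convexity or monotonicity of F_phi. The ratio of d-dimensional
    Hausdorff measure to Lebesgue measure on R^d, which is the content of the isodiametric
    inequality, is never evaluated: it cancels. That linear maps scale both by |det| follows from
    the multiplicativity of the scaling factor. *)

Section euclidean.
Context (R : realType) (n : nat).
Implicit Types (x y z : 'rV[R]_n) (a : R).

Lemma dotpE x y : dotp x y = (x *m y^T) ord0 ord0.
Proof. by rewrite mxE; apply: eq_bigr => i _; rewrite mxE. Qed.

Lemma dotpC x y : dotp x y = dotp y x.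
Proof. by apply: eq_bigr => i _; rewrite mulrC. Qed.

Lemma dotpDl x y z : dotp (x + y) z = dotp x z + dotp y z.
Proof. by rewrite !dotpE mulmxDl mxE. Qed.

Lemma dotpZl a x y : dotp (a *: x) y = a * dotp x y.
Proof. by rewrite !dotpE -scalemxAl mxE. Qed.

Lemma dotpNl x y : dotp (- x) y = - dotp x y.
Proof. by rewrite -scaleN1r dotpZl mulN1r. Qed.

Lemma dotpBl x y z : dotp (x - y) z = dotp x z - dotp y z.
Proof. by rewrite dotpDl dotpNl. Qed.

Lemma dotpDr x y z : dotp z (x + y) = dotp z x + dotp z y.
Proof. by rewrite dotpC dotpDl !(dotpC z). Qed.

Lemma dotpZr a x y : dotp x (a *: y) = a * dotp x y.
Proof. by rewrite dotpC dotpZl dotpC. Qed.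

Lemma dotpNr x y : dotp x (- y) = - dotp x y.
Proof. by rewrite dotpC dotpNl dotpC. Qed.

Lemma dotpBr x y z : dotp z (x - y) = dotp z x - dotp z y.
Proof. by rewrite dotpDr dotpNr. Qed.

Lemma dotp0l x : dotp 0 x = 0.
Proof. by rewrite -(scale0r x) dotpZl mul0r. Qed.

Lemma dotp0r x : dotp x 0 = 0.
Proof. by rewrite dotpC dotp0l. Qed.

Lemma dotp_ge0 x : 0 <= dotp x x.
Proof. by apply: sumr_ge0 => i _; rewrite -expr2 sqr_ge0. Qed.

Lemma enorm_ge0 x : 0 <= enorm x.
Proof. exact: sqrtr_ge0. Qed.

Lemma sqr_enorm x : enorm x ^+ 2 = dotp x x.
Proof. by rewrite sqr_sqrtr// dotp_ge0. Qed.

Lemma enormZ a x : enorm (a *: x) = `|a| * enorm x.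
Proof.
by rewrite /enorm dotpZl dotpZr mulrA -expr2 sqrtrM ?sqr_ge0// sqrtr_sqr.
Qed.

Lemma enormN x : enorm (- x) = enorm x.
Proof. by rewrite -scaleN1r enormZ normrN1 mul1r. Qed.

Lemma enorm_distC x y : enorm (x - y) = enorm (y - x).
Proof. by rewrite -enormN opprB. Qed.

Lemma enorm0 : enorm (0 : 'rV[R]_n) = 0.
Proof. by rewrite /enorm dotp0l sqrtr0. Qed.

Lemma coord_le_enorm x i : `|x ord0 i| <= enorm x.
Proof.
rewrite -sqrtr_sqr ler_sqrt ?dotp_ge0// /dotp (bigD1 i)//= -expr2 lerDl.
by apply: sumr_ge0 => j _; rewrite -expr2 sqr_ge0.
Qed.

Lemma enorm_eq0 x : (enorm x == 0) = (x == 0).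
Proof.
apply/eqP/eqP => [x0|->]; last exact: enorm0.
apply/rowP => i; rewrite mxE; apply/eqP; rewrite -normr_le0 -x0.
exact: coord_le_enorm.
Qed.

Lemma enorm_gt0 x : (0 < enorm x) = (x != 0).
Proof. by rewrite lt_neqAle enorm_ge0 andbT eq_sym enorm_eq0. Qed.

Lemma cauchy_schwarz x y : `|dotp x y| <= enorm x * enorm y.
Proof.
have [->|y0] := eqVneq y 0; first by rewrite dotp0r normr0 enorm0 mulr0.
have c0 : 0 < dotp y y by rewrite -sqr_enorm exprn_gt0// enorm_gt0.
rewrite -sqrtr_sqr /enorm -sqrtrM ?dotp_ge0// ler_sqrt ?mulr_ge0 ?dotp_ge0//.
have := dotp_ge0 (dotp y y *: x - dotp x y *: y).
rewrite !dotpBr !dotpBl !dotpZl !dotpZr (dotpC y x) => h.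
rewrite -subr_ge0 -(pmulr_rge0 _ c0).
by apply: le_trans h _; rewrite le_eqVlt; apply/orP; left; apply/eqP; ring.
Qed.

Lemma dotp_le x y : dotp x y <= enorm x * enorm y.
Proof. exact: le_trans (ler_norm _) (cauchy_schwarz x y). Qed.

Lemma enormD x y : enorm (x + y) <= enorm x + enorm y.
Proof.
rewrite -(@ler_pXn2r _ 2)// ?nnegrE ?addr_ge0 ?enorm_ge0//.
rewrite sqr_enorm dotpDl !dotpDr sqrrD !sqr_enorm (dotpC y x).
have := dotp_le x y; rewrite mulr2n; lra.
Qed.

Lemma enorm_lip x y : `|enorm x - enorm y| <= enorm (x - y).
Proof.
rewrite ler_norml; apply/andP; split.
  have := enormD (y - x) x; rewrite subrK -(enorm_distC x); lra.
have := enormD (x - y) y; rewrite subrK; lra.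
Qed.

Lemma enorm_le_sum x : enorm x <= \sum_i `|x ord0 i|.
Proof.
rewrite {1}(row_sum_delta x).
elim/big_ind2 : _ => [|u a v b ua vb|i _]; first by rewrite enorm0.
  exact: le_trans (enormD _ _) (lerD ua vb).
rewrite enormZ ler_piMr// /enorm /dotp (bigD1 i)//= big1 => [|j ji].
  by rewrite mxE !eqxx addr0 mulr1 sqrtr1.
by rewrite mxE eqxx (negbTE ji) mulr0.
Qed.

Lemma enorm_le_norm x : enorm x <= n%:R * `|x|.
Proof.
rewrite (le_trans (enorm_le_sum x))// mulr_natl.
apply: (@le_trans _ _ (\sum_(i < n) `|x|)).
  apply: ler_sum => i _; rewrite [leRHS]/Num.norm /= mx_normrE.
  by apply: (le_bigmax _ (fun ij => `|x ij.1 ij.2|) (ord0, i)).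
by rewrite sumr_const card_ord.
Qed.

Lemma norm_le_enorm x : `|x| <= enorm x.
Proof.
rewrite [leLHS]/Num.norm /= mx_normrE; apply/bigmax_leP; split => [|[i j] _] /=.
  exact: enorm_ge0.
by rewrite ord1; exact: coord_le_enorm.
Qed.

End euclidean.

Lemma mulmx_enorm_bound (R : realType) m n (A : 'M[R]_(m, n)) :
  exists2 C, 0 < C & forall x, enorm (x *m A) <= C * enorm x.
Proof.
exists (1 + \sum_j \sum_i `|A i j|) => [|x].
  by rewrite ltr_pwDl// sumr_ge0// => j _; exact: sumr_ge0.
rewrite (le_trans (enorm_le_sum _))// mulrDl mul1r ler_wpDl ?enorm_ge0//.
rewrite mulr_suml; apply: ler_sum => j _; rewrite mxE mulr_suml.
rewrite (le_trans (ler_norm_sum _ _ _))//; apply: ler_sum => i _.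
by rewrite normrM mulrC ler_wpM2l// coord_le_enorm.
Qed.

(** * Hausdorff measure *)

Section hausdorff_weight.
Context (R : realType).

(** The bound [c] makes [ediam U] a genuine supremum: [sup] of an unbounded set is 0 by
    convention. *)
Lemma ediam_ub n (U : set 'rV[R]_n) c x y :
  (forall x y, U x -> U y -> enorm (x - y) <= c) ->
  U x -> U y -> enorm (x - y) <= ediam U.
Proof.
move=> Uc Ux Uy; apply: ub_le_sup.
  by exists c => _ [[a b] [/= Ua Ub] <-]; exact: Uc.
by exists (x, y).
Qed.

Lemma ediam_le n (U : set 'rV[R]_n) c : U !=set0 ->
  (forall x y, U x -> U y -> enorm (x - y) <= c) -> ediam U <= c.
Proof.
move=> [x Ux] Uc; apply: ge_sup; first by exists (enorm (x - x)), (x, x).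
by move=> _ [[a b] [/= Ua Ub] <-]; exact: Uc.
Qed.

Lemma ediam_ge0 n (U : set 'rV[R]_n) : 0 <= ediam U.
Proof.
rewrite /ediam; set S := (X in sup X).
have [[[s Ss] ubS]|S0] := pselect (has_sup S); last by rewrite sup_out.
by apply: le_trans (ub_le_sup ubS Ss); case: Ss => p _ <-; exact: enorm_ge0.
Qed.

Lemma hausdorff_weight_ge0 n d (U : set 'rV[R]_n) : 0 <= hausdorff_weight d U.
Proof.
rewrite /hausdorff_weight; case: asboolP => // _.
by rewrite mulr_ge0 ?fine_ge0 ?exprn_ge0 ?divr_ge0 ?ediam_ge0.
Qed.

Lemma hausdorff_weight0 n d : hausdorff_weight d (set0 : set 'rV[R]_n) = 0.
Proof. by rewrite /hausdorff_weight; case: asboolP. Qed.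

Lemma hausdorff_weight_le n d (U : set 'rV[R]_n) c : 0 <= c ->
  (forall x y, U x -> U y -> enorm (x - y) <= c) ->
  hausdorff_weight d U <= fine (omega R d) * (c / 2) ^+ d.
Proof.
move=> c0 Uc; rewrite /hausdorff_weight; case: asboolP => [_|/eqP/set0P U0].
  by rewrite mulr_ge0 ?fine_ge0 ?exprn_ge0 ?divr_ge0.
rewrite ler_wpM2l ?fine_ge0// lerXn2r ?nnegrE ?divr_ge0 ?ediam_ge0//.
by rewrite ler_pM2r// ediam_le.
Qed.

Lemma hausdorff_weight_lip m n d (f : 'rV[R]_m -> 'rV[R]_n) c c' (U : set 'rV[R]_m)
    (E : set 'rV[R]_m) : 0 <= c ->
  (forall x y, E x -> E y -> enorm (f x - f y) <= c * enorm (x - y)) ->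
  (forall x y, U x -> U y -> enorm (x - y) <= c') ->
  hausdorff_weight d (f @` (U `&` E)) <= c ^+ d * hausdorff_weight d U.
Proof.
move=> c0 fc Uc'; have [U0|U0] := pselect (U = set0).
  by rewrite U0 set0I image_set0 !hausdorff_weight0 mulr0.
rewrite [in leRHS]/hausdorff_weight; case: asboolP => // _.
rewrite mulrCA -exprMn mulrA; apply: hausdorff_weight_le.
  by rewrite mulr_ge0 ?ediam_ge0.
move=> _ _ [x [Ux Ex] <-] [y [Uy Ey] <-]; apply: le_trans (fc _ _ Ex Ey) _.
by rewrite ler_wpM2l// (ediam_ub Uc').
Qed.

End hausdorff_weight.

Section hausdorff_outer_measure.
Context (R : realType) (n d : nat).
Implicit Types (A : set 'rV[R]_n) (U : nat -> set 'rV[R]_n).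

Definition mesh_le (delta : R) U :=
  forall i x y, U i x -> U i y -> enorm (x - y) <= delta.

Lemma hausdorff_premeasure_le delta A U : A `<=` \bigcup_i U i ->
  mesh_le delta U ->
  (hausdorff_premeasure d delta A <=
   \sum_(0 <= i <oo) (hausdorff_weight d (U i))%:E)%E.
Proof. by move=> AU dU; apply: ereal_inf_lbound; exists U. Qed.

Lemma hausdorff_premeasure_adherent delta A (e : R) : 0 < e ->
  (hausdorff_premeasure d delta A < +oo)%E ->
  exists U, [/\ A `<=` \bigcup_i U i, mesh_le delta U &
    (\sum_(0 <= i <oo) (hausdorff_weight d (U i))%:E <=
     hausdorff_premeasure d delta A + e%:E)%E].
Proof.
move=> e0 Aoo.
have fA : hausdorff_premeasure d delta A \is a fin_num.
  rewrite ge0_fin_numE//; apply: le_ereal_inf_tmp => _ [U _ <-].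
  by apply: nneseries_ge0 => i _ _; rewrite lee_fin hausdorff_weight_ge0.
have [_ [U [AU dU] <-] /ltW h] := lb_ereal_inf_adherent e0 fA.
by exists U.
Qed.

Section premeasure.
Variable delta : {posnum R}.
Let mu := @hausdorff_premeasure R n d delta%:num.

Lemma hausdorff_premeasure0 : mu set0 = 0.
Proof.
apply/eqP; rewrite eq_le; apply/andP; split; last first.
  apply: le_ereal_inf_tmp => _ [U _ <-].
  by apply: nneseries_ge0 => i _ _; rewrite lee_fin hausdorff_weight_ge0.
apply: le_trans (@hausdorff_premeasure_le _ _ (fun=> set0) _ _) _ => //.
by rewrite eseries0// => i _ _; rewrite hausdorff_weight0.
Qed.

Lemma hausdorff_premeasure_ge0 A : (0 <= mu A)%E.
Proof.
apply: le_ereal_inf_tmp => _ [U _ <-].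
by apply: nneseries_ge0 => i _ _; rewrite lee_fin hausdorff_weight_ge0.
Qed.

Lemma hausdorff_premeasure_sigma_subadditive A F :
  subset_sigma_subadditive mu A F.
Proof.
move=> AF; have [[i ioo]|] := pselect (exists i, mu (F i) = +oo%E).
  rewrite (eseries_pinfty _ _ ioo) ?leey// => k _.
  by rewrite -ltNye (lt_le_trans _ (hausdorff_premeasure_ge0 _)).
rewrite -forallNE => Foo.
apply/lee_addgt0Pr => e e0.
rewrite (le_trans _ (epsilon_trick _ _ (ltW e0)))//; last first.
  by move=> k; exact: hausdorff_premeasure_ge0.
have /choice[G GP] i : exists U, [/\ F i `<=` \bigcup_i U i, mesh_le delta%:num U &
    (\sum_(0 <= i <oo) (hausdorff_weight d (U i))%:E <=
     mu (F i) + (e / (2 ^ i.+1)%:R)%:E)%E].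
  apply: hausdorff_premeasure_adherent; first by rewrite divr_gt0.
  by rewrite ltey; exact/eqP/Foo.
have w0 i j : (0 <= (hausdorff_weight d (G i j))%:E)%E.
  by rewrite lee_fin hausdorff_weight_ge0.
(* A bijection of [nat] with [nat * nat] turns the covers [G i] of the sets [F i] into one sequence
   covering [A]. *)
have /card_esym/ppcard_eqP[f] := card_nat2.
apply: (@le_trans _ _
    (\sum_(0 <= k <oo) (hausdorff_weight d (G (f k).1 (f k).2))%:E)%E).
  apply: hausdorff_premeasure_le => [x /AF[i _ Fix]|k]; last first.
    by have [_ + _] := GP (f k).1; apply.
  have [/(_ _ Fix)[j _ Gijx] _ _] := GP i.
  by exists (f^-1%FUN (i, j)) => //=; rewrite invK ?inE.
rewrite nneseries_esumT//.
rewrite -(@reindex_esum R _ _ setT setT f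
    (fun p => (hausdorff_weight d (G p.1 p.2))%:E))//.
rewrite (_ : [set: nat * nat] = [set: nat] `*`` fun=> [set: nat]); last first.
  by apply/seteqP; split.
rewrite -(@esum_esum _ _ _ _ _ (fun i j => (hausdorff_weight d (G i j))%:E))//.
rewrite nneseries_esumT; last first.
  by move=> i; rewrite adde_ge0 ?hausdorff_premeasure_ge0// lee_fin divr_ge0// ltW.
apply: le_esum => i _; rewrite -nneseries_esumT//.
by have [_ _] := GP i.
Qed.

HB.instance Definition _ := isSubsetOuterMeasure.Build R 'rV[R]_n
  (@hausdorff_premeasure R n d delta%:num)
  hausdorff_premeasure0 hausdorff_premeasure_ge0
  hausdorff_premeasure_sigma_subadditive.

End premeasure.

Lemma hausdorff_premeasure_le_measure delta A : 0 < delta ->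
  (hausdorff_premeasure d delta A <= hausdorff_measure d A)%E.
Proof. by move=> d0; apply: ereal_sup_ubound; exists delta. Qed.

Lemma hausdorff_measure_le A (x : \bar R) :
  (forall delta, 0 < delta -> (hausdorff_premeasure d delta A <= x)%E) ->
  (hausdorff_measure d A <= x)%E.
Proof. by move=> h; apply: ge_ereal_sup => _ [delta d0 <-]; exact: h. Qed.

Lemma hausdorff_measure_ge0 A : (0 <= hausdorff_measure d A)%E.
Proof.
apply: le_trans (hausdorff_premeasure_le_measure A ltr01).
exact: (hausdorff_premeasure_ge0 1%:pos).
Qed.

Lemma hausdorff_measure0 : hausdorff_measure d (set0 : set 'rV[R]_n) = 0.
Proof.
apply/eqP; rewrite eq_le hausdorff_measure_ge0 andbT.
apply: hausdorff_measure_le => _/posnumP[delta].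
by rewrite hausdorff_premeasure0.
Qed.

Lemma hausdorff_measure_sigma_subadditive A F :
  subset_sigma_subadditive (@hausdorff_measure R n d) A F.
Proof.
move=> AF; apply: hausdorff_measure_le => _/posnumP[delta].
apply: (le_trans (hausdorff_premeasure_sigma_subadditive delta AF)).
apply: lee_nneseries => i *; first exact: hausdorff_premeasure_ge0.
exact: hausdorff_premeasure_le_measure.
Qed.

HB.instance Definition _ := isSubsetOuterMeasure.Build R 'rV[R]_n
  (@hausdorff_measure R n d) hausdorff_measure0 hausdorff_measure_ge0
  hausdorff_measure_sigma_subadditive.

Lemma hausdorff_premeasure_anti delta delta' A : delta <= delta' ->
  (hausdorff_premeasure d delta' A <= hausdorff_premeasure d delta A)%E.
Proof.
move=> dd'; apply: le_ereal_inf_tmp => _ [U [AU dU] <-].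
apply: hausdorff_premeasure_le => // i x y Ux Uy.
exact: le_trans (dU i _ _ Ux Uy) dd'.
Qed.

End hausdorff_outer_measure.

Lemma hausdorff_measure_lip (R : realType) m n d (f : 'rV[R]_m -> 'rV[R]_n)
    (c : R) (E : set 'rV[R]_m) : 0 < c ->
  (forall x y, E x -> E y -> enorm (f x - f y) <= c * enorm (x - y)) ->
  (hausdorff_measure d (f @` E) <= (c ^+ d)%:E * hausdorff_measure d E)%E.
Proof.
move=> c0 fc; apply: hausdorff_measure_le => delta delta0.
pose eta := delta / c.
have eta0 : 0 < eta by rewrite divr_gt0.
have cd0 : 0 < c ^+ d by rewrite exprn_gt0.
apply: (@le_trans _ _ ((c ^+ d)%:E * hausdorff_premeasure d eta E)%E); last first.
  by rewrite lee_wpmul2l ?lee_fin ?(ltW cd0)// hausdorff_premeasure_le_measure.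
apply/lee_addgt0Pr => e e0.
have [->|Eoo] := eqVneq (hausdorff_premeasure d eta E) +oo%E.
  by rewrite gt0_muley ?addye ?leey// lte_fin.
have [||U [EU dU]] := @hausdorff_premeasure_adherent _ _ d eta E (e / c ^+ d).
- by rewrite divr_gt0.
- by rewrite ltey.
have cd00 : (0 <= (c ^+ d)%:E)%E by rewrite lee_fin ltW.
move=> /(lee_wpmul2l cd00); rewrite ge0_muleDr//; last 2 first.
- exact: (hausdorff_premeasure_ge0 d (PosNum eta0)).
- by rewrite lee_fin divr_ge0 ?(ltW e0) ?(ltW cd0).
rewrite -EFinM mulrCA divff ?mulr1 ?gt_eqF// -nneseriesZl; last first.
  by move=> i _; rewrite lee_fin hausdorff_weight_ge0.
apply: le_trans; pose V i := f @` (U i `&` E).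
apply: (@le_trans _ _ (\sum_(0 <= i <oo) (hausdorff_weight d (V i))%:E)%E).
  apply: hausdorff_premeasure_le.
    by move=> _ [x Ex <-]; have [i _ Ux] := EU _ Ex; exists i => //; exists x.
  move=> i _ _ [x [Ux Ex] <-] [y [Uy Ey] <-]; apply: le_trans (fc _ _ Ex Ey) _.
  by rewrite mulrC -ler_pdivlMr//; exact: dU Ux Uy.
apply: lee_nneseries => i *; first by rewrite lee_fin hausdorff_weight_ge0.
rewrite -EFinM lee_fin; apply: (@hausdorff_weight_lip _ _ _ _ _ _ eta) => //.
  exact: ltW.
exact: dU.
Qed.

Lemma hausdorff_measure_lip2 (R : realType) (T : Type) m n d
    (f : T -> 'rV[R]_m) (g : T -> 'rV[R]_n) (c : R) (X : set T) : 0 < c ->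
  (forall x y, X x -> X y -> enorm (g x - g y) <= c * enorm (f x - f y)) ->
  (hausdorff_measure d (g @` X) <= (c ^+ d)%:E * hausdorff_measure d (f @` X))%E.
Proof.
move=> c0 gf.
have /choice[h hE] : forall y, exists z, forall x, X x -> f x = y -> g x = z.
  move=> y; have [[x Xx xy]|nX] := pselect (exists2 x, X x & f x = y).
    exists (g x) => x' Xx' x'y; apply/eqP; rewrite -subr_eq0 -enorm_eq0.
    rewrite eq_le enorm_ge0 andbT (le_trans (gf _ _ Xx' Xx))//.
    by rewrite x'y xy subrr enorm0 mulr0.
  by exists 0 => x Xx xy; exfalso; apply: nX; exists x.
rewrite (_ : g @` X = h @` (f @` X)).
  apply: hausdorff_measure_lip => // _ _ [x Xx <-] [y Xy <-].
  by rewrite -!(hE _ _ _ erefl)//; exact: gf.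
rewrite image_comp; apply/seteqP; split => [_ [x Xx <-]|_ [x Xx <-]].
  by exists x => //=; rewrite (hE _ x Xx erefl).
by exists x => //=; rewrite (hE _ x Xx erefl).
Qed.

(** * Borel sets are measurable for Hausdorff measure *)

Section separated_outer_measure.
Context (R : realType) (T : Type) (mu : {outer_measure set T -> \bar R}).
Variable p : T -> R.
Hypothesis mu_separated : forall (A B : set T) (s t : R), s < t ->
  (forall x, A x -> p x <= s) -> (forall x, B x -> t <= p x) ->
  (mu A + mu B <= mu (A `|` B))%E.

(* Caratheodory's criterion: the layers [a_(j+1) <= p <= a_j] accumulating at
   the level [t] have a summable measure, because every other layer is
   separated from the previous ones. *)
Lemma caratheodory_sublevel (t : R) : mu.-caratheodory [set x | p x <= t].
Proof.
set F := [set x | p x <= t].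
apply: le_caratheodory_measurable => X.
have [->|Xoo] := eqVneq (mu X) +oo%E; first by rewrite leey.
pose a k : R := t + k.+1%:R^-1.
have ta k : t < a k by rewrite ltrDl invr_gt0.
have a_decr k : a k.+1 < a k by rewrite ltrD2l ltf_pV2 ?posrE// ltr_nat.
pose m k := mu (X `&` [set x | a k <= p x]).
pose r k := mu (X `&` [set x | a k.+1 <= p x <= a k]).
have mX k : (m k <= mu X)%E by exact: le_outer_measure.
have m_r k : (m k + r k.+1 <= m k.+2)%E.
  rewrite addeC; apply: le_trans (mu_separated (a_decr k) _ _) _.
  - by move=> x [_ /= /andP[]].
  - by move=> x [_ /=].
  apply: le_outer_measure => x [[Xx /= /andP[h _]]|[Xx /= h]]; split => //=.
  apply: le_trans h; apply: le_trans (ltW (a_decr _)) (ltW (a_decr _)).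
have r_sum N : (\sum_(0 <= k < N.+1) r k <= m N.+1 + m N)%E.
  elim: N => [|N ih].
    rewrite big_nat1 (@le_trans _ _ (m 1))//; last first.
      by rewrite leeDl//; exact: outer_measure_ge0.
    by apply: le_outer_measure => x [Xx /= /andP[h _]].
  rewrite big_nat_recr//= (le_trans (leeD2r _ ih))// -addeA [leRHS]addeC.
  by rewrite leeD2l.
have r_fin : (\sum_(0 <= k <oo) r k < +oo)%E.
  apply: (@le_lt_trans _ _ (mu X + mu X)%E); last first.
    by rewrite lte_add_pinfty// ltey.
  apply: lime_le; first by apply: is_cvg_nneseries => k *; exact: outer_measure_ge0.
  near=> N; have N0 : (0 < N)%N by near: N; exact: nbhs_infty_gt.
  by rewrite -(prednK N0) (le_trans (r_sum _))// leeD.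
have r_tail := nneseries_tail_cvg r_fin (fun k _ => outer_measure_ge0 mu _).
apply/lee_addgt0Pr => e e0.
have [N _ /(_ _ (leqnn N)) tailN] : \forall N \near \oo,
    (\sum_(N <= k <oo) r k < e%:E)%E.
  have /r_tail// : nbhs (0 : \bar R) [set y | (y < e%:E)%E].
  by apply: open_ereal_lt'; rewrite lte_fin.
have X_cover : X `&` ~` F `<=`
    (X `&` [set x | a N <= p x]) `|`
    \bigcup_(k in ~` `I_N) (X `&` [set x | a k.+1 <= p x <= a k]).
  move=> x [Xx /= /negP]; rewrite -ltNge => tx.
  have [?|axN] := leP (a N) (p x); [by left|right].
  have exk : exists k, a k <= p x.
    have /ltr_add_invr[k h] := tx; exists k; exact: ltW.
  case: (ex_minnP exk) => k hk kmin.
  have Nk : (N < k)%N.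
    rewrite ltnNge; apply/negP => kN; move: axN; rewrite ltNge => /negP; apply.
    by apply: le_trans hk; rewrite lerD2l lef_pV2 ?posrE// ler_nat.
  case: k hk kmin Nk => // k hk kmin Nk; exists k => /=; first by apply/negP; rewrite -leqNgt.
  split => //=; rewrite hk ltW// ltNge; apply/negP => /kmin.
  by rewrite ltnn.
apply: (@le_trans _ _ (mu (X `&` F) + (m N + e%:E))%E).
  rewrite leeD2l// (le_trans (le_outer_measure _ _ _ X_cover))//.
  rewrite (le_trans (outer_measureU2 _ _ _))// leeD2l//.
  rewrite (le_trans (outer_measure_sigma_subadditive_tail _ _ _))//.
  exact: ltW.
rewrite addeA leeD2r//; apply: le_trans (mu_separated (ta N) _ _) _.
- by move=> x [].
- by move=> x [].
by apply: le_outer_measure => x [[]|[]].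
Unshelve. all: by end_near. Qed.

End separated_outer_measure.

Section hausdorff_borel.
Context (R : realType) (n d : nat).
Implicit Types A B : set 'rV[R]_n.
Local Notation H := (@hausdorff_measure R n d).

Lemma hausdorff_weight_sub A B c : A `<=` B -> 
  (forall x y, B x -> B y -> enorm (x - y) <= c) ->
  hausdorff_weight d A <= hausdorff_weight d B.
Proof.
move=> AB Bc.
have := @hausdorff_weight_lip R n n d id 1 c B A ler01.
rewrite expr1n mul1r image_id setIidr//; apply => //.
by move=> x y _ _; rewrite mul1r.
Qed.

(** A covering set of diameter at most [delta < eta] cannot meet both [A] and [B], so its weight is
    charged to one of them only. *)
Lemma hausdorff_premeasure_separated (delta eta : R) A B : delta < eta ->
  (forall x y, A x -> B y -> eta <= enorm (x - y)) ->
  (hausdorff_premeasure d delta A + hausdorff_premeasure d delta B <=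
   hausdorff_premeasure d delta (A `|` B))%E.
Proof.
move=> de AB; apply: le_ereal_inf_tmp => _ [U [ABU dU] <-].
have wge0 (V : nat -> set 'rV[R]_n) i :
    (0 <= i)%N -> true -> (0 <= (hausdorff_weight d (V i))%:E)%E.
  by move=> _ _; rewrite lee_fin hausdorff_weight_ge0.
apply: (@le_trans _ _ (\sum_(0 <= i <oo) (hausdorff_weight d (U i `&` A))%:E +
    \sum_(0 <= i <oo) (hausdorff_weight d (U i `&` B))%:E)%E).
  apply: leeD; apply: hausdorff_premeasure_le.
  - by move=> x Ax; have [i _ Ux] := ABU x (or_introl Ax); exists i.
  - by move=> i x y [Ux _] [Uy _]; exact: (dU i).
  - by move=> x Bx; have [i _ Ux] := ABU x (or_intror Bx); exists i.
  - by move=> i x y [Ux _] [Uy _]; exact: (dU i).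
rewrite -nneseriesD; last 2 first.
- exact: wge0 (fun i => U i `&` A).
- exact: wge0 (fun i => U i `&` B).
apply: lee_nneseries => [i _ _|i _]; first by rewrite adde_ge0 ?lee_fin ?hausdorff_weight_ge0.
rewrite -EFinD lee_fin; have [UA0|] := eqVneq (U i `&` A) set0.
  by rewrite UA0 hausdorff_weight0 add0r (hausdorff_weight_sub _ (dU i)).
move=> /set0P[x [Ux Ax]]; rewrite (_ : U i `&` B = set0).
  by rewrite hausdorff_weight0 addr0 (hausdorff_weight_sub _ (dU i)).
apply/seteqP; split => // y [Uy By]; have := AB x y Ax By.
by rewrite leNgt => /negP; apply; rewrite (le_lt_trans (dU i _ _ Ux Uy)).
Qed.

Lemma hausdorff_measure_separated (eta : R) A B : 0 < eta ->
  (forall x y, A x -> B y -> eta <= enorm (x - y)) ->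
  (H A + H B <= H (A `|` B))%E.
Proof.
move=> eta0 AB; have [->|ABoo] := eqVneq (H (A `|` B)) +oo%E.
  by rewrite leey.
have HABfin : H (A `|` B) \is a fin_num.
  by rewrite ge0_fin_numE ?outer_measure_ge0// ltey.
have Hfin C : C `<=` A `|` B -> H C \is a fin_num.
  move=> CAB; rewrite ge0_fin_numE ?outer_measure_ge0//.
  by rewrite (le_lt_trans (le_outer_measure _ _ _ CAB))// ltey.
have HBfin : H B \is a fin_num by apply: Hfin => x; right.
rewrite -leeBrDr//; apply: hausdorff_measure_le => r r0.
have rfin : hausdorff_premeasure d r A \is a fin_num.
  rewrite ge0_fin_numE; last exact: (hausdorff_premeasure_ge0 d (PosNum r0)).
  rewrite (le_lt_trans (hausdorff_premeasure_le_measure _ _ r0))//.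
  by rewrite -ge0_fin_numE ?outer_measure_ge0// Hfin// => x; left.
rewrite leeBrDr// addeC -leeBrDr//; apply: hausdorff_measure_le => s s0.
rewrite leeBrDr//.
(* The premeasure grows as the mesh shrinks, so one mesh below [r], [s] and [eta] serves both sets
   at once. *)
pose t := Num.min (Num.min r s) (eta / 2).
have t0 : 0 < t by rewrite !lt_min r0 s0 divr_gt0.
apply: (@le_trans _ _ (hausdorff_premeasure d t B + hausdorff_premeasure d t A)%E).
  by apply: leeD; apply: hausdorff_premeasure_anti; rewrite /t !ge_min lexx ?orbT.
rewrite addeC (le_trans (@hausdorff_premeasure_separated t eta _ _ _ AB))//.
  by rewrite /t !gt_min ltr_pdivrMr// mulr_natr mulr2n ltrDl eta0 !orbT.
exact: hausdorff_premeasure_le_measure.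
Qed.

(** Coordinate half-spaces satisfy Caratheodory's condition, because sets separated in one
    coordinate are at positive distance. Hence the identity map is measurable from the Caratheodory
    sigma-algebra to the Borel one. *)
Lemma borel_caratheodory_hausdorff (A : set (borelRn R n)) : measurable A ->
  H.-caratheodory A.
Proof.
move=> mA; pose U := caratheodory_type H.
have mid : measurable_fun [set: U] (id : U -> borelRn R n).
  apply: (@measurable_fun_rV R _ U n id) => i.
  apply: (measurability _ (RGenOInfty.measurableE R)) => // _ [_ [t ->] <-].
  rewrite setTI (_ : _ @^-1` _ = ~` [set x : 'rV[R]_n | x ord0 i <= t]).
    apply: (@measurableC _ U).
    apply: (caratheodory_sublevel (p := fun x : 'rV[R]_n => x ord0 i)).
    move=> B C s t' st' Bs Ct; apply: (@hausdorff_measure_separated (t' - s)).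
      by rewrite subr_gt0.
    move=> x y /Bs xs /Ct yt; rewrite enorm_distC.
    apply: le_trans (coord_le_enorm _ i); rewrite !mxE.
    by apply: le_trans (ler_norm _); rewrite lerB.
  by apply/seteqP; split => x /=; rewrite in_itv/= andbT ltNge => /negP.
by have := mid measurableT _ mA; rewrite setTI preimage_id.
Qed.

End hausdorff_borel.

(** * Euclidean topology, Borel hulls and grids *)

Section enorm_topology.
Context (R : realType) (n : nat).

Lemma enorm_lipschitz_continuous (V : normedModType R) (f : 'rV[R]_n -> V)
  (C : R) : 0 <= C ->
  (forall x y, `|f x - f y| <= C * enorm (x - y)) -> continuous f.
Proof.
move=> C0 fC x.
apply: ((@cvgrPdist_lt _ _ _ _ (nbhs_filter x) f (f x)).2) => e e0.
have D0 : 0 < C * n%:R + 1 by rewrite ltr_wpDl// mulr_ge0.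
near=> y; rewrite (le_lt_trans (fC _ _))//.
rewrite (le_lt_trans (ler_wpM2l C0 (enorm_le_norm _)))// mulrA.
have : `|x - y| < e / (C * n%:R + 1).
  near: y; have := nbhsx_ballx x _ (divr_gt0 e0 D0).
  by rewrite -ball_normE.
rewrite ltr_pdivlMr// mulrC; apply: le_lt_trans.
by rewrite ler_wpM2r// lerDl.
Unshelve. all: by end_near. Qed.

Lemma enorm_continuous : continuous (@enorm R n).
Proof.
apply: (@enorm_lipschitz_continuous _ _ 1) => // x y; rewrite mul1r.
exact: enorm_lip.
Qed.

Lemma enormB_continuous (y : 'rV[R]_n) : continuous (fun x : 'rV[R]_n => enorm (x - y)).
Proof.
apply: (@enorm_lipschitz_continuous R^o _ 1) => // x z; rewrite mul1r.
by rewrite (le_trans (enorm_lip _ _))// opprB addrA subrK.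
Qed.

Lemma dotp_continuous (y : 'rV[R]_n) : continuous (fun x : 'rV[R]_n => dotp x y).
Proof.
apply: (@enorm_lipschitz_continuous R^o _ (enorm y)) => [|x z].
  exact: enorm_ge0.
by rewrite -dotpBl mulrC; exact: cauchy_schwarz.
Qed.

Lemma closure_enorm_le (U : set 'rV[R]_n) (c : R) :
  (forall x y, U x -> U y -> enorm (x - y) <= c) ->
  forall x y, closure U x -> closure U y -> enorm (x - y) <= c.
Proof.
have cl y : closed [set x : 'rV[R]_n | enorm (x - y) <= c].
  apply: (@closed_comp _ _ (fun x : 'rV[R]_n => enorm (x - y)) [set t | t <= c]).
    by move=> x _; exact: enormB_continuous.
  exact: closed_le.
have sub (V W : set 'rV[R]_n) : closed W -> V `<=` W -> closure V `<=` W.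
  by move=> cW VW; rewrite closureE => x; apply.
move=> Uc x y clx cly.
apply: (sub U [set x : 'rV[R]_n | enorm (x - y) <= c]) => // u Uu /=.
rewrite enorm_distC.
by apply: (sub U [set x : 'rV[R]_n | enorm (x - u) <= c]) => // v Uv; exact: Uc.
Qed.

End enorm_topology.

Lemma mulmxr_continuous (R : realType) m n (A : 'M[R]_(m, n)) :
  continuous (fun x : 'rV[R]_m => x *m A).
Proof.
have [C C0 hC] := mulmx_enorm_bound A.
apply: (@enorm_lipschitz_continuous _ _ _ _ C (ltW C0)) => x y.
by rewrite -mulmxBl (le_trans (norm_le_enorm _)).
Qed.

Lemma closed_measurable_rV (R : realType) n (A : set 'rV[R]_n) :
  closed A -> measurable (A : set (borelRn R n)).
Proof.
move=> cA; rewrite -(setCK A); apply: (@measurableC _ (borelRn R n)).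
by apply: sub_sigma_algebra; exact: closed_openC.
Qed.

Lemma fin_outer_measure_subadditive (R : realType) T
    (mu : {outer_measure set T -> \bar R}) (J : finType) (F : J -> set T) A :
  (forall x, A x -> exists j, F j x) -> (mu A <= \sum_j mu (F j))%E.
Proof.
move=> AF.
suff seqF (s : seq J) : (mu [set x | exists2 j, j \in s & F j x] <=
    \sum_(j <- s) mu (F j))%E.
  apply: le_trans (seqF _); apply: le_outer_measure => x /AF[j Fjx].
  by exists j => //; rewrite mem_index_enum.
elim: s => [|j s ih].
  rewrite big_nil (_ : [set x | _] = set0) ?outer_measure0//.
  by apply/seteqP; split => // x [].
rewrite big_cons; apply: (@le_trans _ _ (mu (F j) +
    mu [set x | exists2 j, j \in s & F j x])%E); last by rewrite leeD2l.
apply: le_trans (outer_measureU2 _ _ _); apply: le_outer_measure => x [k].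
by rewrite inE => /orP[/eqP->|ks] Fk; [left|right; exists k].
Qed.

(** Taking closures does not increase diameters, so nearly optimal covers may be taken closed; [G]
    is the intersection over k of the unions of such covers of mesh 1/(k+1). The hull extends to
    arbitrary sets the scaling law obtained for Borel sets. *)
Lemma hausdorff_borel_hull (R : realType) n d (E : set 'rV[R]_n) :
  exists G : set (borelRn R n), [/\ measurable G, E `<=` G &
    (hausdorff_measure d (G : set 'rV[R]_n) <= hausdorff_measure d E)%E].
Proof.
have [Eoo|Eoo] := eqVneq (hausdorff_measure d E) +oo%E.
  by exists setT; split => //; rewrite Eoo leey.
have e0 (k : nat) : 0 < k.+1%:R^-1 :> R by rewrite invr_gt0.
have /choice[U UP] k : exists U, [/\ E `<=` \bigcup_i U i, mesh_le k.+1%:R^-1 U &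
    (\sum_(0 <= i <oo) (hausdorff_weight d (U i))%:E <=
     hausdorff_premeasure d k.+1%:R^-1 E + k.+1%:R^-1%:E)%E].
  apply: hausdorff_premeasure_adherent => //.
  by rewrite (le_lt_trans (hausdorff_premeasure_le_measure _ _ _))// ltey.
have clU k i x y : closure (U k i) x -> closure (U k i) y ->
    enorm (x - y) <= ediam (U k i).
  apply: closure_enorm_le => {}x {}y Ux Uy; apply: ediam_ub Ux Uy => u v.
  by have [_ + _] := UP k; apply.
exists (\bigcap_k \bigcup_i closure (U k i)); split.
- apply: bigcapT_measurable => k; apply: bigcupT_measurable => i.
  by apply: closed_measurable_rV; exact: closed_closure.
- move=> x Ex k _; have [/(_ _ Ex)[i _ Ux] _ _] := UP k.
  by exists i => //; exact: subset_closure.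
apply: hausdorff_measure_le => delta delta0; apply/lee_addgt0Pr => e e1.
have [k ke] : exists k, k.+1%:R^-1 < Num.min delta e.
  have := @ltr_add_invr R 0 (Num.min delta e); rewrite lt_min delta0 e1.
  by move=> /(_ erefl)[k]; rewrite add0r; exists k.
have [kd {}ke] : k.+1%:R^-1 <= delta /\ k.+1%:R^-1 <= e.
  by move: ke; rewrite lt_min => /andP[/ltW-> /ltW->].
apply: le_trans (hausdorff_premeasure_anti _ _ kd) _.
have [_ dU sU] := UP k.
apply: (@le_trans _ _ (hausdorff_premeasure d k.+1%:R^-1 E + k.+1%:R^-1%:E)%E); last first.
  by rewrite leeD ?lee_fin// hausdorff_premeasure_le_measure.
apply: le_trans sU; apply: (@le_trans _ _
    (\sum_(0 <= i <oo) (hausdorff_weight d (closure (U k i)))%:E)%E).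
  apply: hausdorff_premeasure_le => [x /(_ k Logic.I)//|i x y clx cly].
  apply: le_trans (clU _ _ _ _ clx cly) _.
  have [->|U0] := pselect (U k i = set0); last first.
    by apply: ediam_le (dU i); exact/set0P/eqP.
  have -> : ediam (set0 : set 'rV[R]_n) = 0.
    by rewrite /ediam set0X image_set0 sup0.
  exact: ltW.
apply: lee_nneseries => i *; first by rewrite lee_fin hausdorff_weight_ge0.
rewrite lee_fin [leRHS]/hausdorff_weight; case: asboolP => [U0|U0].
  by rewrite U0 closure0 hausdorff_weight0.
by apply: hausdorff_weight_le (clU k i); exact: ediam_ge0.
Qed.

Section grid.
Context (R : realType) (n : nat) (a : R) (N : nat).
Hypothesis a0 : 0 < a.

(** Cubes of side [2 * a / N.+1] that partition [-a, a)^n. They are half-open so as to be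
    disjoint. *)
Definition grid_cell (j : {ffun 'I_n -> 'I_N.+1}) : set 'rV[R]_n :=
  [set x | forall i, (j i)%:R <= (x ord0 i + a) * (N.+1%:R / (2 * a)) < (j i).+1%:R].

Lemma grid_cellI j j' x : grid_cell j x -> grid_cell j' x -> j = j'.
Proof.
move=> jx j'x; apply/ffunP => i; apply/val_inj/eqP => /=.
have /andP[j1 j2] := jx i; have /andP[j'1 j'2] := j'x i.
have := le_lt_trans j1 j'2; have := le_lt_trans j'1 j2.
by rewrite !ltr_nat !ltnS eqn_leq => -> ->.
Qed.

Lemma grid_cover (x : 'rV[R]_n) : (forall i, `|x ord0 i| < a) -> exists j, grid_cell j x.
Proof.
move=> xa; pose y i := (x ord0 i + a) * (N.+1%:R / (2 * a)).
have k0 : 0 < N.+1%:R / (2 * a) by rewrite divr_gt0// mulr_gt0.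
have y0 i : 0 <= y i.
  by rewrite mulr_ge0 ?(ltW k0)//; have := xa i; rewrite ltr_norml; lra.
have yN i : y i < N.+1%:R.
  have -> : N.+1%:R = (2 * a) * (N.+1%:R / (2 * a)) by field; rewrite gt_eqF.
  by rewrite ltr_pM2r//; have := xa i; rewrite ltr_norml; lra.
have tN i : (Num.truncn (y i) < N.+1)%N.
  rewrite -(@ltr_nat R); apply: le_lt_trans (yN i).
  by have /andP[] := truncn_itv (y0 i).
exists [ffun i => Ordinal (tN i)] => i; rewrite ffunE/=; exact: truncn_itv.
Qed.

Lemma grid_mesh j x y : grid_cell j x -> grid_cell j y ->
  enorm (x - y) <= n%:R * (2 * a / N.+1%:R).
Proof.
move=> jx jy; rewrite (le_trans (enorm_le_sum _))// mulr_natl.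
apply: (@le_trans _ _ (\sum_(i < n) (2 * a / N.+1%:R))); last first.
  by rewrite sumr_const card_ord.
apply: ler_sum => i _; rewrite !mxE.
have k0 : 0 < N.+1%:R / (2 * a) by rewrite divr_gt0// mulr_gt0.
rewrite -(ler_pM2r k0) (_ : 2 * a / N.+1%:R * _ = 1); last first.
  by field; rewrite nat1r pnatr_eq0 gt_eqF.
rewrite -[X in _ * X]gtr0_norm// -normrM ler_norml.
by have := jx i; have := jy i; rewrite -!natr1; lra.
Qed.

End grid.

(** The cube is covered by [N.+1 ^ d] cells of weight at most [fine (omega R d) * (d%:R * a /
    N.+1%:R) ^+ d]; the product [w] does not depend on [N], hence not on the mesh. *)
Lemma hausdorff_cube_lty (R : realType) d (a : R) : 0 < a ->
  (hausdorff_measure d [set x : 'rV[R]_d | forall i, (`|x ord0 i| < a)%R] < +oo)%E.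
Proof.
move=> a0; set Q := [set x | _].
pose w : R := fine (omega R d) * (d%:R * a) ^+ d.
apply: (@le_lt_trans _ _ w%:E); last by rewrite ltry.
apply: hausdorff_measure_le => delta delta0.
have [N Nd] : exists N : nat, d%:R * (2 * a / N.+1%:R) <= delta.
  have := @ltr_add_invr R 0 (delta / (d%:R * (2 * a) + 1)).
  have D0 : 0 < d%:R * (2 * a) + 1 by rewrite ltr_wpDl// !mulr_ge0// ltW.
  rewrite divr_gt0// => /(_ erefl)[N]; rewrite add0r ltr_pdivlMr// mulrDr.
  move=> h; exists N; rewrite mulrA mulrC; apply: le_trans (ltW h).
  by rewrite lerDl mulr1 invr_ge0.
have delta0' : 0 <= d%:R * (2 * a / N.+1%:R) :> R by rewrite !mulr_ge0// ltW.
apply: (@le_trans _ _ (\sum_(j : {ffun 'I_d -> 'I_N.+1})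
    hausdorff_premeasure d delta (grid_cell a j))%E).
  apply: (fin_outer_measure_subadditive (@hausdorff_premeasure R d d (PosNum delta0)%:num)).
  by move=> x; exact: grid_cover.
apply: (@le_trans _ _ (\sum_(j : {ffun 'I_d -> 'I_N.+1})
    (fine (omega R d) * (d%:R * (2 * a / N.+1%:R) / 2) ^+ d)%:E)%E).
  apply: lee_sum => j _.
  (* Padding by empty sets is free even for [d = 0], since [hausdorff_weight] sends the empty set to
     0. *)
  pose U (i : nat) : set 'rV[R]_d := if i is 0%N then grid_cell a j else set0.
  apply: (@le_trans _ _ (\sum_(0 <= i <oo) (hausdorff_weight d (U i))%:E)%E).
    apply: hausdorff_premeasure_le; first by move=> x jx; exists 0%N.
    case => [|i] x y //= jx jy; apply: le_trans Nd; exact: grid_mesh jx jy.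
  rewrite nneseries_recl//; last first.
    by move=> k; rewrite lee_fin hausdorff_weight_ge0.
  rewrite eseries_cond/= eseries0 ?adde0; last first.
    by case=> // k *; rewrite /= hausdorff_weight0.
  rewrite lee_fin; apply: hausdorff_weight_le => // x y; exact: grid_mesh.
rewrite sumEFin lee_fin sumr_const card_ffun !card_ord -[leLHS]mulr_natl.
rewrite natrX mulrCA -exprMn.
rewrite ler_wpM2l ?fine_ge0// le_eqVlt; apply/orP; left; apply/eqP.
by congr (_ ^+ _); field; rewrite nat1r pnatr_eq0.
Qed.

(** * Lebesgue measure under linear maps *)

Section matrix_characters.
Context (R : realFieldType).

Lemma muld_eq1 (s : R) : 0 < s -> s * s = 1 -> s = 1.
Proof.
move=> s0 /eqP; rewrite -expr2 -subr_eq0 subr_sqr_1 mulf_eq0 => /orP[|].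
  by rewrite subr_eq0 => /eqP.
by rewrite gt_eqF// ltr_wpDl// ltW.
Qed.

(** The homomorphisms from GL_n(R) to the positive reals; the factor by which a matrix scales
    Lebesgue measure is going to be one of them. *)
Definition mx_character n (s : 'M[R]_n -> R) :=
  [/\ s 1%:M = 1, forall M, M \in unitmx -> 0 < s M &
    forall M N, M \in unitmx -> N \in unitmx -> s (M *m N) = s M * s N].

Lemma unitmx_trig n (L : 'M[R]_n) :
  (forall i j : 'I_n, (i <= j)%N -> L i j = (i == j)%:R) -> \det L = 1.
Proof.
move=> hL; rewrite det_trig.
  by apply: big1 => i _; rewrite hL// eqxx.
apply/is_trig_mxP => i j ij; rewrite hL ?(ltnW ij)//.
by rewrite (_ : (i == j) = false)//; apply/negbTE; move: ij; rewrite ltn_neqAle => /andP[].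
Qed.

(* A transvection [[1, 0], [b, 1]] is conjugate to its inverse by
   diag(-1, 1, ..., 1), so its character is 1. *)
Lemma mx_character_unitrig n (s : 'M[R]_n -> R) (L : 'M[R]_n) :
  mx_character s -> (forall i j : 'I_n, (i <= j)%N -> L i j = (i == j)%:R) ->
  s L = 1.
Proof.
elim: n => [|n ih] in s L *.
  by move=> [s1 _ _] _; rewrite (_ : L = 1%:M)//; apply/matrixP => -[].
move=> [s1 s_gt0 sM] hL.
pose L' : 'M[R]_(1 + n) := L.
have -> : L = L' by [].
pose E (b : 'M[R]_(n, 1)) : 'M[R]_(1 + n) := block_mx 1%:M 0 b 1%:M.
pose D (M : 'M[R]_n) : 'M[R]_(1 + n) := block_mx 1%:M 0 0 M.
have EE b : E b *m E (- b) = 1%:M.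
  rewrite mulmx_block !mul1mx !mulmx1 ?mul0mx ?mulmx0 ?addr0 ?add0r subrr.
  by rewrite -scalar_mx_block.
have uE b : E b \in unitmx by have /mulmx1_unit[] := EE b.
pose J : 'M[R]_(1 + n) := block_mx (-1)%:M 0 0 1%:M.
have JJ : J *m J = 1%:M.
  rewrite mulmx_block ?mulmx1 ?mul1mx ?mul0mx ?mulmx0 ?addr0 ?add0r.
  by rewrite -scalar_mxM mulrNN mulr1 -scalar_mx_block.
have uJ : J \in unitmx by have /mulmx1_unit[] := JJ.
have JEJ b : J *m E b *m J = E (- b).
  rewrite /J /E !mulmx_block ?mulmx1 ?mul1mx ?mul0mx ?mulmx0 ?addr0 ?add0r.
  rewrite -scalar_mxM mulrNN mulr1; congr block_mx.
  by rewrite mul_mx_scalar scaleN1r.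
have sJ : s J = 1 by apply: muld_eq1; [exact: s_gt0|rewrite -sM// JJ s1].
have sE b : s (E b) = 1.
  apply: muld_eq1; first exact: s_gt0.
  rewrite -{1}[X in X * _]mul1r -[X in X * _]mulr1 -{1}sJ -sJ -!sM ?unitmx_mul ?uJ ?uE//.
  by rewrite JEJ -{2}(opprK b) EE s1.
have ulL : ulsubmx L' = 1%:M.
  apply/matrixP => i j; rewrite !ord1 mxE mxE mxE /L' hL//.
have urL : ursubmx L' = 0.
  apply/matrixP => i j; rewrite !ord1 mxE mxE mxE /L' hL// -val_eqE/=.
have lrL (i j : 'I_n) : (i <= j)%N -> drsubmx L' i j = (i == j)%:R.
  by move=> ij; rewrite !mxE /L' hL ?leq_add2l// -!val_eqE/= eqn_add2l.
have -> : L' = E (dlsubmx L') *m D (drsubmx L').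
  rewrite -{1}(submxK L') ulL urL /E /D mulmx_block.
  by rewrite ?mulmx1 ?mul1mx ?mul0mx ?mulmx0 ?addr0 ?add0r.
have uD (M : 'M[R]_n) : M \in unitmx -> D M \in unitmx.
  by rewrite !unitmxE det_lblock det1 mul1r.
have uL : drsubmx L' \in unitmx by rewrite unitmxE unitmx_trig// unitr1.
rewrite sM ?uE ?uD// sE mul1r.
apply: (ih (s \o D)) => //; split => /=.
- by rewrite /D -scalar_mx_block.
- by move=> M uM; rewrite s_gt0 ?uD.
- move=> M N uM uN; have -> : D (M *m N) = D M *m D N; last by rewrite sM ?uD.
  by rewrite mulmx_block ?mulmx1 ?mul0mx ?mulmx0 ?addr0 ?add0r.
Qed.

(** By LUP decomposition an invertible matrix is a product of a permutation matrix, two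
    unitriangular matrices and a diagonal one. All but the diagonal factor have character 1 and
    determinant of absolute value 1. *)
Lemma mx_character_det n (s : 'M[R]_n -> R) : mx_character s ->
  (forall d : 'rV[R]_n, (forall i, d ord0 i != 0) ->
    s (diag_mx d) = \prod_i `|d ord0 i|) ->
  forall M, M \in unitmx -> s M = `|\det M|.
Proof.
case: n s => [|n] s s_char s_diag M uM.
  have [s1 _ _] := s_char.
  by rewrite (_ : M = 1%:M) ?s1 ?det1 ?normr1//; apply/matrixP => -[].
have [s1 s_gt0 sM] := s_char.
have := cormen_lup_correct M; have := cormen_lup_perm M.
have := @cormen_lup_lower R n M; have := @cormen_lup_upper R n M.
case: cormen_lup => [[P L] U] /= hU hL /is_perm_mxP[p ->] {P}.
rewrite -[_ * M]/(_ *m M) -[L * U]/(L *m U) => PLU.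
have uP (q : 'S_n.+1) : (perm_mx q : 'M[R]_n.+1) \in unitmx by exact: unitmx_perm.
(* A permutation has finite order, and 1 is the only positive root of unity. *)
have sP : s (perm_mx p) = 1.
  have sPk k : s (perm_mx (p ^+ k)%g) = s (perm_mx p) ^+ k.
    by elim: k => [|k ih]; rewrite ?expg0 ?perm_mx1// expgS perm_mxM sM// ih exprS.
  have := sPk #[p]%g; rewrite expg_order perm_mx1 s1 => /esym/eqP.
  by rewrite pexpr_eq1 ?order_gt0// ?(ltW (s_gt0 _ _))// => /eqP.
have detL : \det L = 1 by exact: unitmx_trig.
have detPLU : \det (perm_mx p) * \det M = \det U.
  by rewrite -det_mulmx PLU det_mulmx detL mul1r.
have absU : `|\det M| = `|\det U|.
  by rewrite -detPLU normrM det_perm normrX normrN1 expr1n mul1r.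
have uL : L \in unitmx by rewrite unitmxE detL unitr1.
have uU : U \in unitmx.
  by rewrite unitmxE unitfE -normr_gt0 -absU normr_gt0 -unitfE -unitmxE.
have -> : s M = s U.
  have := congr1 s PLU; rewrite !sM// sP mul1r => ->.
  by rewrite (mx_character_unitrig s_char) ?mul1r.
have detU : \det U = \prod_i U i i.
  rewrite -det_tr det_trig; first by apply: eq_bigr => i _; rewrite mxE.
  by apply/is_trig_mxP => i j ij; rewrite mxE hU.
have U0 i : U i i != 0.
  by move: uU; rewrite unitmxE unitfE detU => /prodf_neq0; apply.
pose d : 'rV[R]_n.+1 := \row_i U i i.
(* Dividing each row of [U] by its diagonal entry leaves an upper unitriangular matrix, whose
   transpose falls under [mx_character_unitrig]. *)
pose V := \matrix_(i, j) ((U i i)^-1 * U i j).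
have UdV : U = diag_mx d *m V.
  by apply/matrixP => i j; rewrite mul_diag_mx !mxE mulrA divff// mul1r.
have V1 : \det V^T = 1.
  apply: unitmx_trig => i j ij; rewrite !mxE.
  have [->|ne] := eqVneq i j; first by rewrite mulVf.
  by rewrite (hU j i) ?mulr0// ltn_neqAle ij andbT.
have uV : V \in unitmx by rewrite unitmxE -det_tr V1 unitr1.
have ud : diag_mx d \in unitmx.
  by rewrite unitmxE det_diag unitfE; apply/prodf_neq0 => i _; rewrite mxE.
rewrite {1}UdV sM// s_diag; last by move=> i; rewrite mxE.
have -> : s V = 1.
  (* Transposition reverses products, but the values of [s] commute, so [s \o trmx] is again a
     character. *)
  rewrite -(trmxK V); apply: (@mx_character_unitrig _ (s \o trmx)).
    split => /= [|N uN|N N' uN uN']; first by rewrite trmx1.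
      by rewrite s_gt0// unitmx_tr.
    by rewrite trmx_mul sM ?unitmx_tr// mulrC.
  move=> i j ij; rewrite !mxE.
  have [->|ne] := eqVneq i j; first by rewrite mulVf.
  by rewrite (hU j i) ?mulr0// ltn_neqAle ij andbT.
rewrite mulr1 absU detU normr_prod; apply: eq_bigr => i _; by rewrite mxE.
Qed.

End matrix_characters.

Section lebesgue_shift.
Context (R : realType).

Lemma measurable_mulmxr n m (M : 'M[R]_(n, m)) :
  measurable_fun [set: borelRn R n]
    ((fun x => (x : 'rV[R]_n) *m M) : borelRn R n -> borelRn R m).
Proof.
apply: measurable_fun_rV => i.
rewrite (_ : (fun _ => _) = (fun x : borelRn R n => \sum_j (x : 'rV[R]_n) ord0 j * M j i)).
  apply: measurable_sum => j; apply: measurable_funM => //.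
  exact: measurable_coord.
by apply/funext => x; rewrite mxE.
Qed.

Lemma preimage_measurable d d' (T : measurableType d) (U : measurableType d')
  (f : T -> U) (A : set U) : measurable_fun [set: T] f -> measurable A ->
  measurable (f @^-1` A).
Proof. by move=> mf mA; rewrite -[X in measurable X]setTI; exact: mf. Qed.

Lemma lebesgue_measure_addr (c : R) (A : set R) : measurable A ->
  lebesgue_measure ((fun x => x + c) @^-1` A) = lebesgue_measure A.
Proof.
move=> mA; apply/esym.
have mc : measurable_fun [set: measurableTypeR R]
    ((fun x => x + c) : measurableTypeR R -> measurableTypeR R).
  exact: measurable_funD.
pose m := measure_function_pushforward__canonical__measure_function_Measure
  (@lebesgue_measure R) mc.
apply: (@lebesgue_measure_unique R m) => //= _ [[a b] _ <-].
rewrite /pushforward (_ : _ @^-1` _ = `]a - c, b - c]%classic).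
  rewrite !lebesgue_measure_itv/= !lte_fin ltrD2r; case: ifPn => // _.
  by rewrite -!EFinB; congr _%:E; ring.
by apply/seteqP; split => x /=; rewrite !in_itv/= ltrBlDr lerBrDr.
Qed.

Lemma ge0_integral_addr (c : R) (f : R -> \bar R) : measurable_fun [set: R] f ->
  (forall x, 0 <= f x)%E ->
  (\int[@lebesgue_measure R]_x f (x + c)%R = \int[lebesgue_measure]_x f x)%E.
Proof.
move=> mf f0.
have mc : measurable_fun [set: measurableTypeR R]
    ((fun x => x + c) : measurableTypeR R -> measurableTypeR R).
  exact: measurable_funD.
rewrite -[LHS]/(\int[lebesgue_measure]_(x in (fun x : R => x + c)%R @^-1` setT)
  (f \o (fun x : R => x + c)%R) x)%E.
rewrite -(@ge0_integral_pushforward _ _ (measurableTypeR R) (measurableTypeR R) R _ mc)//.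
by apply: eq_measure_integral => A mA _; exact: lebesgue_measure_addr.
Qed.

Lemma rV_ext n (u v : 'rV[R]_n) : (forall i, u ord0 i = v ord0 i) -> u = v.
Proof. by move=> uv; apply/rowP => i; exact: uv. Qed.

Lemma cons_rV_ord0 n (p : R * borelRn R n) : (cons_rV p : 'rV[R]_n.+1) ord0 ord0 = p.1.
Proof. by have /(congr1 fst) := cons_rVK p. Qed.

Lemma cons_rV_lift n (p : R * borelRn R n) i :
  (cons_rV p : 'rV[R]_n.+1) ord0 (lift ord0 i) = (p.2 : 'rV[R]_n) ord0 i.
Proof. by have /(congr1 snd)/rowP/(_ i) := cons_rVK p; rewrite mxE. Qed.

Lemma behead_rVK n : cancel (@behead_rV R n) (@cons_rV R n).
Proof.
move=> x; apply: rV_ext => i; case: (unliftP ord0 i) => [j|] ->.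
  by rewrite cons_rV_lift mxE.
by rewrite cons_rV_ord0.
Qed.

Lemma cons_rVD n (x y : R) (v w : 'rV[R]_n) :
  cons_rV (x + y, (v + w : borelRn R n)) =
  (cons_rV (x, (v : borelRn R n)) : 'rV[R]_n.+1) + cons_rV (y, (w : borelRn R n)).
Proof.
apply: rV_ext => i; rewrite [RHS]mxE; case: (unliftP ord0 i) => [j|] ->.
  by rewrite !cons_rV_lift mxE.
by rewrite !cons_rV_ord0.
Qed.

(** Induction along the iterated product: the first coordinate of [c] translates the outer integral,
    the others translate each slice. *)
Lemma lebesgue_rV_addr n (c : 'rV[R]_n) (A : set (borelRn R n)) : measurable A ->
  lebesgue_rV R n ((fun x : 'rV[R]_n => x + c) @^-1` A) = lebesgue_rV R n A.
Proof.
elim: n c A => [|n ih] c A mA.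
  congr (lebesgue_rV R 0 _); apply/funext => x /=.
  by rewrite (_ : x + c = x)//; apply/rowP => -[].
rewrite [LHS]/= [RHS]/= /lebesgue_rV_succ /pushforward /product_measure1.
set B := @cons_rV R n @^-1` A.
have mB : measurable B := preimage_measurable (@measurable_cons_rV R n) mA.
pose c0 := (behead_rV c).1; pose c' : 'rV[R]_n := (behead_rV c).2.
rewrite -(@ge0_integral_addr c0 (lebesgue_rV R n \o xsection B)); last 2 first.
- exact: measurable_fun_xsection.
- by [].
apply: eq_integral => x _ /=.
rewrite -(ih c' (xsection B (x + c0))); last exact: measurable_xsection.
congr (lebesgue_rV R n _); rewrite /xsection; apply/funext => v.
rewrite /= !inE /B /= cons_rVD -[X in A (_ + X)]behead_rVK.
by [].
Qed.

End lebesgue_shift.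

(** * Uniqueness of translation invariant measures *)

Section translation_invariant.
Context (R : realType) (n : nat).
Implicit Types A Q : set (borelRn R n).

Definition translation_invariant (mu : set (borelRn R n) -> \bar R) :=
  forall (c : 'rV[R]_n) A, measurable A ->
    mu ((fun x : 'rV[R]_n => x + c) @^-1` A) = mu A.

Lemma measurable_oppr_rV :
  measurable_fun [set: borelRn R n] ((fun x => - x) : borelRn R n -> borelRn R n).
Proof.
apply: measurable_fun_rV => i.
rewrite (_ : (fun _ => _) = (fun x : borelRn R n => - (x : 'rV[R]_n) ord0 i)).
  by apply: measurableT_comp => //; exact: measurable_coord.
by apply/funext => x; rewrite mxE.
Qed.

Lemma measurable_add_rV : measurable_fun [set: borelRn R n * borelRn R n]
  ((fun p => (p.1 : 'rV[R]_n) + (p.2 : 'rV[R]_n)) : _ -> borelRn R n).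
Proof.
apply: measurable_fun_rV => i.
rewrite (_ : (fun _ => _) = (fun p : borelRn R n * borelRn R n =>
    (p.1 : 'rV[R]_n) ord0 i + (p.2 : 'rV[R]_n) ord0 i)).
  apply: measurable_funD; apply: (measurableT_comp (measurable_coord i)).
    exact: measurable_fst.
  exact: measurable_snd.
by apply/funext => x; rewrite mxE.
Qed.

Lemma measurable_sub_rV : measurable_fun [set: borelRn R n * borelRn R n]
  ((fun p => (p.2 : 'rV[R]_n) - (p.1 : 'rV[R]_n)) : _ -> borelRn R n).
Proof.
apply: measurable_fun_rV => i.
rewrite (_ : (fun _ => _) = (fun p : borelRn R n * borelRn R n =>
    (p.2 : 'rV[R]_n) ord0 i - (p.1 : 'rV[R]_n) ord0 i)).
  apply: measurable_funB; apply: (measurableT_comp (measurable_coord i)).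
    exact: measurable_snd.
  exact: measurable_fst.
by apply/funext => x; rewrite !mxE.
Qed.

(* Fubini applied to [(x, y) |-> (x + y \in A) && (y \in Q)], with the change
   of variable [z = x + y] in one of the iterated integrals. *)
Lemma translation_invariant_product
    (mu nu : {sigma_finite_measure set (borelRn R n) -> \bar R}) A Q :
  translation_invariant mu -> translation_invariant nu ->
  measurable A -> measurable Q ->
  (mu A * nu Q = nu A * mu ((fun x : 'rV[R]_n => (- x)%R) @^-1` Q))%E.
Proof.
move=> mut nut mA mQ.
have swap : forall X : set (borelRn R n * borelRn R n), measurable X ->
    product_measure1 mu nu X = product_measure2 mu nu X.
  move=> X mX; apply: product_measure_unique => // B C mB mC.
  exact: product_measure2E.
pose addp (p : borelRn R n * borelRn R n) : borelRn R n :=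
  (p.1 : 'rV[R]_n) + (p.2 : 'rV[R]_n).
pose subp (p : borelRn R n * borelRn R n) : borelRn R n :=
  (p.2 : 'rV[R]_n) - (p.1 : 'rV[R]_n).
pose D := addp @^-1` A `&` snd @^-1` Q.
pose D' := snd @^-1` A `&` subp @^-1` Q.
have mD : measurable D.
  apply: measurableI; first exact: (preimage_measurable measurable_add_rV).
  exact: (preimage_measurable measurable_snd).
have mD' : measurable D'.
  apply: measurableI; first exact: (preimage_measurable measurable_snd).
  exact: (preimage_measurable measurable_sub_rV).
have mN : measurable ((fun x : 'rV[R]_n => - x) @^-1` Q : set (borelRn R n)).
  exact: (preimage_measurable measurable_oppr_rV).
have DD' : product_measure1 mu nu D = product_measure1 mu nu D'.
  apply: eq_integral => x _ /=.
  rewrite -(nut (x : 'rV[R]_n) (xsection D' x)); last exact: measurable_xsection.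
  congr (nu _); rewrite /xsection; apply/funext => y.
  rewrite /= !inE /D /D' /addp /subp /=.
  by rewrite addrK (addrC x).
have -> : (mu A * nu Q)%E = product_measure1 mu nu D.
  rewrite swap// /product_measure2 -integral_cst//.
  rewrite [LHS]integral_mkcond; apply: eq_integral => y _ /=.
  rewrite patchE /ysection; case: ifPn => [/set_mem Qy|/negP Qy].
    rewrite -(mut (y : 'rV[R]_n) A mA); congr (mu _); apply/funext => x.
    by rewrite /= inE /D/= /addp /=; apply/propext; split=> [|[]].
  rewrite (_ : [set x | _] = set0) ?measure0//.
  by apply/seteqP; split => // x; rewrite /= inE => -[_ /mem_set].
rewrite DD' swap// /product_measure2 muleC -integral_cst//.
rewrite [RHS]integral_mkcond; apply: eq_integral => z _ /=.
rewrite patchE /ysection; case: ifPn => [/set_mem Az|/negP Az].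
  rewrite -(mut (- z : 'rV[R]_n) _ mN); congr (mu _); apply/funext => x.
  by rewrite /= inE /D'/= /subp /= opprB; apply/propext; split=> [[]|].
rewrite (_ : [set x | _] = set0) ?measure0//.
by apply/seteqP; split => // x; rewrite /= inE => -[/mem_set].
Qed.

End translation_invariant.

Section box.
Context (R : realType).

Definition box n (a : 'I_n -> R) : set (borelRn R n) :=
  [set x | forall i, `|(x : 'rV[R]_n) ord0 i| <= a i].

Lemma measurable_box n (a : 'I_n -> R) : measurable (box a).
Proof.
rewrite (_ : box a = \bigcap_i
    ((fun x : borelRn R n => (x : 'rV[R]_n) ord0 i) @^-1` [set` `[- a i, a i]])).
  apply: fin_bigcap_measurable => // i _.
  by apply: preimage_measurable => //; exact: measurable_coord.
apply/seteqP; split => [x xa i _|x xa i] /=.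
  by rewrite in_itv/= -ler_norml.
by rewrite ler_norml; have := xa i Logic.I; rewrite /= in_itv.
Qed.

Lemma lebesgue_rV_box n (a : 'I_n -> R) : (forall i, 0 <= a i) ->
  lebesgue_rV R n (box a) = (\prod_i (2 * a i))%:E.
Proof.
elim: n a => [|n ih] a a0.
  by rewrite big_ord0 /= diracE mem_set// => -[].
rewrite big_ord_recl/= /lebesgue_rV_succ /pushforward.
have -> : @cons_rV R n @^-1` box a =
    [set` `[- a ord0, a ord0]] `*` box (fun i => a (lift ord0 i)).
  apply/seteqP; split => [[x v] xa|[x v] [/= xa va] i]; first split => /=.
  - by have := xa ord0; rewrite /= cons_rV_ord0 in_itv/= -ler_norml.
  - by move=> i; have := xa (lift ord0 i); rewrite /= cons_rV_lift.
  case: (unliftP ord0 i) => [j|] ->; first by rewrite cons_rV_lift.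
  by rewrite cons_rV_ord0 ler_norml; move: xa; rewrite in_itv.
rewrite product_measure1E//; last exact: measurable_box.
rewrite ih//= lebesgue_measure_itv/= lte_fin opprK.
rewrite EFinM; congr (_ * _)%E.
have := a0 ord0; rewrite le_eqVlt => /orP[/eqP<-|a00].
  by rewrite mulr0 oppr0 ltxx.
by rewrite gtrN// -EFinD mulr_natl mulr2n.
Qed.

Definition cube n (a : R) : set (borelRn R n) := box (fun=> a).

(** This symmetry absorbs the reflection in [translation_invariant_product]. *)
Lemma cubeN n a : (fun x : 'rV[R]_n => - x) @^-1` @cube n a = @cube n a.
Proof.
by apply/seteqP; split => x xa i; have := xa i; rewrite /= mxE normrN.
Qed.

Lemma lebesgue_rV_cube n a : 0 <= a ->
  lebesgue_rV R n (@cube n a) = ((2 * a) ^+ n)%:E.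
Proof. by move=> a0; rewrite lebesgue_rV_box// prodr_const card_ord. Qed.

Lemma cube_cover n : \bigcup_k (@cube n k.+1%:R) = setT.
Proof.
apply/seteqP; split => // x _; exists (Num.truncn (enorm (x : 'rV[R]_n))) => // i.
apply: le_trans (coord_le_enorm _ _) _.
by have /andP[_ /ltW] := truncn_itv (enorm_ge0 (x : 'rV[R]_n)).
Qed.

End box.

(* [mu] together with a proof of its sigma-finiteness, so that the structure of
   sigma-finite measure can be inferred. *)
Section with_sigma_finite.
Context d (T : measurableType d) (R : realType) (mu : {measure set T -> \bar R}).
Hypothesis sf : sigma_finite setT mu.

Definition with_sigma_finite of sigma_finite setT mu := fun A => mu A.

HB.instance Definition _ := Measure.copy (with_sigma_finite sf) mu.
HB.instance Definition _ := Measure_isSigmaFinite.Build _ _ _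
  (with_sigma_finite sf) sf.

End with_sigma_finite.

Section invariant_measure.
Context (R : realType) (n : nat).

(** The product formula with [Q] the cube [-1, 1]^n and Lebesgue measure as second measure; the
    divisor [2 ^+ n] is the volume of that cube. Sigma-finiteness comes from exhausting the space by
    cubes. *)
Lemma translation_invariant_unique (mu : {measure set (borelRn R n) -> \bar R})
    (A : set (borelRn R n)) :
  translation_invariant mu -> (forall a : R, (mu (@cube R n a) < +oo)%E) ->
  measurable A ->
  (mu A = (fine (mu (@cube R n 1)) / 2 ^+ n)%:E * lebesgue_rV R n A)%E.
Proof.
move=> mut muoo mA.
have sf : sigma_finite setT mu.
  exists (fun k => @cube R n k.+1%:R); first by rewrite cube_cover.
  by move=> k; split; [exact: measurable_box|exact: muoo].
pose m : {sigma_finite_measure set (borelRn R n) -> \bar R} :=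
  with_sigma_finite sf.
have lt : translation_invariant (lebesgue_rV R n).
  by move=> c B mB; exact: lebesgue_rV_addr.
have := @translation_invariant_product R n m (lebesgue_rV R n) A (@cube R n 1)
  mut lt mA (measurable_box _).
rewrite cubeN lebesgue_rV_cube// mulr1 /= => h.
have n2 : 2 ^+ n != 0 :> R by rewrite expf_neq0.
rewrite EFinM fineK; last by rewrite ge0_fin_numE.
rewrite muleC muleA -h -muleA -EFinM divff// mule1//.
Qed.

End invariant_measure.

Section linear_scaling.
Context (R : realType) (n : nat).

Lemma cube_preimage_sub (M : 'M[R]_n) (a : R) : M \in unitmx ->
  exists b : R, 0 <= b /\ (fun x : 'rV[R]_n => x *m M) @^-1` @cube R n a `<=` @cube R n b.
Proof.
move=> uM; have [C C0 hC] := mulmx_enorm_bound (invmx M).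
exists (C * (n%:R * `|a|)); split => [|x xa i].
  by rewrite !mulr_ge0// ltW.
rewrite -[x : 'rV_n](mulmxK uM) (le_trans (coord_le_enorm _ _))//.
rewrite (le_trans (hC _))// ler_pM2l// (le_trans (enorm_le_sum _))//.
rewrite mulr_natl; apply: (@le_trans _ _ (\sum_(i < n) `|a|)).
  by apply: ler_sum => j _; rewrite (le_trans (xa j))// ler_norm.
by rewrite sumr_const card_ord.
Qed.

Let lin (M : 'M[R]_n) (x : borelRn R n) : borelRn R n := (x : 'rV[R]_n) *m M.

Let lin_measure (M : 'M[R]_n) : {measure set (borelRn R n) -> \bar R} :=
  measure_function_pushforward__canonical__measure_function_Measure
    (lebesgue_rV R n) (measurable_mulmxr M).

Let lin_measureE M A : lin_measure M A = lebesgue_rV R n (lin M @^-1` A).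
Proof. by []. Qed.

(** The volume of the image of [-1, 1]^n under [M], relative to that of the cube; [invmx] turns the
    preimage in [lin_measure] into an image. *)
Let s (M : 'M[R]_n) : R := fine (lin_measure (invmx M) (@cube R n 1)) / 2 ^+ n.

Let cube_fin M a : M \in unitmx -> (lin_measure M (@cube R n a) < +oo)%E.
Proof.
move=> uM; have [b [b0 Mb]] := cube_preimage_sub a uM.
apply: (@le_lt_trans _ _ (lebesgue_rV R n (@cube R n b))).
  have mb c : measurable (@cube R n c) by exact: measurable_box.
  have mpre := preimage_measurable (measurable_mulmxr M) (mb a).
  exact: (le_measure (lebesgue_rV R n) (mem_set mpre) (mem_set (mb b)) Mb).
by rewrite lebesgue_rV_cube// ltry.
Qed.

(** The pushforward of Lebesgue measure under a linear map is translation invariant, a translation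
    by [c] upstairs becoming one by [c *m M] downstairs, so uniqueness applies with constant
    [s M]. *)
Let sE M A : M \in unitmx -> measurable A ->
  lebesgue_rV R n (lin (invmx M) @^-1` A) = ((s M)%:E * lebesgue_rV R n A)%E.
Proof.
move=> uM mA; rewrite -lin_measureE; apply: translation_invariant_unique => //.
  move=> c B mB; rewrite !lin_measureE.
  rewrite -(@lebesgue_rV_addr _ _ (c *m M) (lin (invmx M) @^-1` B)).
    congr (lebesgue_rV R n _); apply/funext => x; rewrite /= /lin mulmxDl.
    by rewrite mulmxK.
  exact: (preimage_measurable (measurable_mulmxr _)).
by move=> a; apply: cube_fin; rewrite unitmx_inv.
Qed.

(** Multiplicativity is [sE] applied twice to the cube; positivity follows from
    [s M * s (invmx M) = 1]. *)
Let s_character : mx_character s.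
Proof.
have mQ := @measurable_box R n (fun=> 1).
have n2 : 0 < 2 ^+ n :> R by rewrite exprn_gt0.
have s1 : s 1%:M = 1.
  rewrite /s lin_measureE (_ : _ @^-1` _ = @cube R n 1).
    by rewrite lebesgue_rV_cube//= mulr1 divff// gt_eqF.
  by apply/funext => x; rewrite /= /lin invmx1 mulmx1.
have sM M N : M \in unitmx -> N \in unitmx -> s (M *m N) = s M * s N.
  move=> uM uN; have uMN : M *m N \in unitmx by rewrite unitmx_mul uM.
  have := sE uMN mQ.
  rewrite (_ : _ @^-1` _ = lin (invmx N) @^-1` (lin (invmx M) @^-1` @cube R n 1)).
    rewrite !sE//; last exact: (preimage_measurable (measurable_mulmxr _)).
    rewrite lebesgue_rV_cube// mulr1 -!EFinM => -[] /eqP.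
    rewrite mulrA (inj_eq (mulIf (lt0r_neq0 n2))) => /eqP<-.
    exact: mulrC.
  have invM : invmx (M *m N) = invmx N *m invmx M.
    apply: (can_inj (mulKmx uMN)).
    by rewrite mulmxV// -mulmxA (mulmxA N) mulmxV// mul1mx mulmxV.
  by apply/funext => x; rewrite /= /lin -mulmxA -invM.
split => // M uM.
have : s M * s (invmx M) = 1 by rewrite -sM ?unitmx_inv// mulmxV.
have : 0 <= s M by rewrite divr_ge0 ?fine_ge0// ltW.
rewrite le_eqVlt => /orP[/eqP<-|//].
by rewrite mul0r => /eqP; rewrite eq_sym oner_eq0.
Qed.

Let s_diag (d : 'rV[R]_n) : (forall i, d ord0 i != 0) ->
  s (diag_mx d) = \prod_i `|d ord0 i|.
Proof.
move=> d0; rewrite /s lin_measureE (_ : _ @^-1` _ = box (fun i => `|d ord0 i|)).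
  rewrite lebesgue_rV_box//= big_split/= prodr_const card_ord mulrC mulKf ?expf_neq0//.
have ud : diag_mx d \in unitmx.
  by rewrite unitmxE det_diag unitfE; apply/prodf_neq0 => i _; exact: d0.
have ->: invmx (diag_mx d) = diag_mx (\row_i (d ord0 i)^-1).
  apply: (can_inj (mulKmx ud)); rewrite mulmxV//; apply/matrixP => i j.
  rewrite mul_diag_mx !mxE; have [->|] := eqVneq; last by rewrite mulr0n mulr0.
  by rewrite mulr1n divff.
apply/seteqP; split => x /= xd i; have := xd i; rewrite /lin mul_mx_diag !mxE.
  by rewrite normrM normfV ler_pdivrMr ?mul1r// normr_gt0.
by rewrite normrM normfV ler_pdivrMr ?mul1r// normr_gt0.
Qed.

Lemma lebesgue_rV_linear (M : 'M[R]_n) (A : set (borelRn R n)) :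
  M \in unitmx -> measurable A ->
  lebesgue_rV R n ((fun x : 'rV[R]_n => x *m M) @^-1` A) =
  (`|\det M|^-1%:E * lebesgue_rV R n A)%E.
Proof.
move=> uM mA; have := @sE (invmx M) A; rewrite unitmx_inv invmxK => -> //.
by rewrite (mx_character_det s_character s_diag) ?unitmx_inv// det_inv normfV.
Qed.

Lemma translation_invariant_linear (mu : {measure set (borelRn R n) -> \bar R})
    (M : 'M[R]_n) (A : set (borelRn R n)) :
  translation_invariant mu -> (forall a : R, (mu (@cube R n a) < +oo)%E) ->
  M \in unitmx -> measurable A ->
  mu ((fun x : 'rV[R]_n => x *m M) @^-1` A) = (`|\det M|^-1%:E * mu A)%E.
Proof.
move=> mut muoo uM mA.
have mMA := preimage_measurable (measurable_mulmxr M) mA.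
rewrite (translation_invariant_unique mut muoo mMA).
rewrite (translation_invariant_unique mut muoo mA).
by rewrite lebesgue_rV_linear// muleCA.
Qed.

End linear_scaling.

(** * Hausdorff measure under linear maps *)

Section hausdorff_linear.
Context (R : realType) (d : nat).

Definition hausdorff_borel (A : set (borelRn R d)) : \bar R :=
  hausdorff_measure d (A : set 'rV[R]_d).

Let hausdorff_borel_sigma_additive : semi_sigma_additive hausdorff_borel.
Proof.
move=> F mF tF mUF.
apply: (@caratheodory_measure_sigma_additive R _ (@hausdorff_measure R d d)) => //.
  by move=> i; apply: borel_caratheodory_hausdorff.
exact: borel_caratheodory_hausdorff.
Qed.

HB.instance Definition _ := isMeasure.Build _ _ _ hausdorff_borel
  (outer_measure0 (@hausdorff_measure R d d))
  (outer_measure_ge0 (@hausdorff_measure R d d))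
  hausdorff_borel_sigma_additive.

(** The reverse inequality compares the parametrisations [f] and the identity of [A], since [f] is
    only known to be isometric on [A]. *)
Lemma hausdorff_measure_isometry n m k (f : 'rV[R]_n -> 'rV[R]_m) (A : set 'rV[R]_n) :
  (forall x y, A x -> A y -> enorm (f x - f y) = enorm (x - y)) ->
  hausdorff_measure k (f @` A) = hausdorff_measure k A.
Proof.
move=> fA; apply/eqP; rewrite eq_le; apply/andP; split.
  have := @hausdorff_measure_lip R n m k f 1 A ltr01.
  by rewrite expr1n mul1e; apply => x y Ax Ay; rewrite mul1r fA.
have := @hausdorff_measure_lip2 R 'rV[R]_n m n k f id 1 A ltr01.
by rewrite expr1n mul1e image_id; apply => x y Ax Ay; rewrite mul1r fA.
Qed.

Lemma hausdorff_cube_fin (a : R) : (hausdorff_borel (@cube R d a) < +oo)%E.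
Proof.
have a1 : 0 < `|a| + 1 by rewrite ltr_wpDl.
apply: le_lt_trans (hausdorff_cube_lty d a1); apply: le_outer_measure => x xa i.
by rewrite (le_lt_trans (xa i))// (le_lt_trans (ler_norm a))// ltrDl.
Qed.

(** A Borel hull of [E] gives the upper bound for every set and every invertible matrix; the same
    bound for [invmx M] gives the lower one. *)
Lemma hausdorff_measure_linear (M : 'M[R]_d) (E : set 'rV[R]_d) : M \in unitmx ->
  hausdorff_measure d [set x *m M | x in E] =
  (`|\det M|%:E * hausdorff_measure d E)%E.
Proof.
have le (N : 'M[R]_d) (F : set 'rV[R]_d) : N \in unitmx ->
    (hausdorff_measure d [set x *m N | x in F] <=
     `|\det N|%:E * hausdorff_measure d F)%E.
  move=> uN; have [G [mG FG hG]] := hausdorff_borel_hull d F.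
  apply: le_trans (lee_wpmul2l _ hG) => //.
  apply: (@le_trans _ _ (hausdorff_measure d [set x *m N | x in (G : set 'rV[R]_d)])).
    by apply: le_outer_measure => _ [x Fx <-]; exists x => //; exact: FG.
  have -> : [set x *m N | x in (G : set 'rV[R]_d)] =
      (fun x : 'rV[R]_d => x *m invmx N) @^-1` G.
    apply/seteqP; split => [_ [x Gx <-]|x Gx] /=; first by rewrite mulmxK.
    by exists (x *m invmx N) => //; rewrite mulmxKV.
  have := @translation_invariant_linear R d hausdorff_borel (invmx N) G _
    hausdorff_cube_fin.
  rewrite unitmx_inv det_inv normfV invrK uN /hausdorff_borel => h.
  rewrite -h//; move=> c A mA; apply: esym.
  change (hausdorff_measure d (A : set 'rV[R]_d) =
    hausdorff_measure d ((fun x : 'rV[R]_d => x + c) @^-1` A : set 'rV[R]_d)).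
  rewrite -(@hausdorff_measure_isometry _ _ _ (fun x => x - c) A).
    congr (hausdorff_measure d _); apply/seteqP; split => [_ [x Ax <-]|x Ax] /=.
      by rewrite subrK.
    by exists (x + c) => //; rewrite addrK.
  by move=> x y _ _; congr enorm; rewrite opprB addrA subrK.
move=> uM; apply/eqP; rewrite eq_le le//=.
have := le (invmx M) [set x *m M | x in E].
have -> : [set x *m invmx M | x in [set x *m M | x in E]] = E.
  rewrite image_comp; apply/seteqP; split => [_ [x Ex <-]|x Ex] /=.
    by rewrite mulmxK.
  by exists x => //=; rewrite mulmxK.
have dM : `|\det M| > 0 by rewrite normr_gt0 -unitfE -unitmxE.
by rewrite unitmx_inv => /(_ uM); rewrite det_inv normfV lee_pdivlMl.
Qed.

End hausdorff_linear.

(** * Hausdorff measure of sets close to a hyperplane *)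

Section orthonormal_frame.
Context (R : realType) (d : nat).
Implicit Types (v w : 'rV[R]_d.+1).

Lemma dotp_mx n (x y : 'rV[R]_n) : x *m y^T = (dotp x y)%:M.
Proof. by rewrite [LHS]mx11_scalar -dotpE. Qed.

Lemma dotp_mulmxl m n (x : 'rV[R]_m) (A : 'M[R]_(m, n)) (y : 'rV[R]_n) :
  dotp (x *m A) y = dotp x (y *m A^T).
Proof. by rewrite !dotpE trmx_mul trmxK mulmxA. Qed.

(* The Householder reflection exchanging [v] and the first basis vector. *)
Lemma orthonormal_completion v : enorm v = 1 -> exists J : 'M[R]_(d, d.+1),
  (col_mx v J : 'M[R]_(1 + d, d.+1)) *m (col_mx v J : 'M[R]_(1 + d, d.+1))^T = 1%:M.
Proof.
move=> v1; pose e : 'rV[R]_d.+1 := delta_mx ord0 ord0.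
pose w := v - e; pose c := 2 / dotp w w.
pose O : 'M[R]_d.+1 := 1%:M - c *: (w^T *m w).
have vv : dotp v v = 1 by rewrite -sqr_enorm v1 expr1n.
have ee : dotp e e = 1.
  rewrite /dotp (bigD1 ord0)//= big1 ?mxE ?eqxx ?addr0 ?mulr1// => i i0.
  by rewrite mxE (negbTE i0) andbF mulr0.
have ww : dotp w w = - 2 * dotp e w.
  by rewrite /w !dotpBl !dotpBr vv ee (dotpC e v); ring.
have OT : O^T = O by rewrite /O linearB/= linearZ/= trmx_mul trmxK trmx1.
have PP : (w^T *m w) *m (w^T *m w) = dotp w w *: (w^T *m w).
  by rewrite -mulmxA (mulmxA w) dotp_mx mul_scalar_mx -scalemxAr.
have OO : O *m O^T = 1%:M.
  rewrite OT [LHS]mulmxBl mul1mx [X in _ - X]mulmxBr mulmx1.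
  rewrite -scalemxAl -scalemxAr PP 2!scalerA /O.
  have [->|w0] := eqVneq w 0; first by rewrite mulmx0 !scaler0 !subr0.
  have ww0 : dotp w w != 0 by rewrite -sqr_enorm expf_neq0// enorm_eq0.
  have -> : c * c * dotp w w = 2 * c by rewrite /c; field.
  by rewrite mulr_natl mulr2n scalerDl opprB -addrA addrK addNr addr0.
have eO : e *m O = v.
  rewrite mulmxBr mulmx1 -scalemxAr mulmxA dotp_mx mul_scalar_mx scalerA.
  have [w0|w0] := eqVneq w 0.
    by rewrite w0 scaler0 subr0; apply/esym/eqP; rewrite -subr_eq0 -/w w0.
  have ew : dotp e w != 0.
    apply: contraNneq w0 => ew0.
    by rewrite -enorm_eq0 -sqrf_eq0 sqr_enorm ww ew0 mulr0 eqxx.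
  rewrite (_ : c * _ = -1) ?scaleN1r ?opprK; last by rewrite /c ww; field.
  by rewrite addrC subrK.
clearbody O; pose O' : 'M[R]_(1 + d, d.+1) := O.
exists (dsubmx O').
have -> : col_mx v (dsubmx O') = O'.
  rewrite -[RHS]vsubmxK; congr col_mx; rewrite -eO.
  apply/rowP => i; rewrite -rowE !mxE /O'.
  by congr (O _ _); apply: val_inj.
exact: OO.
Qed.

Variables (v : 'rV[R]_d.+1) (J : 'M[R]_(d, d.+1)).
Hypothesis vJ : (col_mx v J : 'M[R]_(1 + d, d.+1)) *m
  (col_mx v J : 'M[R]_(1 + d, d.+1))^T = 1%:M.

Lemma frame_orthogonal : v *m v^T = 1%:M /\ J *m v^T = 0 /\ v *m J^T = 0 /\
  J *m J^T = 1%:M.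
Proof.
have := vJ; rewrite tr_col_mx mul_col_row (scalar_mx_block 1 d) => /eq_block_mx[-> -> -> ->].
by [].
Qed.

(** A square matrix with orthonormal rows has orthonormal columns, so that v^T v + J^T J is the
    identity. *)
Lemma frame_decomposition (x : 'rV[R]_d.+1) :
  x = dotp x v *: v + x *m J^T *m J.
Proof.
rewrite -mul_scalar_mx -dotp_mx -!mulmxA -mulmxDr.
rewrite -{1}[x]mulmx1; congr (x *m _).
by rewrite -mul_row_col -tr_col_mx (mulmx1C vJ).
Qed.

Lemma frame_isometry (y : 'rV[R]_d) : enorm (y *m J) = enorm y.
Proof.
have [_ [_ [_ JJ]]] := frame_orthogonal.
by rewrite /enorm dotp_mulmxl -mulmxA JJ mulmx1.
Qed.

Lemma frame_proj_le (x : 'rV[R]_d.+1) : enorm (x *m J^T) <= enorm x.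
Proof.
rewrite ler_sqrt ?dotp_ge0// dotp_mulmxl trmxK.
have -> : dotp x x = dotp x v * dotp x v + dotp x (x *m J^T *m J).
  by rewrite -dotpZr -dotpDr -frame_decomposition.
by rewrite lerDr -expr2 sqr_ge0.
Qed.

Lemma frame_proj_ge (eta : R) (x : 'rV[R]_d.+1) : `|dotp x v| <= eta * enorm x ->
  (1 - eta) * enorm x <= enorm (x *m J^T).
Proof.
move=> xv; rewrite mulrBl mul1r lerBlDr -(frame_isometry (x *m J^T)).
rewrite {1}(frame_decomposition x) (le_trans (enormD _ _))// addrC lerD2l.
rewrite enormZ; have [vv _] := frame_orthogonal.
have -> : enorm v = 1 by rewrite /enorm dotpE vv mxE eqxx sqrtr1.
by rewrite mulr1.
Qed.

End orthonormal_frame.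

Section near_hyperplane.
Context (R : realType) (d : nat).
Variables (A : 'M[R]_d.+1) (v : 'rV[R]_d.+1).
Hypotheses (detA : `|\det A| = 1) (v1 : enorm v = 1).

Let uA : A \in unitmx.
Proof. by rewrite unitmxE unitfE -normr_gt0 detA. Qed.

(* The factor by which [x |-> x *m A] scales (n-1)-dimensional volume on the
   hyperplane orthogonal to [v]. *)
Definition normal_scale : R := enorm (v *m invmx A^T).

Lemma normal_scale_gt0 : 0 < normal_scale.
Proof.
rewrite enorm_gt0; apply: contra_eqN v1 => /eqP v0.
have uAT : A^T \in unitmx by rewrite unitmx_tr uA.
by rewrite -(mulmxKV uAT v) v0 mul0mx enorm0 eq_sym oner_eq0.
Qed.

(** [A] maps the hyperplane orthogonal to [v] onto the one orthogonal to [v' = v *m invmx A^T],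
    normalised. In the frames (v, J) and (v', J') the matrix of [A] is block triangular with corner
    entry [normal_scale^-1]; its determinant has absolute value 1, which determines that of the
    other diagonal block. *)
Lemma hyperplane_frames : exists J J' : 'M[R]_(d, d.+1),
  [/\ (col_mx v J : 'M[R]_(1 + d, d.+1)) *m (col_mx v J : 'M[R]_(1 + d, d.+1))^T = 1%:M,
     (forall y : 'rV[R]_d, enorm (y *m J *m A *m J'^T) = enorm (y *m J *m A)),
     J *m A *m J'^T \in unitmx & `|\det (J *m A *m J'^T)| = normal_scale].
Proof.
have s0 := normal_scale_gt0.
pose v' := normal_scale^-1 *: (v *m invmx A^T).
have v'1 : enorm v' = 1.
  by rewrite enormZ gtr0_norm ?invr_gt0// mulVf// gt_eqF.
have [J vJ] := orthonormal_completion v1.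
have [J' vJ'] := orthonormal_completion v'1.
have [vv [Jv [vJ0 JJ]]] := frame_orthogonal vJ.
have JAv' : J *m A *m v'^T = 0.
  rewrite linearZ/= trmx_mul -trmx_inv trmxK -scalemxAr -!mulmxA (mulmxA A).
  by rewrite mulmxV// mul1mx Jv scaler0.
have vAv' : v *m A *m v'^T = (normal_scale^-1)%:M.
  rewrite linearZ/= trmx_mul -trmx_inv trmxK -scalemxAr -!mulmxA (mulmxA A).
  by rewrite mulmxV// mul1mx vv scalemx1.
have det_block : \det ((col_mx v J : 'M[R]_(1 + d, d.+1)) *m A *m
    (col_mx v' J' : 'M[R]_(1 + d, d.+1))^T) =
    normal_scale^-1 * \det (J *m A *m J'^T).
  rewrite tr_col_mx mul_col_mx mul_col_row vAv' JAv' det_ublock.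
  by rewrite det_scalar1.
have detM : `|\det (J *m A *m J'^T)| = normal_scale.
  have detO (u : 'rV[R]_d.+1) (L : 'M[R]_(d, d.+1)) :
      (col_mx u L : 'M[R]_(1 + d, d.+1)) *m (col_mx u L : 'M[R]_(1 + d, d.+1))^T = 1%:M ->
      `|\det (col_mx u L : 'M[R]_(1 + d))| = 1.
    move=> /(congr1 determinant); rewrite det_mulmx det_tr det1 -expr2.
    by move=> /(congr1 Num.sqrt); rewrite sqrtr_sqr sqrtr1.
  move: det_block; rewrite !det_mulmx det_tr => /(congr1 Num.norm).
  rewrite !normrM !detO// detA !mulr1 gtr0_norm ?invr_gt0// => h.
  by rewrite -[RHS]mulr1 h mulrA divff ?mul1r// gt_eqF.
exists J, J'; split => //.
  move=> y; rewrite -[in RHS](addr0 (y *m J *m A)) [in RHS](frame_decomposition vJ' (y *m J *m A)).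
  rewrite addr0 (_ : dotp _ v' = 0) ?scale0r ?add0r ?(frame_isometry vJ')//.
  by rewrite dotpE -!mulmxA (mulmxA J) JAv' mulmx0 mxE.
by rewrite unitmxE unitfE -normr_gt0 detM.
Qed.

(** On [X] the projection to the hyperplane is 1-Lipschitz with [b]-Lipschitz inverse, and [A]
    differs from [A] after projection by a relative error [eta * C * C']. Each comparison of maps
    costs a factor [b ^+ d], while on the hyperplane itself the scaling is exact. The third bound
    serves to prove finiteness. *)
Lemma hausdorff_near_hyperplane (b eta C C' : R) (X : set 'rV[R]_d.+1) :
  0 < b -> 0 <= eta -> 0 <= C -> 0 <= C' ->
  (forall x, enorm (x *m A) <= C * enorm x) ->
  (forall x, enorm x <= C' * enorm (x *m A)) ->
  1 <= b * (1 - eta) -> 1 + eta * C * C' <= b -> 1 <= b * (1 - eta * C * C') ->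
  (forall x y, X x -> X y -> `|dotp (x - y) v| <= eta * enorm (x - y)) ->
  [/\ (hausdorff_measure d [set x *m A | x in X] <=
        (b ^+ d * normal_scale)%:E * hausdorff_measure d X)%E,
     (normal_scale%:E * hausdorff_measure d X <=
        ((b ^+ d) ^+ 2)%:E * hausdorff_measure d [set x *m A | x in X])%E &
     forall J : 'M[R]_(d, d.+1),
      (col_mx v J : 'M[R]_(1 + d, d.+1)) *m (col_mx v J : 'M[R]_(1 + d, d.+1))^T = 1%:M ->
      (hausdorff_measure d X <=
        (b ^+ d)%:E * hausdorff_measure d [set x *m J^T | x in X])%E].
Proof.
move=> b0 eta0 C0 C'0 hC hC' b1 b2 b3 Xv.
have X_proj (J : 'M[R]_(d, d.+1)) :
    (col_mx v J : 'M[R]_(1 + d, d.+1)) *m (col_mx v J : 'M[R]_(1 + d, d.+1))^T = 1%:M ->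
    (hausdorff_measure d X <=
     (b ^+ d)%:E * hausdorff_measure d [set x *m J^T | x in X])%E.
  move=> vJ; rewrite -{1}(image_id X); apply: hausdorff_measure_lip2 => // x y Xx Xy.
  rewrite -mulmxBl (le_trans _ (ler_wpM2l (ltW b0) (frame_proj_ge vJ (Xv _ _ Xx Xy))))//.
  by rewrite mulrA ler_peMl ?enorm_ge0.
have [J [J' [vJ isoJ' uM detM]]] := hyperplane_frames.
have [vv [Jv [vJ0 JJ]]] := frame_orthogonal vJ.
set M := J *m A *m J'^T in uM detM.
pose P (x : 'rV[R]_d.+1) := x *m J^T.
(* [F] projects to the hyperplane, applies [A] and reads the result in the frame [J']; it factors as
   [P] followed by the square matrix [M]. *)
pose F (x : 'rV[R]_d.+1) := x *m J^T *m J *m A *m J'^T.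
have XF : hausdorff_measure d (F @` X) =
    (normal_scale%:E * hausdorff_measure d (P @` X))%E.
  rewrite -detM -hausdorff_measure_linear// image_comp; congr hausdorff_measure.
  by apply: eq_imagel => x _; rewrite /= /F /P /M -!mulmxA.
have PX : (hausdorff_measure d (P @` X) <= hausdorff_measure d X)%E.
  rewrite -[leRHS]mul1e -{1}(expr1n _ d); apply: hausdorff_measure_lip => // x y _ _.
  by rewrite mul1r -mulmxBl; exact: frame_proj_le vJ _.
(* The part of [z = x - y] lost by projecting is [dotp z v *: v], of length at most [eta * enorm z];
   [A] stretches it by at most [C], and [enorm z <= C' * enorm (z *m A)]. *)
have F_near x y : X x -> X y ->
    `|enorm ((x - y) *m A) - enorm (F x - F y)| <= eta * C * C' * enorm ((x - y) *m A).
  move=> Xx Xy; rewrite /F -!mulmxBl isoJ'; set z := x - y.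
  rewrite (le_trans (enorm_lip _ _))// {1}(frame_decomposition vJ z) mulmxDl addrK.
  rewrite -scalemxAl enormZ.
  apply: (@le_trans _ _ (eta * enorm z * (C * 1))).
    by rewrite ler_pM ?enorm_ge0 ?Xv// -v1.
  rewrite mulr1 mulrAC -[leRHS]mulrA ler_wpM2l ?mulr_ge0//.
have F_le x y : X x -> X y ->
    enorm (F x - F y) <= b * enorm ((x - y) *m A).
  move=> Xx Xy; have := F_near _ _ Xx Xy; rewrite ler_norml => /andP[h _].
  apply: le_trans (ler_wpM2r (enorm_ge0 _) b2).
  by rewrite mulrDl mul1r; lra.
have F_ge x y : X x -> X y ->
    enorm ((x - y) *m A) <= b * enorm (F x - F y).
  move=> Xx Xy; have := F_near _ _ Xx Xy; rewrite ler_norml => /andP[_ h].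
  have : (1 - eta * C * C') * enorm ((x - y) *m A) <= enorm (F x - F y).
    by rewrite mulrBl mul1r; lra.
  move=> /(ler_wpM2l (ltW b0)); apply: le_trans.
  by rewrite mulrA ler_peMl ?enorm_ge0.
have bd0 : 0 < b ^+ d by rewrite exprn_gt0.
split => //.
  apply: (@le_trans _ _ ((b ^+ d)%:E * hausdorff_measure d (F @` X))%E).
    by apply: hausdorff_measure_lip2 => // x y Xx Xy; have := F_ge _ _ Xx Xy; rewrite mulmxBl.
  rewrite XF EFinM -muleA lee_wpmul2l ?lee_fin ?(ltW bd0)//.
  by rewrite lee_wpmul2l ?lee_fin ?(ltW normal_scale_gt0).
apply: (@le_trans _ _ ((b ^+ d)%:E * hausdorff_measure d (F @` X))%E).
  by rewrite XF muleCA lee_wpmul2l ?lee_fin ?(ltW normal_scale_gt0)// X_proj.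
rewrite expr2 EFinM -muleA lee_wpmul2l ?lee_fin ?(ltW bd0)//.
by apply: hausdorff_measure_lip2 => // x y Xx Xy; have := F_le _ _ Xx Xy; rewrite mulmxBl.
Qed.

End near_hyperplane.

(** * Support functions and contact sets *)

Section support.
Context (R : realType) (n : nat).
Implicit Types (K : set 'rV[R]_n) (u v x y : 'rV[R]_n).

Lemma dotp_continuous2 :
  continuous (fun p : 'rV[R]_n * 'rV[R]_n => dotp p.1 p.2).
Proof.
rewrite /dotp; apply: (@continuous_big R^o) => [|i _ p].
  exact: add_continuous.
apply: cvgM.
  apply: (@continuous_comp _ _ _ fst (fun x : 'rV[R]_n => x ord0 i)); first exact: cvg_fst.
  exact: coord_continuous.
apply: (@continuous_comp _ _ _ snd (fun x : 'rV[R]_n => x ord0 i)); first exact: cvg_snd.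
exact: coord_continuous.
Qed.

Lemma compact_enorm_bound K : compact K ->
  exists2 M : R, 0 < M & forall x, K x -> enorm x <= M.
Proof.
move=> /compact_bounded[M [_ KM]].
exists (n%:R * (`|M| + 1) + 1) => [|x Kx].
  by rewrite ltr_wpDl// mulr_ge0// addr_ge0.
rewrite (le_trans (enorm_le_norm _))// ler_wpDr// ler_wpM2l//.
by apply: KM Kx; rewrite (le_lt_trans (ler_norm _))// ltrDl.
Qed.

Lemma support_fun_ub K x u : compact K -> K x -> dotp x u <= support_fun K u.
Proof.
move=> /compact_enorm_bound[M M0 KM] Kx; apply: ub_le_sup; last by exists x.
exists (M * enorm u) => _ [y Ky <-]; apply: le_trans (dotp_le _ _) _.
by rewrite ler_wpM2r ?enorm_ge0// KM.
Qed.

Lemma support_fun_le K u (c : R) : K !=set0 ->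
  (forall x, K x -> dotp x u <= c) -> support_fun K u <= c.
Proof.
move=> [x Kx] Kc; apply: ge_sup; first by exists (dotp x u), x.
by move=> _ [y Ky <-]; exact: Kc.
Qed.

Lemma support_funZ K u (t : R) : compact K -> K !=set0 -> 0 < t ->
  support_fun K (t *: u) = t * support_fun K u.
Proof.
move=> cK K0 t0; apply/eqP; rewrite eq_le; apply/andP; split.
  apply: support_fun_le => // x Kx; rewrite dotpZr ler_pM2l//.
  exact: support_fun_ub.
rewrite -ler_pdivlMl//; apply: support_fun_le => // x Kx.
by rewrite ler_pdivlMl// -dotpZr support_fun_ub.
Qed.

Lemma support_fun_gt0 K u : compact K -> K° 0 -> u != 0 -> 0 < support_fun K u.
Proof.
move=> cK K0 u0.
have /nbhs_ballP[e /= e0 eK] := K0.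
have u1 : 0 < enorm u by rewrite enorm_gt0.
have Ku : K ((e / 2 / enorm u) *: u).
  apply: eK; rewrite -ball_normE/= sub0r normrN.
  rewrite (le_lt_trans (norm_le_enorm _))// enormZ ger0_norm; last first.
    by rewrite !divr_ge0// ltW.
  by rewrite divfK ?gt_eqF// ltr_pdivrMr// mulr_natr mulr2n ltrDl.
apply: lt_le_trans (support_fun_ub u cK Ku).
by rewrite dotpZl mulr_gt0 ?divr_gt0// -sqr_enorm exprn_gt0.
Qed.

Lemma support_fun_lip K u v (M : R) : compact K -> K !=set0 ->
  (forall x, K x -> enorm x <= M) ->
  `|support_fun K u - support_fun K v| <= M * enorm (u - v).
Proof.
move=> cK K0 KM.
have le w z : support_fun K w <= support_fun K z + M * enorm (w - z).
  apply: support_fun_le => // x Kx; rewrite -[w](subrK z) dotpDr addrC addrK.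
  rewrite lerD ?support_fun_ub// (le_trans (dotp_le _ _))//.
  by rewrite ler_wpM2r ?enorm_ge0// KM.
by rewrite ler_distl lerBlDr le -enorm_distC le.
Qed.

Lemma support_fun_continuous K : compact K -> K !=set0 ->
  continuous (support_fun K).
Proof.
move=> cK K0; have [M M0 KM] := compact_enorm_bound cK.
apply: (@enorm_lipschitz_continuous _ _ R^o _ M (ltW M0)) => u v.
exact: support_fun_lip.
Qed.

Lemma is_K0_nonempty K : is_K0 K -> K !=set0.
Proof. by move=> [_ K0]; exists 0; exact: interior_subset. Qed.

Lemma is_K0_compact K : is_K0 K -> compact K.
Proof. by move=> [[]]. Qed.

Lemma rV_compact_closed K : compact K -> closed K.
Proof. by apply: compact_closed; exact: norm_hausdorff. Qed.

Lemma sphere_compact : compact (@sphere R n).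
Proof.
apply: bounded_closed_compact.
  exists 1; split; first exact: num_real.
  by move=> M M1 u u1; apply: (le_trans (norm_le_enorm u)); rewrite u1 ltW.
apply: (@closed_comp _ _ (@enorm R n) [set 1]); last exact: closed_eq.
by move=> x _; exact: enorm_continuous.
Qed.

Lemma sphere_neq0 u : sphere u -> u != 0.
Proof. by rewrite -enorm_gt0 => ->. Qed.

End support.

Section contact.
Context (R : realType) (n : nat).
Implicit Types (K B : set 'rV[R]_n) (u v x y : 'rV[R]_n).

(* The reverse spherical image of [B], the set whose (n-1)-dimensional
   Hausdorff measure is S(K, B). *)
Definition contact K B : set 'rV[R]_n :=
  [set x | (K `\` K°) x /\
    exists2 u, (B `&` @sphere R n) u & dotp x u = support_fun K u].

Lemma surface_area_measureE K B :
  surface_area_measure K B = hausdorff_measure n.-1 (contact K B).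
Proof. by []. Qed.

(** A point [x] of [K] with an outer unit normal [u] cannot be interior, since a small multiple of
    [u] added to [x] would stay in [K]. This removes the interior and the supremum from the
    description of [contact]. *)
Lemma contactP K B x : compact K ->
  contact K B x <-> K x /\ exists2 u, (B `&` @sphere R n) u &
    forall y, K y -> dotp (y - x) u <= 0.
Proof.
move=> cK; split=> [[[Kx _] [u Bu xu]]|[Kx [u [Bu u1] xu]]].
  split => //; exists u => // y Ky; rewrite dotpBl subr_le0 xu.
  exact: support_fun_ub.
split.
  split => // /nbhs_ballP[e /= e0 eK].
  have Ky : K (x + (e / 2) *: u).
    apply: eK; rewrite -ball_normE/= opprD addNKr normrN.
    rewrite (le_lt_trans (norm_le_enorm _))// enormZ u1 mulr1 ger0_norm; last first.
      by rewrite divr_ge0// ltW.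
    by rewrite ltr_pdivrMr// mulr_natr mulr2n ltrDl.
  have := xu _ Ky; rewrite addrAC subrr add0r dotpZl -sqr_enorm u1 expr1n mulr1.
  by rewrite leNgt divr_gt0.
exists u => //; apply/eqP; rewrite eq_le support_fun_ub//=.
apply: support_fun_le; first by exists x.
by move=> y /xu; rewrite dotpBl subr_le0.
Qed.

(** If [u] is a normal at [x], then [dotp (y - x) u <= 0], and replacing [u] by [v] costs at most
    [eta * enorm (y - x)]. Exchanging [x] and [y] bounds the absolute value. This is the
    near-flatness assumed in [hausdorff_near_hyperplane]. *)
Lemma contact_near K B v (eta : R) : compact K ->
  (forall u, B u -> enorm (u - v) <= eta) ->
  forall x y, contact K B x -> contact K B y ->
  `|dotp (x - y) v| <= eta * enorm (x - y).
Proof.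
move=> cK Bv.
have le x y : contact K B x -> K y -> dotp (y - x) v <= eta * enorm (y - x).
  move=> /(contactP _ _ cK)[Kx [u [Bu _] xu]] Ky.
  rewrite -[v](subrK u) dotpDr addrC (le_trans (lerD (xu _ Ky) (dotp_le _ _)))//.
  by rewrite add0r mulrC ler_wpM2r ?enorm_ge0// enorm_distC Bv.
move=> x y Bx By; have [[Kx _] _] := Bx; have [[Ky _] _] := By.
rewrite ler_norml le// andbT lerNl -dotpNl opprB enorm_distC.
exact: le.
Qed.

(** It is the first projection of the compact set of pairs (x, u) with [u] in [C] a unit normal to
    [K] at [x]. *)
Lemma contact_compact K C : compact K -> closed C -> compact (contact K C).
Proof.
move=> cK clC.
pose Z := (K `*` (@sphere R n `&` C)) `&` \bigcap_(y in K)
  [set p : 'rV[R]_n * 'rV[R]_n | dotp (y - p.1) p.2 <= 0].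
have -> : contact K C = fst @` Z.
  apply/seteqP; split => [x /(contactP _ _ cK)[Kx [u [Cu u1] xu]]|].
    by exists (x, u).
  move=> _ [[x u] [[/= Kx [u1 Cu]] xu] <-]; apply/(contactP _ _ cK); split => //.
  by exists u.
apply: continuous_compact.
  by apply: continuous_subspaceT => p; exact: cvg_fst.
apply: compact_closedI.
  by apply: compact_setX => //; apply: compact_closedI => //; exact: sphere_compact.
apply: closed_bigI => y _.
apply: (@closed_comp _ _ (fun p : 'rV[R]_n * 'rV[R]_n => dotp (y - p.1) p.2)
  [set t | t <= 0]); last exact: closed_le.
move=> p _.
have -> : (fun p : 'rV[R]_n * 'rV[R]_n => dotp (y - p.1) p.2) =
    (fun p => dotp y p.2 - dotp p.1 p.2).
  by apply/funext => q; rewrite dotpBl.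
apply: cvgB; last exact: dotp_continuous2.
apply: (@continuous_comp _ _ _ snd (dotp y)); first exact: cvg_snd.
have -> : dotp y = fun x => dotp x y by apply/funext => x; exact: dotpC.
exact: dotp_continuous.
Qed.

Lemma contact_bigcup K (I : Type) (D : set I) (B : I -> set 'rV[R]_n) :
  contact K (\bigcup_(i in D) B i) = \bigcup_(i in D) contact K (B i).
Proof.
apply/seteqP; split => [x [Kx [u [[i Di Bu] u1] xu]]|x [i Di [Kx [u [Bu u1] xu]]]].
  by exists i => //; split => //; exists u.
by split => //; exists u => //; split => //; exists i.
Qed.

Lemma contactS K B C : B `<=` C -> contact K B `<=` contact K C.
Proof. by move=> BC x [Kx [u [/BC Cu u1] xu]]; split => //; exists u. Qed.

End contact.

(** Splits a multiplicative tolerance [b] into [k] equal factors. *)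
Lemma exists_root_gt1 (R : realType) (b : R) (k : nat) : 1 < b ->
  exists2 c, 1 < c & c ^+ k <= b.
Proof.
move=> b1; have b0 : 0 < b := lt_trans ltr01 b1.
(* The root of order [k.+1] rather than [k] also covers [k = 0]. *)
exists (b `^ k.+1%:R^-1).
  have k0 : 0 < k.+1%:R^-1 :> R by rewrite invr_gt0.
  have := @gt0_ltr_powR R _ k0 1 b; by rewrite powR1; apply => //; rewrite nnegrE ltW.
rewrite -powR_mulrn ?powR_ge0// -powRrM -[leRHS]powRr1 ?(ltW b0)// ler_powR ?(ltW b1)//.
by rewrite mulrC ler_pdivrMr ?mul1r ?ler_nat.
Qed.

Lemma lee_mulgt1 (R : realType) (x y : \bar R) : (0 <= y)%E ->
  (forall b : R, 1 < b -> (x <= b%:E * y)%E) -> (x <= y)%E.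
Proof.
move=> y0 xy; have [->|yoo] := eqVneq y +oo%E; first by rewrite leey.
apply/lee_addgt0Pr => e e0.
have yfin : y \is a fin_num by rewrite ge0_fin_numE// ltey.
have y1 : 0 < fine y + 1 by rewrite ltr_wpDl// fine_ge0.
(* The summand 1 in the denominator allows [y = 0]. *)
have := xy (1 + e / (fine y + 1)).
rewrite ltrDl divr_gt0// => /(_ erefl) /le_trans; apply.
rewrite -(fineK yfin) -EFinM -EFinD lee_fin mulrDl mul1r lerD2l.
by rewrite mulrAC ler_pdivrMr// ler_pM2l// lerDl.
Qed.

(** * Surface area measure of a linear image *)

Section sphere_grid.
Context (R : realType) (n : nat).
Implicit Types (B : set (borelRn R n)).

(** Half-width 2 leaves room for the strict inequality in [grid_cover], as unit vectors may have a
    coordinate equal to 1. *)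
Definition sphere_cell N (j : {ffun 'I_n -> 'I_N.+1}) : set 'rV[R]_n := grid_cell 2 j.

Lemma sphere_cell_cover N u : sphere u -> exists j, @sphere_cell N j u.
Proof.
move=> u1; apply: grid_cover => // i; rewrite (le_lt_trans (coord_le_enorm _ _))//.
by rewrite u1 ltrDl.
Qed.

Lemma sphere_cell_mesh (eta : R) : 0 < eta -> exists N, forall j x y,
  @sphere_cell N j x -> sphere_cell j y -> enorm (x - y) <= eta.
Proof.
move=> eta0; have D0 : 0 < n%:R * (2 * 2) + 1 :> R by rewrite ltr_wpDl// !mulr_ge0.
have := @ltr_add_invr R 0 (eta / (n%:R * (2 * 2) + 1)).
rewrite divr_gt0// => /(_ erefl)[N]; rewrite add0r ltr_pdivlMr// mulrDr.
move=> h; exists N => j x y jx jy; apply: le_trans (grid_mesh _ jx jy) _ => //.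
rewrite mulrA mulrC; apply: le_trans (ltW h).
by rewrite lerDl mulr1 invr_ge0.
Qed.

(** The open side of the cell is approached by closed conditions at distance 1/(k+1). With
    [contact_compact] this makes the contact set of a cell a countable union of compact sets. *)
Lemma sphere_cell_bigcup_closed N (j : {ffun 'I_n -> 'I_N.+1}) :
  exists2 C : nat -> set 'rV[R]_n, (forall k, closed (C k)) &
    sphere_cell j = \bigcup_k C k.
Proof.
pose y (i : 'I_n) (x : 'rV[R]_n) := (x ord0 i + 2) * (N.+1%:R / (2 * 2)).
have cy i : continuous (y i : 'rV[R]_n -> R^o).
  apply: (@enorm_lipschitz_continuous _ _ R^o _ (N.+1%:R / (2 * 2))) => // x z.
  rewrite /y -mulrBl opprD addrACA subrr addr0 normrM mulrC.
  rewrite ger0_norm ?divr_ge0// ler_wpM2l ?divr_ge0//.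
  by have := coord_le_enorm (x - z) i; rewrite !mxE.
exists (fun k => \bigcap_i [set x | (j i)%:R <= y i x <= (j i).+1%:R - k.+1%:R^-1]).
  move=> k; apply: closed_bigI => i _.
  apply: (@closed_comp _ _ (y i) [set` `[(j i)%:R, (j i).+1%:R - k.+1%:R^-1]]).
    by move=> x _; exact: cy.
  exact: interval_closed.
apply/seteqP; split => [x jx|x [k _ jx] i]; last first.
  have /andP[-> h] := jx i Logic.I; rewrite (le_lt_trans h)//.
  by rewrite ltrBlDr ltrDl invr_gt0.
have /choice[k hk] i : exists k : nat, y i x <= (j i).+1%:R - k.+1%:R^-1.
  have /andP[_ h] := jx i; have [k hk] := ltr_add_invr h.
  by exists k; rewrite lerBrDr ltW.
exists (\max_i k i)%N => // i _ /=; have /andP[-> _] := jx i => /=.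
rewrite (le_trans (hk i))// lerD2l lerN2 lef_pV2 ?posrE// ler_nat ltnS.
exact: leq_bigmax.
Qed.

Lemma measurable_sphere_cell N (j : {ffun 'I_n -> 'I_N.+1}) :
  measurable (sphere_cell j : set (borelRn R n)).
Proof.
have [C cC ->] := sphere_cell_bigcup_closed j.
by apply: bigcupT_measurable => k; exact: closed_measurable_rV.
Qed.

Lemma measurable_sphere : measurable (@sphere R n : set (borelRn R n)).
Proof.
by apply: closed_measurable_rV; apply: rV_compact_closed; exact: sphere_compact.
Qed.

Lemma sphere_grid_sum (m : set (borelRn R n) -> \bar R) N B : m set0 = 0%E ->
  (forall X Y, measurable X -> measurable Y -> X `<=` B -> Y `<=` B ->
    X `&` Y = set0 -> m (X `|` Y) = (m X + m Y)%E) ->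
  measurable B -> B `<=` @sphere R n ->
  m B = (\sum_(j : {ffun 'I_n -> 'I_N.+1}) m (B `&` sphere_cell j))%E.
Proof.
move=> m0 mU mB BS.
pose W (s : seq {ffun 'I_n -> 'I_N.+1}) : set (borelRn R n) :=
  [set x | exists2 j, j \in s & (B `&` sphere_cell j) x].
have W_cons j s : W (j :: s) = (B `&` sphere_cell j) `|` W s.
  apply/seteqP; split => [x [k]|x [jx|[k ks kx]]].
  - by rewrite inE => /orP[/eqP->|ks] kx; [left|right; exists k].
  - by exists j; rewrite ?mem_head.
  - by exists k => //; rewrite inE ks orbT.
have mBj j : measurable (B `&` sphere_cell j).
  by apply: measurableI => //; exact: measurable_sphere_cell.
have mW s : measurable (W s).
  elim: s => [|j s ih]; last by rewrite W_cons; exact: measurableU.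
  by rewrite (_ : W [::] = set0)//; apply/seteqP; split => // x [].
have WB s : W s `<=` B by move=> x [j _ []].
have W_sum s : uniq s -> m (W s) = (\sum_(j <- s) m (B `&` sphere_cell j))%E.
  elim: s => [_|j s ih /= /andP[js us]].
    by rewrite big_nil (_ : W [::] = set0)//; apply/seteqP; split => // x [].
  rewrite W_cons mU//.
    by rewrite big_cons ih.
  apply/seteqP; split => // x [[_ jx] [k ks [_ kx]]].
  by move: js; rewrite (grid_cellI jx kx) ks.
rewrite -W_sum ?index_enum_uniq//; congr m.
apply/seteqP; split => [x Bx|x [j _ []//]].
by have [j jx] := sphere_cell_cover N (BS _ Bx); exists j; rewrite ?mem_index_enum.
Qed.

(** A factor [b] on each cell is the same factor on the sum, however many cells there are, and [b]
    then tends to 1. The comparison asks subadditivity of [m1] and additivity of [m2], so that [m1]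
    may be the Hausdorff measure of an image. *)
Lemma le_sphere_grid (m1 m2 : set (borelRn R n) -> \bar R) B :
  (0 <= m2 B)%E -> 
  (forall N, m1 B <= \sum_(j : {ffun 'I_n -> 'I_N.+1}) m1 (B `&` sphere_cell j))%E ->
  (forall N, m2 B = \sum_(j : {ffun 'I_n -> 'I_N.+1}) m2 (B `&` sphere_cell j))%E ->
  (forall b : R, 1 < b -> exists N, forall j : {ffun 'I_n -> 'I_N.+1},
    (m1 (B `&` sphere_cell j) <= b%:E * m2 (B `&` sphere_cell j))%E) ->
  (forall X, measurable X -> X `<=` B -> 0 <= m2 X)%E ->
  measurable B -> (m1 B <= m2 B)%E.
Proof.
move=> m2B m1_sub m2_add hb m2_ge0 mB; apply: lee_mulgt1 => // b b1.
have [N bN] := hb _ b1; rewrite (le_trans (m1_sub N))// (m2_add N) ge0_sume_distrr.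
  by apply: lee_sum => j _; exact: bN.
move=> j _; apply: m2_ge0; last by move=> x [].
by apply: measurableI => //; exact: measurable_sphere_cell.
Qed.

(** On the sphere [enorm (v *m L)] is at least [D^-1], which turns the additive error [C * eta] into
    a relative one. *)
Lemma enorm_mulmx_near (L : 'M[R]_n) (b : R) : L \in unitmx -> 1 < b ->
  exists2 eta : R, 0 < eta & forall u v, sphere v ->
    enorm (u - v) <= eta -> enorm (u *m L) <= b * enorm (v *m L).
Proof.
move=> uL b1; have [C C0 hC] := mulmx_enorm_bound L.
have [D D0 hD] := mulmx_enorm_bound (invmx L).
exists ((b - 1) / (C * D)) => [|u v v1 uv]; first by rewrite divr_gt0 ?subr_gt0// mulr_gt0.
have hv : 1 <= D * enorm (v *m L) by have := hD (v *m L); rewrite mulmxK// v1.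
have h : enorm ((u - v) *m L) <= (b - 1) * enorm (v *m L).
  rewrite (le_trans (hC _))// (le_trans (ler_wpM2l (ltW C0) uv))//.
  have -> : C * ((b - 1) / (C * D)) = (b - 1) / D by field; rewrite !gt_eqF.
  by rewrite ler_wpM2l ?subr_ge0 ?(ltW b1)// -[D^-1]mulr1 ler_pdivrMl.
rewrite -[u](subrK v) mulmxDl (le_trans (enormD _ _))//.
by rewrite -lerBrDr -[X in _ <= _ - X]mul1r -mulrBl.
Qed.

End sphere_grid.

(** Cutting the union along the measurable set [Y j] removes from the remaining sets only their null
    overlaps with [Y j]. *)
Lemma hausdorff_image_fin_sum (R : realType) n k (J : finType)
    (Y : J -> set 'rV[R]_n) :
  (forall j, (@hausdorff_measure R n k).-caratheodory (Y j)) ->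
  (forall i j, i != j -> hausdorff_measure k (Y i `&` Y j) = 0%E) ->
  (\sum_j hausdorff_measure k (Y j) <= hausdorff_measure k (\bigcup_j Y j))%E.
Proof.
move=> mY Y0.
suff seqY (s : seq J) : uniq s -> (\sum_(j <- s) hausdorff_measure k (Y j) <=
    hausdorff_measure k [set x | exists2 j, j \in s & Y j x])%E.
  rewrite (le_trans (seqY _ (index_enum_uniq _)))//.
  by apply: le_outer_measure => x [j _ jx]; exists j.
elim: s => [_|j s ih /= /andP[js us]].
  by rewrite big_nil outer_measure_ge0.
set W := [set x | _] in ih; set Z := [set x | _].
have YZ : Z `&` Y j = Y j.
  by apply: setIidr => x jx; exists j; rewrite ?mem_head.
rewrite big_cons (mY j Z) YZ leeD2l//.
apply: (le_trans (ih us)); apply: (@le_trans _ _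
    (hausdorff_measure k (Z `&` ~` Y j) + hausdorff_measure k (W `&` Y j))%E).
  rewrite (le_trans _ (outer_measureU2 _ _ _))//; apply: le_outer_measure => x Wx.
  have [jx|njx] := pselect (Y j x); [by right|left]; split => //.
  by have [i si ix] := Wx; exists i => //; rewrite inE si orbT.
rewrite (_ : hausdorff_measure k (W `&` Y j) = 0%E) ?adde0//.
apply/eqP; rewrite eq_le outer_measure_ge0 andbT.
apply: (@le_trans _ _ (\sum_(i : J) hausdorff_measure k
    (if i \in s then Y i `&` Y j else set0))%E).
  apply: fin_outer_measure_subadditive => x [[i si ix] jx].
  by exists i; rewrite si.
rewrite big1// => i _; case: ifPn => [si|_]; last exact: outer_measure0.
by apply: Y0; apply: contraNneq js => <-.
Qed.

(** * Hausdorff measure of the linear image of a contact set *)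

Section contact_image.
Context (R : realType) (d : nat).
Variables (A : 'M[R]_d.+1) (K : set 'rV[R]_d.+1).
Hypotheses (detA : `|\det A| = 1) (cK : compact K).
Local Notation n := d.+1.
Local Notation H := (@hausdorff_measure R d.+1 d).
Implicit Types (B : set 'rV[R]_n).

Let uA : A \in unitmx.
Proof. by rewrite unitmxE unitfE -normr_gt0 detA. Qed.

Definition contact_image B := [set x *m A | x in contact K B].

Lemma contact_local (b : R) : 1 < b -> exists2 eta : R, 0 < eta &
  forall v B, sphere v -> (forall u, B u -> enorm (u - v) <= eta) ->
  [/\ (H (contact_image B) <= (b * normal_scale A v)%:E * H (contact K B))%E,
      ((normal_scale A v)%:E * H (contact K B) <= b%:E * H (contact_image B))%E &
      (H (contact K B) < +oo)%E].
Proof.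
move=> b1; have b0 : 0 < b := lt_trans ltr01 b1.
have [C C0 hC] := mulmx_enorm_bound A.
have [C' C'0 hC'] := mulmx_enorm_bound (invmx A).
(* The exponent [d * 2] pays for the factor [(c ^+ d) ^+ 2] in [hausdorff_near_hyperplane]. *)
have [c c1 cb] := exists_root_gt1 (d * 2) b1.
have c0 : 0 < c := lt_trans ltr01 c1.
have D0 : 0 < 1 + C * C' by rewrite addr_gt0// mulr_gt0.
(* With this choice [eta] and [eta * C * C'] add up to [1 - c^-1], so each is below it. *)
pose eta := (1 - c^-1) / (1 + C * C').
have cV0 : 0 < 1 - c^-1 by rewrite subr_gt0 invf_lt1.
have eta0 : 0 < eta by rewrite divr_gt0.
have etaE : eta + eta * C * C' = 1 - c^-1.
  by rewrite -mulrA -[X in X + _]mulr1 -mulrDr divfK ?gt_eqF.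
have etaCC : 0 < eta * C * C' := mulr_gt0 (mulr_gt0 eta0 C0) C'0.
have cc : c * (1 - c^-1) = c - 1 by rewrite mulrBr mulr1 divff// gt_eqF.
have e1 : 1 <= c * (1 - eta).
  have : c^-1 <= 1 - eta by lra.
  by move=> /(ler_wpM2l (ltW c0)); rewrite divff ?gt_eqF.
have e2 : 1 + eta * C * C' <= c.
  have := ler_peMl (ltW cV0) (ltW c1); lra.
have e3 : 1 <= c * (1 - eta * C * C').
  have : c^-1 <= 1 - eta * C * C' by lra.
  by move=> /(ler_wpM2l (ltW c0)); rewrite divff ?gt_eqF.
have cd2b : (c ^+ d) ^+ 2 <= b by rewrite -exprM.
have cdb : c ^+ d <= b.
  apply: le_trans cd2b; rewrite expr2 ler_peMl ?exprn_ege1 ?exprn_ge0//; exact: ltW.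
exists eta => // v B v1 Bv.
have hA x : enorm x <= C' * enorm (x *m A) by have := hC' (x *m A); rewrite mulmxK.
have [h1 h2 h3] := hausdorff_near_hyperplane detA v1 c0 (ltW eta0) (ltW C0) (ltW C'0)
  hC hA e1 e2 e3 (contact_near cK Bv).
have s0 := normal_scale_gt0 detA v1.
split.
- apply: le_trans h1 _; rewrite lee_wpmul2r ?outer_measure_ge0// lee_fin.
  by rewrite ler_pM2r.
- by apply: le_trans h2 _; rewrite lee_wpmul2r ?outer_measure_ge0// lee_fin.
(* Finiteness: up to a constant, the contact set is bounded by its projection, which lies in a cube
   of R^d. *)
have [J vJ] := orthonormal_completion v1.
apply: le_lt_trans (h3 J vJ) _; rewrite lte_mul_pinfty ?lee_fin ?exprn_ge0 ?(ltW c0)//.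
have [M M0 KM] := compact_enorm_bound cK.
apply: le_lt_trans (hausdorff_cube_fin _ M); apply: le_outer_measure.
move=> _ [x [[Kx _] _] <-] i; rewrite (le_trans (coord_le_enorm _ _))//.
by rewrite (le_trans (frame_proj_le vJ _))// KM.
Qed.

Lemma contact_fin_lty : (H (contact K (@sphere R n)) < +oo)%E.
Proof.
(* The number 2 is an arbitrary factor above 1. *)
have [eta eta0 loc] := contact_local (ltr1n R 2).
have [N Nmesh] := @sphere_cell_mesh R n eta eta0.
apply: (@le_lt_trans _ _ (\sum_(j : {ffun 'I_n -> 'I_N.+1})
    H (contact K (@sphere R n `&` sphere_cell j)))%E).
  apply: fin_outer_measure_subadditive => x [Kx [u [u1 _] xu]].
  have [j ju] := sphere_cell_cover N u1.
  by exists j; split => //; exists u.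
apply: lte_sum_pinfty => j _.
have [->|/eqP/set0P[v [v1 jv]]] := pselect (@sphere R n `&` sphere_cell j = set0).
  rewrite (_ : contact K set0 = set0) ?outer_measure0//.
  by apply/seteqP; split => // x [_ [u []]].
have [u [_ ju]|_ _ //] := loc v (@sphere R n `&` sphere_cell j) v1.
exact: Nmesh ju jv.
Qed.

Lemma contact_measurable B (C : nat -> set 'rV[R]_n) :
  (forall k, closed (C k)) -> B = \bigcup_k C k ->
  measurable (contact K B : set (borelRn R n)) /\
  measurable (contact_image B : set (borelRn R n)).
Proof.
move=> cC ->; rewrite /contact_image contact_bigcup image_bigcup; split.
  apply: bigcupT_measurable => k; apply: closed_measurable_rV.
  by apply: rV_compact_closed; exact: contact_compact.
apply: bigcupT_measurable => k; apply: closed_measurable_rV.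
apply: rV_compact_closed; apply: continuous_compact; last exact: contact_compact.
by apply: continuous_subspaceT; exact: mulmxr_continuous.
Qed.

Lemma normal_scale_continuous : continuous (normal_scale A : 'rV[R]_n -> R^o).
Proof.
have [C C0 hC] := mulmx_enorm_bound (invmx A^T).
apply: (@enorm_lipschitz_continuous _ _ R^o _ C (ltW C0)) => u v.
by rewrite (le_trans (enorm_lip _ _))// -mulmxBl.
Qed.

Variable f : 'rV[R]_n -> R.
Hypothesis Kf : is_curvature_fun K f.
Local Notation sigma := (@spherical_measure R n).
Local Notation S := (@sphere R n).

Let mf (B : set (borelRn R n)) : B `<=` S ->
  measurable_fun B (fun u : borelRn R n => (f u)%:E).
Proof.
have [mf _ _] := Kf; move=> BS; apply/measurable_EFinP.
exact: (measurable_funS (@measurable_sphere R n) BS mf).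
Qed.

Let mnu (B : set (borelRn R n)) : B `<=` S ->
  measurable_fun B (fun u : borelRn R n => (normal_scale A u * f u)%:E).
Proof.
have [mf' _ _] := Kf; move=> BS; apply/measurable_EFinP.
apply: (measurable_funS (@measurable_sphere R n) BS); apply: measurable_funM => //.
apply: measurable_funTS; apply: continuous_measurable_rV.
exact: normal_scale_continuous.
Qed.

Let mu (B : set (borelRn R n)) : \bar R := (\int[sigma]_(u in B) (f u)%:E)%E.
Let nu (B : set (borelRn R n)) : \bar R :=
  (\int[sigma]_(u in B) (normal_scale A u * f u)%:E)%E.

Let muE (B : set (borelRn R n)) : measurable B -> B `<=` S -> H (contact K B) = mu B.
Proof. by have [_ _ h] := Kf; exact: h. Qed.

Let f0 u : S u -> (0 <= (f u)%:E)%E.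
Proof. by have [_ h _] := Kf; move=> /h; rewrite lee_fin. Qed.

Let sf0 u : S u -> (0 <= (normal_scale A u * f u)%:E)%E.
Proof. by move=> Su; rewrite lee_fin mulr_ge0 ?enorm_ge0// -lee_fin f0. Qed.

Let muU (X Y : set (borelRn R n)) : measurable X -> measurable Y -> X `<=` S -> Y `<=` S ->
  X `&` Y = set0 -> mu (X `|` Y) = (mu X + mu Y)%E.
Proof.
move=> mX mY XS YS XY; apply: ge0_integral_setU => //.
- by apply: mf => u [/XS|/YS].
- by move=> u [/XS|/YS]; exact: f0.
by apply/disj_setPS; rewrite XY.
Qed.

Let nuU (X Y : set (borelRn R n)) : measurable X -> measurable Y -> X `<=` S -> Y `<=` S ->
  X `&` Y = set0 -> nu (X `|` Y) = (nu X + nu Y)%E.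
Proof.
move=> mX mY XS YS XY; apply: ge0_integral_setU => //.
- by apply: mnu => u [/XS|/YS].
- by move=> u [/XS|/YS]; exact: sf0.
by apply/disj_setPS; rewrite XY.
Qed.

(** On a small cell, freezing [normal_scale] at one point [v] costs a factor [c] in the integral,
    and replacing [A] by its effect on the hyperplane orthogonal to [v] costs another;
    [c ^+ 2 <= b]. *)
Let near_cell (b : R) : 1 < b -> exists N, forall (j : {ffun 'I_n -> 'I_N.+1})
    (B : set (borelRn R n)), measurable B -> B `<=` S -> B `<=` sphere_cell j ->
  [/\ (H (contact_image B) <= b%:E * nu B)%E, (nu B <= b%:E * H (contact_image B))%E &
      (H (contact K B) < +oo)%E].
Proof.
move=> b1; have b0 : 0 < b := lt_trans ltr01 b1.
have [c c1 cb] := exists_root_gt1 2 b1.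
have c0 : 0 < c := lt_trans ltr01 c1.
have [eta eta0 loc] := contact_local c1.
have uAT : invmx A^T \in unitmx by rewrite unitmx_inv unitmx_tr uA.
have [eta' eta'0 loc'] := enorm_mulmx_near uAT c1.
have [|N Nmesh] := @sphere_cell_mesh R n (Num.min eta eta').
  by rewrite lt_min eta0.
exists N => j B mB BS Bj.
have [->|/eqP/set0P[v Bv]] := pselect (B = set0).
  have c0' : contact K set0 = set0 by apply/seteqP; split => // x [_ [u []]].
  rewrite /contact_image c0' image_set0 !outer_measure0 /nu integral_set0.
  by rewrite mule0; split => //; rewrite ltry.
have v1 : S v := BS _ Bv.
have Bnear u : B u -> enorm (u - v) <= eta /\ enorm (u - v) <= eta'.
  by move=> Bu; have := Nmesh j u v (Bj _ Bu) (Bj _ Bv); rewrite le_min => /andP[].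
have [u /Bnear[]//|h1 h2 h3] := loc v B v1.
have sv0 := normal_scale_gt0 detA v1.
have s_le u : B u -> normal_scale A u <= c * normal_scale A v.
  by move=> /Bnear[_ h]; exact: loc'.
have s_ge u : B u -> normal_scale A v <= c * normal_scale A u.
  by move=> Bu; have [_ h] := Bnear _ Bu; apply: loc' (BS _ Bu) _; rewrite enorm_distC.
have svmu : ((normal_scale A v)%:E * mu B = \int[sigma]_(u in B) (normal_scale A v * f u)%:E)%E.
  rewrite /mu -ge0_integralZl//; first exact: mf.
  - by move=> u /BS; exact: f0.
  - by rewrite lee_fin ltW.
have mZ (k : R) : measurable_fun B (fun u : borelRn R n => (k * f u)%:E).
  have /measurable_EFinP h := mf BS; apply/measurable_EFinP.
  exact: measurable_funM.
have mZ' (k : R) : measurable_fun B (fun u : borelRn R n => (k * (normal_scale A u * f u))%:E).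
  have /measurable_EFinP h := mnu BS; apply/measurable_EFinP.
  exact: measurable_funM.
have le1 : ((normal_scale A v)%:E * mu B <= c%:E * nu B)%E.
  rewrite svmu /nu -ge0_integralZl//; first last.
  - by rewrite lee_fin ltW.
  - by move=> u /BS; exact: sf0.
  - exact: mnu.
  apply: ge0_le_integral => //.
  - by move=> u /BS Su; rewrite lee_fin mulr_ge0 ?(ltW sv0)// -lee_fin f0.
  - by apply: measurable_funeM; exact: mnu.
  - by move=> u Bu; rewrite -EFinM lee_fin mulrA ler_wpM2r ?s_ge// -lee_fin f0//; exact: BS.
have le2 : (nu B <= (c * normal_scale A v)%:E * mu B)%E.
  rewrite EFinM -muleA svmu /nu -ge0_integralZl//; first last.
  - by rewrite lee_fin ltW.
  - by move=> u /BS Su; rewrite lee_fin mulr_ge0 ?(ltW sv0)// -lee_fin f0.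
  apply: ge0_le_integral => //.
  - by move=> u /BS; exact: sf0.
  - exact: mnu.
  - by apply: measurable_funeM; exact: mZ.
  - by move=> u Bu; rewrite -EFinM lee_fin mulrA ler_wpM2r ?s_le// -lee_fin f0//; exact: BS.
have nu0 : (0 <= nu B)%E by apply: integral_ge0 => u /BS; exact: sf0.
have H0 := outer_measure_ge0 (@hausdorff_measure R n d) (contact_image B).
split => //.
- apply: le_trans h1 _; rewrite muE// EFinM -muleA.
  apply: (@le_trans _ _ (c%:E * (c%:E * nu B))%E).
    by rewrite lee_wpmul2l// lee_fin ltW.
  by rewrite muleA -EFinM -expr2 lee_wpmul2r// lee_fin.
apply: le_trans le2 _; rewrite EFinM -muleA -muE//.
apply: (@le_trans _ _ (c%:E * (c%:E * H (contact_image B)))%E).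
  by rewrite lee_wpmul2l// lee_fin ltW.
by rewrite muleA -EFinM -expr2 lee_wpmul2r// lee_fin.
Qed.

Let cell N (j : {ffun 'I_n -> 'I_N.+1}) : set (borelRn R n) := S `&` sphere_cell j.

Let mcell N (j : {ffun 'I_n -> 'I_N.+1}) : measurable (cell j).
Proof.
by apply: measurableI; [exact: measurable_sphere|exact: measurable_sphere_cell].
Qed.

Let cell_contact_measurable N (j : {ffun 'I_n -> 'I_N.+1}) :
  measurable (contact K (cell j) : set (borelRn R n)) /\
  measurable (contact_image (cell j) : set (borelRn R n)).
Proof.
have [C cC CE] := sphere_cell_bigcup_closed R j.
apply: (@contact_measurable (cell j) (fun k => S `&` C k)) => [k|].
  apply: closedI => //; apply: rV_compact_closed; exact: sphere_compact.
by rewrite /cell CE setI_bigcupr.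
Qed.

Let image_null (X : set 'rV[R]_n) : H X = 0%E -> H [set x *m A | x in X] = 0%E.
Proof.
have [C C0 hC] := mulmx_enorm_bound A.
move=> X0; apply/eqP; rewrite eq_le outer_measure_ge0 andbT.
have := @hausdorff_measure_lip R n n d (fun x => x *m A) C X C0.
by rewrite X0 mule0; apply => x y _ _; rewrite -mulmxBl.
Qed.

(** With X and Y the two contact sets, the integral formula gives H(X u Y) = H(X) + H(Y), while
    measurability of X gives H(X u Y) = H(X) + H(Y \ X). Both being finite, H(Y \ X) = H(Y), and the
    overlap is null. *)
Let overlap_null N (i j : {ffun 'I_n -> 'I_N.+1}) : i != j ->
  (forall k : {ffun 'I_n -> 'I_N.+1}, H (contact K (cell k)) < +oo)%E ->
  H (contact K (cell i) `&` contact K (cell j)) = 0%E.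
Proof.
move=> ij fin.
have [mi _] := cell_contact_measurable i.
have ci := @borel_caratheodory_hausdorff R n d _ mi.
set X := contact K (cell i) in ci *; set Y := contact K (cell j).
have cellU : contact K (cell i `|` cell j) = X `|` Y.
  apply/seteqP; split => [x [Kx [u [[iu|ju] u1] xu]]|x [|]].
  - by left; split => //; exists u.
  - by right; split => //; exists u.
  - by apply: contactS => u; left.
  - by apply: contactS => u; right.
have disj : cell i `&` cell j = set0.
  apply/seteqP; split => // u [[_ iu] [_ ju]].
  by move: ij; rewrite (grid_cellI iu ju) eqxx.
have XY : H (X `|` Y) = (H X + H Y)%E.
  rewrite -cellU muE; [|exact: measurableU|by move=> u [[]|[]]].
  rewrite muU//; try by move=> u [].
  by rewrite -!muE//; move=> u [].
have e1 : H (X `|` Y) = (H X + H (Y `\` X))%E.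
  rewrite (ci (X `|` Y)); congr (H _ + H _)%E.
    by rewrite setUK.
  by rewrite setIUl setICr set0U setDE.
have e2 : H Y = (H (Y `&` X) + H (Y `\` X))%E by rewrite (ci Y) setDE.
have finE Z : Z `<=` X \/ Z `<=` Y -> H Z \is a fin_num.
  move=> ZXY; rewrite ge0_fin_numE ?outer_measure_ge0//.
  by case: ZXY => /(le_outer_measure (@hausdorff_measure R n d)) /le_lt_trans; apply; exact: fin.
have fX : H X \is a fin_num by apply: finE; left.
have fD : H (Y `\` X) \is a fin_num by apply: finE; right; exact: subDsetl.
have fI : H (Y `&` X) \is a fin_num by apply: finE; right; exact: subIsetl.
have YD : H (Y `\` X) = H Y.
  move: e1; rewrite XY -(fineK fX) -(fineK fD) -(fineK (finE Y (or_intror (@subset_refl _ Y)))).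
  by rewrite -!EFinD => -[] /addrI ->.
rewrite setIC; move: e2; rewrite YD -(fineK fI) -YD -(fineK fD) -EFinD => -[].
by move=> /esym/(canRL (addrK _)); rewrite subrr => ->.
Qed.

Let contact_image_le (B : set (borelRn R n)) : measurable B -> B `<=` S ->
  (H (contact_image B) <= nu B)%E.
Proof.
move=> mB BS.
apply: (@le_sphere_grid R n (fun B => H (contact_image B)) nu) => //.
- by apply: integral_ge0 => u /BS; exact: sf0.
- move=> N; apply: fin_outer_measure_subadditive => _ [x [Kx [u [Bu u1] xu]] <-].
  have [j ju] := sphere_cell_cover N u1; exists j; exists x => //.
  by split => //; exists u.
- move=> N; apply: sphere_grid_sum => //; first by rewrite /nu integral_set0.
  by move=> X Y mX mY XB YB; apply: nuU => //; [move=> x /XB/BS|move=> x /YB/BS].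
- move=> b b1; have [N hN] := near_cell b1; exists N => j.
  have [|||//] := hN j (B `&` sphere_cell j).
  + by apply: measurableI => //; exact: measurable_sphere_cell.
  + by move=> x [/BS].
  + by move=> x [].
- by move=> X mX XB; apply: integral_ge0 => u /XB/BS; exact: sf0.
Qed.

(** The contact images of the cells are Borel with null overlaps, so their measures add up to at
    most that of the union. *)
Let contact_image_total : (nu S <= H (contact_image S))%E.
Proof.
apply: lee_mulgt1 => [|b b1]; first exact: outer_measure_ge0.
have [N hN] := near_cell b1.
have {}hN (j : {ffun 'I_n -> 'I_N.+1}) :
    (nu (cell j) <= b%:E * H (contact_image (cell j)))%E /\
    (H (contact K (cell j)) < +oo)%E.
  by have [||_ ? ?] := hN j (cell j) (mcell j) => //; move=> x [].
have -> : nu S = (\sum_(j : {ffun 'I_n -> 'I_N.+1}) nu (cell j))%E.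
  apply: sphere_grid_sum => //; first by rewrite /nu integral_set0.
  exact: measurable_sphere.
apply: (@le_trans _ _ (b%:E * \sum_(j : {ffun 'I_n -> 'I_N.+1}) H (contact_image (cell j)))%E).
  rewrite ge0_sume_distrr; last by move=> *; exact: outer_measure_ge0.
  by apply: lee_sum => j _; have [] := hN j.
rewrite lee_wpmul2l ?lee_fin ?(le_trans ler01 (ltW b1))//.
apply: le_trans (hausdorff_image_fin_sum _ _) _.
- move=> j; apply: borel_caratheodory_hausdorff.
  by have [] := cell_contact_measurable j.
- move=> i j ij; have := @overlap_null N i j ij (fun k => (hN k).2).
  move=> /image_null <-; congr H; apply/seteqP; split.
    move=> _ [[x ix <-] [y jy yx]]; exists x => //; split => //.
    by rewrite -(mulmxK uA x) -yx mulmxK.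
  by move=> _ [x [ix jx] <-]; split; exists x.
- by apply: le_outer_measure => _ [j _ [x jx <-]]; exists x => //; apply: contactS jx => u [].
Qed.

Let nu_fin : (nu S < +oo)%E.
Proof.
have [C C0 hC] := mulmx_enorm_bound A.
apply: le_lt_trans contact_image_total _.
have h := @hausdorff_measure_lip R n n d (fun x => x *m A) C (contact K S) C0.
apply: le_lt_trans (h _) _.
  by move=> x y _ _; rewrite -mulmxBl.
by rewrite lte_mul_pinfty ?outer_measure_ge0 ?contact_fin_lty// lee_fin exprn_ge0 ?ltW.
Qed.

(** The total bound gives nu(B) + nu(S \ B) <= H(image of B) + H(image of S \ B), and the last term
    is at most nu(S \ B), which is finite and cancels. *)
Theorem contact_image_measure (B : set (borelRn R n)) :
  measurable B -> B `<=` S ->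
  H (contact_image B) = (\int[sigma]_(u in B) (normal_scale A u * f u)%:E)%E.
Proof.
move=> mB BS; apply/eqP; rewrite eq_le contact_image_le//=.
have mS := @measurable_sphere R n.
have mD : measurable (S `\` B : set (borelRn R n)) by exact: measurableD.
have SE : nu S = (nu B + nu (S `\` B))%E.
  rewrite -nuU//; last by rewrite setDIK.
  by rewrite setDUK.
have nuB0 X : X `<=` S -> (0 <= nu X)%E.
  by move=> XS; apply: integral_ge0 => u /XS; exact: sf0.
have nu_le X Y : nu S = (nu X + nu Y)%E -> X `<=` S -> Y `<=` S -> nu X \is a fin_num.
  move=> XY XS YS; rewrite ge0_fin_numE ?nuB0//.
  by apply: le_lt_trans nu_fin; rewrite XY leeDl ?nuB0.
have fD : nu (S `\` B) \is a fin_num by apply: (nu_le _ B) => //; rewrite addeC.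
rewrite -/(nu B) -(leeD2rE _ _ fD) -SE; apply: (le_trans contact_image_total).
apply: (@le_trans _ _ (H (contact_image B) + H (contact_image (S `\` B)))%E).
  rewrite (le_trans _ (outer_measureU2 _ _ _))//; apply: le_outer_measure.
  move=> _ [x [Kx [u [Su u1] xu]] <-]; have [Bu|nBu] := pselect (B u).
    by left; exists x => //; split => //; exists u.
  by right; exists x => //; split => //; exists u.
by rewrite leeD2l// contact_image_le.
Qed.

Lemma contact_image_integral_lty :
  (\int[sigma]_(u in S) (normal_scale A u * f u)%:E < +oo)%E.
Proof. exact: nu_fin. Qed.

End contact_image.

(** * Change of variables on the sphere *)

Section density.
Local Open Scope ereal_scope.
Context d (T : measurableType d) (R : realType).
Variables (mu nu : {measure set T -> \bar R}) (w : T -> R) (D : set T).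
Hypotheses (mD : measurable D) (mw : measurable_fun setT w) (w0 : forall x, (0 <= w x)%R).
Hypothesis nuE : forall A, measurable A -> A `<=` D ->
  nu A = \int[mu]_(x in A) (w x)%:E.

Import HBNNSimple.

Let density_nnsfun (h : {nnsfun T >-> R}) :
  \int[nu]_(x in D) (h x)%:E = \int[mu]_(x in D) (h x * w x)%:E.
Proof.
have mh (r : R) : measurable (h @^-1` [set r]) by [].
have ind_ge0 (r : R) x : 0 <= (r * \1_(h @^-1` [set r]) x)%:E.
  exact: nnfun_muleindic_ge0.
under eq_integral do rewrite fimfunE -fsumEFin//.
rewrite ge0_integral_fsum//; first last.
  by move=> r; apply/measurable_EFinP/measurable_funM.
have -> : \int[mu]_(x in D) (h x * w x)%:E =
    \int[mu]_(x in D) (\sum_(r \in range h) (r * \1_(h @^-1` [set r]) x)%:E * (w x)%:E).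
  apply: eq_integral => x _; rewrite -ge0_mule_fsuml//.
  by rewrite fsumEFin// -fimfunE EFinM.
rewrite ge0_integral_fsum//; first last.
- by move=> r x _; apply: mule_ge0; [exact: ind_ge0|rewrite lee_fin].
- move=> r; apply/emeasurable_funM; apply/measurable_EFinP.
    exact: measurable_funM.
  exact: measurable_funTS.
apply: eq_fsbigr => r /set_mem[t _ rt]; have r0 : (0 <= r)%R by rewrite -rt.
rewrite (integralZl_indic _ (fun r => h @^-1` [set r]))//; last first.
  by move=> r_lt0; move: r0; rewrite leNgt r_lt0.
rewrite integral_indic// nuE//; last exact: measurableI.
rewrite setIC integral_mkcondr -ge0_integralZl//.
- by apply: eq_integral => x _; rewrite epatch_indic EFinM -muleA [X in _ * X]muleC.
- rewrite epatch_indic; apply: emeasurable_funM; apply/measurable_EFinP => //.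
  exact: measurable_funTS.
- by move=> x _; rewrite epatch_indic mule_ge0 ?lee_fin.
Qed.

(** Monotone convergence from simple functions. It will be applied to the pushforward of spherical
    measure, whose density is known on subsets of the sphere. *)
Lemma ge0_integral_density (f : T -> \bar R) : measurable_fun D f ->
  (forall x, D x -> 0 <= f x) ->
  \int[nu]_(x in D) f x = \int[mu]_(x in D) (f x * (w x)%:E).
Proof.
move=> mf f0; pose h := nnsfun_approx mD mf.
have nd_h x : D x -> {homo (fun k => (h k x)%:E) : a b / (a <= b)%N >-> a <= b}.
  by move=> Dx a b ab; rewrite lee_fin; exact/lefP/nd_nnsfun_approx.
have -> : \int[nu]_(x in D) f x = limn (fun k => \int[nu]_(x in D) (h k x)%:E).
  rewrite -monotone_convergence//.
  - by apply: eq_integral => x /[!inE] Dx; apply/esym/cvg_lim => //; exact: cvg_nnsfun_approx.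
  - by move=> k; apply/measurable_EFinP; apply: measurable_funTS.
  - by move=> k x _; rewrite lee_fin.
have -> : \int[mu]_(x in D) (f x * (w x)%:E) =
    limn (fun k => \int[mu]_(x in D) (h k x * w x)%:E).
  rewrite -monotone_convergence//.
  - apply: eq_integral => x /[!inE] Dx; apply/esym/cvg_lim => //.
    under eq_cvg do rewrite EFinM.
    by apply: cvgeZr => //; exact: cvg_nnsfun_approx.
  - move=> k; apply/measurable_EFinP; apply: measurable_funM; exact: measurable_funTS.
  - by move=> k x _; rewrite lee_fin mulr_ge0.
  - by move=> x Dx a b ab; rewrite !EFinM lee_wpmul2r ?lee_fin// -lee_fin; exact: nd_h.
by congr (limn _); apply/funext => k; exact: density_nnsfun.
Qed.

End density.

Section direction.
Context (R : realType) (n : nat).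
Implicit Types (x u : 'rV[R]_n).
Local Notation dir := (@direction R n).
Local Notation S := (@sphere R n).

Lemma enorm_direction x : x != 0 -> S (dir x).
Proof.
move=> x0; rewrite /sphere /= /direction enormZ ger0_norm ?invr_ge0 ?enorm_ge0//.
by rewrite mulVf// enorm_eq0.
Qed.

Lemma directionK x : enorm x *: (dir x : 'rV[R]_n) = x.
Proof.
have [->|x0] := eqVneq x 0; first by rewrite enorm0 scale0r.
by rewrite /direction scalerA divff ?scale1r// enorm_eq0.
Qed.

Lemma direction_id u : S u -> dir u = u.
Proof. by rewrite /sphere /direction /= => ->; rewrite invr1 scale1r. Qed.

Lemma directionZ x (t : R) : 0 < t -> dir (t *: x) = dir x.
Proof.
move=> t0; rewrite /direction enormZ gtr0_norm// invfM scalerA mulrAC.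
by rewrite mulVf ?mul1r// gt_eqF.
Qed.

Lemma direction_mulmx x (L : 'M[R]_n) : x != 0 ->
  dir ((dir x : 'rV[R]_n) *m L) = dir (x *m L).
Proof.
move=> x0; have -> : (dir x : 'rV[R]_n) *m L = (enorm x)^-1 *: (x *m L).
  by rewrite /direction -scalemxAl.
by rewrite directionZ// invr_gt0 enorm_gt0.
Qed.

Lemma mulmx_neq0 x (L : 'M[R]_n) : L \in unitmx -> x != 0 -> x *m L != 0.
Proof.
by move=> uL; apply: contraNneq => xL; rewrite -(mulmxK uL x) xL mul0mx.
Qed.

Lemma direction_mulmxK (L : 'M[R]_n) u : L \in unitmx -> S u ->
  dir ((dir (u *m L) : 'rV[R]_n) *m invmx L) = u.
Proof.
move=> uL Su; have u0 := sphere_neq0 Su.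
by rewrite direction_mulmx ?mulmx_neq0// mulmxK// direction_id.
Qed.

Lemma measurable_direction_mulmx (L : 'M[R]_n) : measurable_fun [set: borelRn R n]
  ((fun x => dir ((x : 'rV[R]_n) *m L)) : borelRn R n -> borelRn R n).
Proof.
exact: (measurableT_comp (@measurable_direction R n) (measurable_mulmxr L)).
Qed.

Lemma measurable_enorm_mulmx (L : 'M[R]_n) : measurable_fun [set: borelRn R n]
  (fun x : borelRn R n => enorm ((x : 'rV[R]_n) *m L)).
Proof.
exact: (measurableT_comp (@measurable_enorm R n) (measurable_mulmxr L)).
Qed.

Lemma spherical_measure_sphereC (A : set (borelRn R n)) :
  A `&` S = set0 -> spherical_measure A = 0%E.
Proof.
move=> AS; rewrite /spherical_measure (_ : _ `&` _ = set0) ?measure0 ?mule0//.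
apply/seteqP; split => // x [/= Ax /andP[x0 _]].
have : (A `&` S) (dir x) by split => //; apply: enorm_direction; rewrite -enorm_gt0.
by rewrite AS.
Qed.

(** Dilation by [s] preserves directions and multiplies volume by [s ^+ n]. *)
Lemma cone_volume (B : set (borelRn R n)) (s : R) : measurable B -> 0 < s ->
  (n%:R%:E * lebesgue_rV R n (dir @^-1` B `&` [set x | (0 < enorm (x : 'rV[R]_n) <= s)%R]) =
   (s ^+ n)%:E * spherical_measure B)%E.
Proof.
move=> mB s0; rewrite /spherical_measure muleCA; congr (_ * _)%E.
have sV : s^-1 != 0 by rewrite gt_eqF// invr_gt0.
have us : ((s^-1)%:M : 'M[R]_n) \in unitmx.
  by rewrite unitmxE det_scalar unitfE expf_neq0.
set Y := dir @^-1` B `&` @punctured_eball R n.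
have mY : measurable Y.
  apply: measurableI; last exact: measurable_punctured_eball.
  exact: (preimage_measurable (@measurable_direction R n)).
have := lebesgue_rV_linear us mY.
rewrite det_scalar ger0_norm ?exprn_ge0 ?invr_ge0 ?ltW// exprVn invrK => <-.
congr (lebesgue_rV R n _); apply/funext => x /=; rewrite /Y /= mul_mx_scalar.
rewrite directionZ ?invr_gt0// /punctured_eball /= enormZ gtr0_norm ?invr_gt0//.
by rewrite pmulr_rgt0 ?invr_gt0// ler_pdivrMl// mulr1.
Qed.

End direction.

Section sphere_change_of_variables.
Context (R : realType) (n : nat).
Variable L : 'M[R]_n.
Hypothesis detL : `|\det L| = 1.
Local Notation dir := (@direction R n).
Local Notation S := (@sphere R n : set (borelRn R n)).
Local Notation sigma := (@spherical_measure R n).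

Let uL : L \in unitmx.
Proof. by rewrite unitmxE unitfE -normr_gt0 detL. Qed.

Let r (u : borelRn R n) : R := enorm ((u : 'rV[R]_n) *m L).
(** The Jacobian of [u |-> dir (u *m L)]. The inverse is a power with exponent -1 so that
    [measurable_powR] applies. *)
Let w (u : borelRn R n) : R := (r u `^ (- 1)) ^+ n.

Let wE u : w u = (r u)^-1 ^+ n.
Proof. by rewrite /w powR_inv1// enorm_ge0. Qed.

Let mw : measurable_fun [set: borelRn R n] w.
Proof.
apply: measurable_funX; apply: (measurableT_comp (measurable_powR _)).
exact: measurable_enorm_mulmx.
Qed.

Let w0 u : 0 <= w u.
Proof. by rewrite wE exprn_ge0// invr_ge0 enorm_ge0. Qed.

Let r_gt0 u : S u -> 0 < r u.
Proof. by move=> /sphere_neq0 u0; rewrite enorm_gt0 mulmx_neq0. Qed.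

Let P : set (borelRn R n) := [set x | 0 < enorm ((x : 'rV[R]_n) *m L) <= 1].

Let mP : measurable P.
Proof.
rewrite (_ : P = (fun x : borelRn R n => enorm ((x : 'rV[R]_n) *m L)) @^-1` `]0, 1]%classic).
  by apply: (preimage_measurable (measurable_enorm_mulmx L)).
by apply/seteqP; split => x /=; rewrite in_itv.
Qed.

(** [n] times the volume of the part of the cone over [B] that lies in the ellipsoid
    [enorm (x *m L) <= 1]. *)
Let m1 (B : set (borelRn R n)) : \bar R :=
  (n%:R%:E * lebesgue_rV R n (dir @^-1` B `&` P))%E.
Let m2 (B : set (borelRn R n)) : \bar R := (\int[sigma]_(u in B) (w u)%:E)%E.

Let mdir (B : set (borelRn R n)) : measurable B -> measurable (dir @^-1` B).
Proof. exact: (preimage_measurable (@measurable_direction R n)). Qed.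

(** [L] carries this part of the cone onto the part of the unit ball over the image of [B], and it
    preserves volume. *)
Let m1_image (B : set (borelRn R n)) : measurable B -> B `<=` S ->
  sigma ((fun v : borelRn R n => dir ((v : 'rV[R]_n) *m invmx L)) @^-1` B) = m1 B.
Proof.
move=> mB BS; rewrite /spherical_measure /m1; congr (_ * _)%E.
set Y := _ `&` _.
have mY : measurable Y.
  apply: measurableI; last exact: measurable_punctured_eball.
  apply: mdir; exact: (preimage_measurable (measurable_direction_mulmx _)).
have := lebesgue_rV_linear uL mY; rewrite detL invr1 mul1e => <-.
congr (lebesgue_rV R n _); apply/seteqP; split => x /=.
  move=> [Bx xL]; split => //; move: Bx; rewrite /=.
  have xL0 : x *m L != 0 by move: xL => /andP[]; rewrite enorm_gt0.
  by rewrite direction_mulmx// mulmxK.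
move=> [Bx xL]; split => //=.
have xL0 : x *m L != 0 by move: xL => /andP[]; rewrite enorm_gt0.
by rewrite direction_mulmx// mulmxK.
Qed.

Let mm2 (B : set (borelRn R n)) : measurable_fun B (fun u => (w u)%:E).
Proof. by apply/measurable_EFinP; exact: measurable_funTS. Qed.

Let m2_ge0 B : (0 <= m2 B)%E.
Proof. by apply: integral_ge0 => u _; rewrite lee_fin. Qed.

Let m1_add (X Y : set (borelRn R n)) : measurable X -> measurable Y ->
  X `&` Y = set0 -> m1 (X `|` Y) = (m1 X + m1 Y)%E.
Proof.
move=> mX mY XY; rewrite /m1 preimage_setU setIUl measureU.
- by rewrite ge0_muleDr.
- by apply: measurableI => //; exact: mdir.
- by apply: measurableI => //; exact: mdir.
- by rewrite setIACA setIid -preimage_setI XY preimage_set0 set0I.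
Qed.

Let m2_add (X Y : set (borelRn R n)) : measurable X -> measurable Y ->
  X `&` Y = set0 -> m2 (X `|` Y) = (m2 X + m2 Y)%E.
Proof.
move=> mX mY XY; apply: ge0_integral_setU => //.
- by move=> u _; rewrite lee_fin.
by apply/disj_setPS; rewrite XY.
Qed.

(** On a small cell [r] stays within a factor [c] of [r v], so the ellipsoidal cone lies between the
    round cones of radii [(c * r v)^-1] and [c / r v]. The integral of [w] obeys the same two
    bounds, whose ratio is [c ^+ (2 * n)]. *)
Let near_cell (b : R) : 1 < b -> exists N, forall (j : {ffun 'I_n -> 'I_N.+1})
  (B : set (borelRn R n)), measurable B -> B `<=` S -> B `<=` sphere_cell j ->
  (m1 B <= b%:E * m2 B /\ m2 B <= b%:E * m1 B)%E.
Proof.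
move=> b1; have [c c1 cb] := exists_root_gt1 (2 * n) b1.
have c0 : 0 < c := lt_trans ltr01 c1.
have [eta eta0 loc] := enorm_mulmx_near uL c1.
have [N Nmesh] := @sphere_cell_mesh R n eta eta0.
exists N => j B mB BS Bj.
have [->|/eqP/set0P[v Bv]] := pselect (B = set0).
  by rewrite /m1 /m2 preimage_set0 set0I measure0 integral_set0 !mule0.
have v1 : S v := BS _ Bv.
have rv0 := r_gt0 v1.
have r_le u : B u -> r u <= c * r v.
  by move=> Bu; apply: loc => //; exact: Nmesh (Bj _ Bu) (Bj _ Bv).
have r_ge u : B u -> r v <= c * r u.
  by move=> Bu; apply: loc (BS _ Bu) _; exact: Nmesh (Bj _ Bv) (Bj _ Bu).
pose ball s : set (borelRn R n) := [set x | 0 < enorm (x : 'rV[R]_n) <= s].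
have mball s : measurable (ball s).
  rewrite (_ : ball s = @enorm R n @^-1` `]0, s]%classic).
    by apply: (preimage_measurable (@measurable_enorm R n)).
  by apply/seteqP; split => x /=; rewrite in_itv.
have enormL (x : 'rV[R]_n) : enorm (x *m L) = enorm x * r (dir x).
  by rewrite /r -[in LHS](directionK x) -scalemxAl enormZ ger0_norm ?enorm_ge0.
have up : dir @^-1` B `&` P `<=` dir @^-1` B `&` ball (c / r v).
  move=> x [Bx /= /andP[xL0 xL1]]; split => //=.
  have x0 : 0 < enorm (x : 'rV[R]_n).
    by move: xL0; rewrite !enorm_gt0; apply: contraNneq => ->; rewrite mul0mx.
  apply/andP; split => //.
  rewrite ler_pdivlMr//; have := r_ge _ Bx; move: xL1; rewrite enormL => h.
  move=> /(ler_wpM2l (ltW x0)) /le_trans; apply.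
  by rewrite mulrCA ler_piMr// ltW.
have lo : dir @^-1` B `&` ball (c * r v)^-1 `<=` dir @^-1` B `&` P.
  move=> x [Bx /= /andP[x0 x1]]; split => //=; rewrite /P /= enormL.
  apply/andP; split; first exact: mulr_gt0 x0 (r_gt0 (BS _ Bx)).
  have := r_le _ Bx.
  move=> /(ler_wpM2l (ltW x0)) /le_trans; apply.
  by rewrite -ler_pdivlMr ?mulr_gt0// mul1r.
have crv0 : 0 < c / r v by rewrite divr_gt0.
have crv0' : 0 < (c * r v)^-1 by rewrite invr_gt0 mulr_gt0.
have mBball s : measurable (dir @^-1` B `&` ball s) := measurableI _ _ (mdir mB) (mball s).
have mBP : measurable (dir @^-1` B `&` P) := measurableI _ _ (mdir mB) mP.
have m1_up : (m1 B <= ((c / r v) ^+ n)%:E * sigma B)%E.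
  rewrite -cone_volume// lee_wpmul2l ?lee_fin//.
  exact: (le_measure (lebesgue_rV R n) (mem_set mBP) (mem_set (mBball _)) up).
have m1_lo : (((c * r v)^-1 ^+ n)%:E * sigma B <= m1 B)%E.
  rewrite -cone_volume// lee_wpmul2l ?lee_fin//.
  exact: (le_measure (lebesgue_rV R n) (mem_set (mBball _)) (mem_set mBP) lo).
have m2_up : (m2 B <= ((c / r v) ^+ n)%:E * sigma B)%E.
  rewrite -integral_cst//; apply: ge0_le_integral => //.
  - by move=> u _; rewrite lee_fin.
  - move=> u Bu; have ru0 := r_gt0 (BS _ Bu).
    rewrite lee_fin wE lerXn2r ?nnegrE ?(ltW crv0) ?invr_ge0 ?(ltW ru0)//.
    by rewrite ler_pdivlMr// mulrC ler_pdivrMr//; exact: r_ge.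
have m2_lo : (((c * r v)^-1 ^+ n)%:E * sigma B <= m2 B)%E.
  rewrite -integral_cst//; apply: ge0_le_integral => //.
  - by move=> u _; rewrite lee_fin exprn_ge0 ?ltW.
  - move=> u Bu; have ru0 := r_gt0 (BS _ Bu).
    rewrite lee_fin wE lerXn2r ?nnegrE ?(ltW crv0') ?invr_ge0 ?(ltW ru0)//.
    by rewrite lef_pV2 ?posrE ?mulr_gt0//; exact: r_le.
have cE : (c / r v) ^+ n = c ^+ (2 * n) * (c * r v)^-1 ^+ n.
  rewrite exprM -exprMn; congr (_ ^+ _); rewrite invfM expr2 mulrA mulfK//.
  by rewrite gt_eqF.
have s0 : (0 <= ((c * r v)^-1 ^+ n)%:E * sigma B)%E.
  by rewrite mule_ge0// lee_fin exprn_ge0// ltW.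
have m1_ge0 : (0 <= m1 B)%E := le_trans s0 m1_lo.
have cb' : ((c ^+ (2 * n))%:E <= b%:E)%E by rewrite lee_fin.
have c0' : (0 <= (c ^+ (2 * n))%:E)%E by rewrite lee_fin exprn_ge0// ltW.
split.
  apply: le_trans m1_up _; rewrite cE EFinM -muleA.
  exact: le_trans (lee_wpmul2l c0' m2_lo) (lee_wpmul2r (m2_ge0 _) cb').
apply: le_trans m2_up _; rewrite cE EFinM -muleA.
exact: le_trans (lee_wpmul2l c0' m1_lo) (lee_wpmul2r m1_ge0 cb').
Qed.

Let m1_m2 (B : set (borelRn R n)) : measurable B -> B `<=` S -> m1 B = m2 B.
Proof.
move=> mB BS.
have m1_ge0 X : (0 <= m1 X)%E by rewrite mule_ge0 ?lee_fin.
have m10 : m1 set0 = 0%E by rewrite /m1 preimage_set0 set0I measure0 mule0.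
have m20 : m2 set0 = 0%E by rewrite /m2 integral_set0.
have sum1 N : m1 B = (\sum_(j : {ffun 'I_n -> 'I_N.+1}) m1 (B `&` sphere_cell j))%E.
  by apply: sphere_grid_sum => // X Y *; exact: m1_add.
have sum2 N : m2 B = (\sum_(j : {ffun 'I_n -> 'I_N.+1}) m2 (B `&` sphere_cell j))%E.
  by apply: sphere_grid_sum => // X Y *; exact: m2_add.
have cell (b : R) : 1 < b -> exists N, forall j : {ffun 'I_n -> 'I_N.+1},
    (m1 (B `&` sphere_cell j) <= b%:E * m2 (B `&` sphere_cell j) /\
     m2 (B `&` sphere_cell j) <= b%:E * m1 (B `&` sphere_cell j))%E.
  move=> b1; have [N hN] := near_cell b1; exists N => j; apply: (hN j).
  - by apply: measurableI => //; exact: measurable_sphere_cell.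
  - by move=> x [/BS].
  - by move=> x [].
apply/eqP; rewrite eq_le; apply/andP; split.
  apply: (@le_sphere_grid R n) => //; first by move=> N; rewrite -sum1.
  by move=> b /cell[N hN]; exists N => j; have [] := hN j.
apply: (@le_sphere_grid R n) => //; first by move=> N; rewrite -sum2.
by move=> b /cell[N hN]; exists N => j; have [] := hN j.
Qed.

(** The set on the left is the image of [B] under [g]. The pushforward of [sigma] under [ginv] has
    density [w] on [B], and the formula is the integral of [F \o g] against it. *)
Theorem sphere_change_of_variables (B : set (borelRn R n)) (F : borelRn R n -> \bar R) :
  measurable B -> B `<=` S ->
  measurable_fun S F -> (forall u, S u -> 0 <= F u)%E ->
  (\int[sigma]_(v in S `&` (fun v : borelRn R n => dir ((v : 'rV[R]_n) *m invmx L)) @^-1` B) F v =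
   \int[sigma]_(u in B) (F (dir ((u : 'rV[R]_n) *m L)) *
     (enorm ((u : 'rV[R]_n) *m L) ^- n)%:E))%E.
Proof.
move=> mB BS mF F0.
pose ginv : borelRn R n -> borelRn R n := fun v => dir ((v : 'rV[R]_n) *m invmx L).
pose g : borelRn R n -> borelRn R n := fun v => dir ((v : 'rV[R]_n) *m L).
have mginv : measurable_fun setT ginv := measurable_direction_mulmx (invmx L).
have gS u : S u -> S (g u).
  by move=> /sphere_neq0 u0; apply: enorm_direction; exact: mulmx_neq0.
have mFg : measurable_fun B (F \o g).
  apply: (@measurable_comp _ _ _ _ _ _ S) => //.
  - exact: measurable_sphere.
  - by move=> _ [u Bu <-]; apply/gS/BS.
  - by apply: measurable_funTS; exact: measurable_direction_mulmx.
pose nu := measure_function_pushforward__canonical__measure_function_Measure sigma mginv.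
have nuE (A : set (borelRn R n)) : measurable A -> A `<=` B ->
    nu A = (\int[sigma]_(u in A) (w u)%:E)%E.
  move=> mA AB; have AS : A `<=` S by move=> u /AB/BS.
  by rewrite -[RHS](m1_m2 mA AS); exact: m1_image.
have mw0 u : 0 <= w u by exact: w0.
have uLV : invmx L \in unitmx by rewrite unitmx_inv.
have mgB : measurable (ginv @^-1` B) := preimage_measurable mginv mB.
have mG : measurable_fun (ginv @^-1` B) (F \o g \o ginv).
  apply: (@measurable_comp _ _ _ _ _ _ B) => //.
    by move=> _ [v Bv <-].
  exact: measurable_funTS.
have := @ge0_integral_density _ _ _ sigma nu w B mB mw mw0 nuE (F \o g) mFg.
rewrite (@ge0_integral_pushforward _ _ _ _ _ _ mginv sigma B (F \o g))//; last first.
  by move=> u /set_mem Bu; apply/F0/gS/BS.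
rewrite (ge0_negligible_integral (measurableC (@measurable_sphere R n)) mgB mG).
- move=> h; rewrite setDE setCK setIC in h; transitivity
    (\int[sigma]_(x in S `&` ginv @^-1` B) (F \o g \o ginv) x)%E.
    apply: eq_integral => v /set_mem[Sv _]; rewrite /= /g /ginv.
    by have := direction_mulmxK uLV Sv; rewrite invmxK => ->.
  rewrite h; last by move=> u Bu; apply/F0/gS/BS.
  by apply: eq_integral => u _; rewrite wE exprVn.
- by move=> v Bv; apply/F0/gS/BS.
- by apply: spherical_measure_sphereC; rewrite setICl.
Qed.


End sphere_change_of_variables.

(** * Linear images of convex bodies *)

Section linear_image.
Context (R : realType) (n : nat).
Implicit Types (K L : set 'rV[R]_n) (T : 'M[R]_n) (u x y : 'rV[R]_n).

Lemma SL_unitmx T : SL T -> T \in unitmx.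
Proof. by rewrite unitmxE unitfE -normr_gt0 => ->. Qed.

Lemma SL_invmx T : SL T -> SL (invmx T).
Proof. by rewrite /SL det_inv normfV => ->; rewrite invr1. Qed.

Lemma SL_trmx T : SL T -> SL T^T.
Proof. by rewrite /SL det_tr. Qed.

Lemma lin_imageK T K : T \in unitmx -> lin_image (invmx T) (lin_image T K) = K.
Proof.
move=> uT; rewrite /lin_image image_comp; apply/seteqP; split => [_ [x Kx <-]|x Kx] /=.
  by rewrite trmx_inv mulmxK ?unitmx_tr.
by exists x => //=; rewrite trmx_inv mulmxK ?unitmx_tr.
Qed.

Lemma lin_imageE T K : T \in unitmx ->
  lin_image T K = (fun x : 'rV[R]_n => x *m invmx T^T) @^-1` K.
Proof.
move=> uT; apply/seteqP; split => [_ [x Kx <-]|x Kx] /=.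
  by rewrite mulmxK ?unitmx_tr.
by exists (x *m invmx T^T) => //; rewrite mulmxKV ?unitmx_tr.
Qed.

Lemma support_fun_lin_image T K u :
  support_fun (lin_image T K) u = support_fun K (u *m T).
Proof.
congr (sup _); rewrite /lin_image image_comp; apply: eq_imagel => x _ /=.
by rewrite dotp_mulmxl trmxK.
Qed.

Lemma lin_image_compact T K : compact K -> compact (lin_image T K).
Proof.
move=> cK; apply: continuous_compact cK.
by apply: continuous_subspaceT; exact: mulmxr_continuous.
Qed.

Lemma lin_image_convex T K : convex_set K -> convex_set (lin_image T K).
Proof.
move=> cK x y k /set_mem[x' Kx' <-] /set_mem[y' Ky' <-]; apply/mem_set.
exists (conv k (x' : convex_lmodType 'rV[R]_n) y').
  by apply/set_mem; apply: cK; exact/mem_set.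
by rewrite /conv/= mulmxDl -!scalemxAl.
Qed.

Lemma lin_image_interior T K x : T \in unitmx -> K° x ->
  (lin_image T K)° (x *m T^T).
Proof.
move=> uT Kx; rewrite lin_imageE//.
have : nbhs ((x *m T^T) *m invmx T^T) K by rewrite mulmxK ?unitmx_tr.
exact: mulmxr_continuous.
Qed.

Lemma lin_image_K0 T K : T \in unitmx -> is_K0 K -> is_K0 (lin_image T K).
Proof.
move=> uT [[convK cK _] K0].
have TK0 : (lin_image T K)° 0 by rewrite -(mul0mx _ T^T); exact: lin_image_interior.
split => //; split; [exact: lin_image_convex|exact: lin_image_compact|by exists 0].
Qed.

Lemma polar_lin_image T K :
  polar (lin_image T K) = (fun y : 'rV[R]_n => y *m T) @^-1` polar K.
Proof.
apply/seteqP; split => y /= Ky x.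
  by move=> Kx; rewrite -[T]trmxK -dotp_mulmxl; apply: Ky; exists x.
by move=> [x' Kx' <-]; rewrite dotp_mulmxl trmxK; exact: Ky.
Qed.

Lemma polar_closed K : closed (polar K).
Proof.
rewrite (_ : polar K = \bigcap_(x in K) [set y | dotp y x <= 1]).
  apply: closed_bigI => x _.
  apply: (@closed_comp _ _ (fun y : 'rV[R]_n => dotp y x) [set t | t <= 1]).
    by move=> y _; exact: dotp_continuous.
  exact: closed_le.
by apply/seteqP; split => y Ky x Kx; have := Ky x Kx; rewrite /= dotpC.
Qed.

Lemma lebesgue_rV_SL T (A : set (borelRn R n)) : SL T -> measurable A ->
  lebesgue_rV R n ((fun x : 'rV[R]_n => x *m T) @^-1` A) = lebesgue_rV R n A.
Proof.
by move=> sT mA; rewrite lebesgue_rV_linear ?SL_unitmx// sT invr1 mul1e.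
Qed.

Local Notation S := (@sphere R n : set (borelRn R n)).
Local Notation dir := (@direction R n).

Lemma direction_mulmx_sphere T u : T \in unitmx -> S u -> S (dir (u *m T)).
Proof.
by move=> uT /sphere_neq0 u0; apply: enorm_direction; exact: mulmx_neq0.
Qed.

Lemma support_fun_direction K x : compact K -> K !=set0 -> x != 0 ->
  support_fun K x = enorm x * support_fun K (dir x).
Proof.
by move=> cK K0 x0; rewrite -[in LHS](directionK x) support_funZ// enorm_gt0.
Qed.

(** [u] is normal to TK at Tx exactly when T^t u is a positive multiple of a unit normal to K at x.
    On row vectors, Tx is [x *m T^T] and T^t u is [u *m T]. *)
Lemma contact_lin_image T K (B : set 'rV[R]_n) : T \in unitmx -> compact K ->
  B `<=` S ->
  contact (lin_image T K) B =
  [set x *m T^T | x in contact K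
    (S `&` (fun v : borelRn R n => dir ((v : 'rV[R]_n) *m invmx T)) @^-1` B)].
Proof.
move=> uT cK BS; have cTK : compact (lin_image T K) by exact: lin_image_compact.
have uTV : invmx T \in unitmx by rewrite unitmx_inv.
apply/seteqP; split => [y /(contactP _ _ cTK)[[x Kx <-] [u [Bu u1] yu]]|].
  exists x => //; apply/(contactP _ _ cK); split => //.
  exists (dir (u *m T)).
    split; last exact: direction_mulmx_sphere.
    split; first exact: direction_mulmx_sphere.
    by rewrite /= direction_mulmxK.
  move=> z Kz; have /yu : lin_image T K (z *m T^T) by exists z.
  have uT0 : 0 < enorm (u *m T) by rewrite enorm_gt0 mulmx_neq0// sphere_neq0.
  rewrite -mulmxBl dotp_mulmxl trmxK.
  have -> : dotp (z - x) (u *m T) = enorm (u *m T) * dotp (z - x) (dir (u *m T)).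
    by rewrite -dotpZr directionK.
  by rewrite pmulr_rle0.
move=> _ [x /(contactP _ _ cK)[Kx [v [[Sv Bv] _] xv]] <-].
apply/(contactP _ _ cTK); split; first by exists x.
exists (dir (v *m invmx T)).
  by split => //; exact: direction_mulmx_sphere.
move=> _ [z Kz <-]; have := xv _ Kz.
rewrite -mulmxBl dotp_mulmxl trmxK => h.
have -> : (dir (v *m invmx T) : 'rV[R]_n) *m T = (enorm (v *m invmx T))^-1 *: v.
  by rewrite /direction -scalemxAl mulmxKV.
by rewrite dotpZr pmulr_rle0// invr_gt0 enorm_gt0 mulmx_neq0// sphere_neq0.
Qed.

End linear_image.

(** * The curvature function of a linear image *)

Section curvature_lin_image.
Context (R : realType) (d : nat).
Local Notation n := d.+1.
Variables (T : 'M[R]_n) (K : set 'rV[R]_n) (f : 'rV[R]_n -> R).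
Hypotheses (sT : SL T) (cK : compact K) (Kf : is_curvature_fun K f).
Local Notation S := (@sphere R n : set (borelRn R n)).
Local Notation dir := (@direction R n).
Local Notation sigma := (@spherical_measure R n).

Let uT := SL_unitmx sT.

(* This is f_{TK} when [f] is f_K. *)
Definition curvature_lin_image (u : 'rV[R]_n) : R :=
  enorm (u *m T) ^- n.+1 * f (dir (u *m T)).

(** This supplies one of the [n.+1] inverse factors in [curvature_lin_image]; the other [n] are the
    Jacobian. *)
Let scale_direction u : S u ->
  normal_scale T^T (dir (u *m T)) = (enorm ((u : 'rV[R]_n) *m T))^-1.
Proof.
move=> Su; rewrite /normal_scale trmxK /direction -scalemxAl mulmxK// enormZ.
by rewrite Su mulr1 ger0_norm// invr_ge0 enorm_ge0.
Qed.

Lemma measurable_comp_direction_mulmx (F : borelRn R n -> R) :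
  measurable_fun S F ->
  measurable_fun S (fun u : borelRn R n => F (dir ((u : 'rV[R]_n) *m T))).
Proof.
move=> mF; apply: (@measurable_comp _ _ _ _ _ _ S F) => //.
- exact: measurable_sphere.
- by move=> _ [u Su <-]; exact: direction_mulmx_sphere.
- by apply: measurable_funTS; exact: measurable_direction_mulmx.
Qed.

Let mf : measurable_fun S f. Proof. by have [] := Kf. Qed.
Let f0 u : S u -> 0 <= f u. Proof. by have [_ h _] := Kf; exact: h. Qed.

Let nsf (v : borelRn R n) : \bar R := (normal_scale T^T v * f v)%:E.

Let mnsf : measurable_fun S nsf.
Proof.
apply/measurable_EFinP; apply: measurable_funM => //.
apply: measurable_funTS; apply: continuous_measurable_rV.
exact: normal_scale_continuous.
Qed.

Let nsf0 v : S v -> (0 <= nsf v)%E.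
Proof. by move=> Sv; rewrite lee_fin mulr_ge0 ?enorm_ge0// f0. Qed.

Let curvature_change (B : set (borelRn R n)) : measurable B -> B `<=` S ->
  (\int[sigma]_(v in S `&` (fun v : borelRn R n => dir ((v : 'rV[R]_n) *m invmx T)) @^-1` B) nsf v =
   \int[sigma]_(u in B) (curvature_lin_image u)%:E)%E.
Proof.
move=> mB BS; rewrite sphere_change_of_variables//.
apply: eq_integral => u /set_mem Bu; rewrite /nsf -EFinM; congr EFin.
rewrite scale_direction; last exact: BS.
by rewrite /curvature_lin_image -!exprVn mulrAC -exprS.
Qed.

Lemma curvature_lin_imageP : is_curvature_fun (lin_image T K) curvature_lin_image.
Proof.
split.
- apply: measurable_funM; last exact: measurable_comp_direction_mulmx.
  apply: measurable_funTS.
  rewrite (_ : (fun _ => _) = (fun u : borelRn R n =>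
      (enorm ((u : 'rV[R]_n) *m T) `^ (- 1)) ^+ n.+1)).
    apply: measurable_funX; apply: (measurableT_comp (measurable_powR _)).
    exact: measurable_enorm_mulmx.
  by apply/funext => u; rewrite powR_inv1 ?enorm_ge0// exprVn.
- move=> u Su; rewrite mulr_ge0 ?invr_ge0 ?exprn_ge0 ?enorm_ge0//.
  by apply: f0; exact: direction_mulmx_sphere.
move=> B mB BS.
rewrite surface_area_measureE contact_lin_image// -curvature_change//.
apply: (@contact_image_measure R d T^T K _ cK f Kf).
- by rewrite det_tr.
- apply: measurableI; first exact: measurable_sphere.
  exact: (preimage_measurable (measurable_direction_mulmx _)).
- by move=> v [].
Qed.

Lemma curvature_lin_image_lty :
  (\int[sigma]_(u in S) (curvature_lin_image u)%:E < +oo)%E.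
Proof.
rewrite -curvature_change//; last exact: measurable_sphere.
rewrite (_ : _ `&` _ = S); first exact: (contact_image_integral_lty (SL_trmx sT) cK Kf).
apply: setIidl => v Sv; apply: direction_mulmx_sphere => //.
by rewrite unitmx_inv.
Qed.

End curvature_lin_image.

(** Both functions have the integral S(K, B) over every Borel set [B] of the sphere; finiteness of
    the total makes [f] integrable, so these integrals determine it almost everywhere. *)
Lemma curvature_fun_unique (R : realType) n (K : set 'rV[R]_n) (f g : 'rV[R]_n -> R) :
  is_curvature_fun K f -> is_curvature_fun K g ->
  (\int[@spherical_measure R n]_(u in @sphere R n) (f u)%:E < +oo)%E ->
  ae_eq (@spherical_measure R n) (@sphere R n)
    (EFin \o f : borelRn R n -> \bar R) (EFin \o g).
Proof.
move=> [mf f0 fE] [mg g0 gE] foo.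
apply: integral_ae_eq.
- exact: measurable_sphere.
- apply/integrableP; split; first exact/measurable_EFinP.
  rewrite (eq_integral (EFin \o f : borelRn R n -> \bar R))// => u /set_mem Su /=.
  by rewrite ger0_norm// f0.
- exact/measurable_EFinP.
- by move=> B BS mB; rewrite -fE// -gE.
Qed.

(** * The Orlicz functionals *)

Section orlicz_measurable.
Context (R : realType) (n : nat).
Local Notation pos := (`]0, +oo[%classic : set R).

Let posE (x : R) : pos x = (0 < x) :> Prop.
Proof. by rewrite /= in_itv/= andbT. Qed.

Let measurable_const_pos (F : R -> R) : pos_constant F -> measurable_fun pos F.
Proof.
move=> [c Fc]; apply: (@eq_measurable_fun _ _ _ _ _ (cst c)) => //.
by move=> x /set_mem; rewrite posE => /Fc.
Qed.

(* The sublevel sets are intervals. *)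
Let measurable_convex_pos (F : R -> R) : pos_strictly_convex F -> measurable_fun pos F.
Proof.
move=> Fconv; apply: (measurability _ (RGenInftyO.measurableE R)) => //.
move=> _ [_ [a ->] <-]; apply: is_interval_measurable => x y [x0 xa] [y0 ya] z.
move: x0 y0 xa ya; rewrite /= !in_itv/= !andbT => x0 y0 xa ya /andP[].
rewrite le_eqVlt => /orP[/eqP<- //|xz].
rewrite le_eqVlt => /orP[/eqP-> //|zy].
split; first exact: lt_trans xz.
have yx0 : 0 < y - x by rewrite subr_gt0 (lt_trans xz).
pose t := (y - z) / (y - x).
have t01 : 0 < t < 1.
  apply/andP; split; first by rewrite divr_gt0// subr_gt0.
  by rewrite /t ltr_pdivrMr// mul1r ltrD2l ltrN2.
have zE : z = t * x + (1 - t) * y by rewrite /t; field; rewrite gt_eqF.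
rewrite zE; apply: lt_trans (Fconv x y t x0 y0 _ t01) _.
  by rewrite lt_eqF// (lt_trans xz).
have /andP[t0 t1] := t01; have t1' : 0 < 1 - t by rewrite subr_gt0.
have -> : a = t * a + (1 - t) * a by ring.
by rewrite ltrD// ltr_pM2l.
Qed.

Let measurable_increasing_pos (F : R -> R) : pos_increasing F -> measurable_fun pos F.
Proof.
move=> Finc; apply: (measurability _ (RGenOInfty.measurableE R)) => //.
move=> _ [_ [a ->] <-]; apply: is_interval_measurable => x y [x0 xa] [y0 ya] z.
move: x0 xa; rewrite /= !in_itv/= !andbT => x0 xa /andP[].
rewrite le_eqVlt => /orP[/eqP<- //|xz _].
split; first exact: lt_trans xz.
exact: lt_trans xa (Finc _ _ x0 xz).
Qed.

Lemma measurable_F_of (phi : R -> R) : (0 < n)%N ->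
  measurable_fun pos (F_of n phi) -> measurable_fun pos phi.
Proof.
move=> n0 mF; have n0' : n%:R != 0 :> R by rewrite pnatr_eq0 -lt0n.
apply: (@eq_measurable_fun _ _ _ _ _ (F_of n phi \o (fun s => s `^ (- n%:R)))).
  move=> s /set_mem; rewrite posE => s0; rewrite /F_of /= -powRrM.
  by rewrite mulrNN divff// powRr1// ltW.
apply: (@measurable_comp _ _ _ _ _ _ pos) => //.
  by move=> _ [s s0 <-]; move: s0; rewrite !posE; exact: powR_gt0.
by apply: measurable_funTS; exact: measurable_powR.
Qed.

Lemma is_Phi_measurable (phi : R -> R) : (0 < n)%N -> is_Phi n phi ->
  measurable_fun pos phi.
Proof.
move=> n0 [_ h]; apply: measurable_F_of => //.
by case: h; [exact: measurable_const_pos|exact: measurable_convex_pos].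
Qed.

Lemma is_Psi_measurable (phi : R -> R) : (0 < n)%N -> is_Psi n phi ->
  measurable_fun pos phi.
Proof.
move=> n0 [_ h]; apply: measurable_F_of => //.
by case: h; [exact: measurable_const_pos|move=> []/measurable_increasing_pos].
Qed.

End orlicz_measurable.

Section curvature_fun_lin_image.
Context (R : realType) (d : nat).
Local Notation n := d.+1.
Local Notation S := (@sphere R n : set (borelRn R n)).
Local Notation dir := (@direction R n).
Local Notation sigma := (@spherical_measure R n).
Variables (T : 'M[R]_n) (sT : SL T).

Lemma curvature_funP (K : set 'rV[R]_n) : is_F0 K -> is_curvature_fun K (curvature_fun K).
Proof. by move=> [_ Kf]; exact: (xgetPex _ Kf). Qed.

Lemma lin_image_F0 (K : set 'rV[R]_n) : is_F0 K -> is_F0 (lin_image T K).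
Proof.
move=> FK; have [K0 [f Kf]] := FK.
split; first by apply: lin_image_K0 => //; exact: SL_unitmx.
exists (curvature_lin_image T f); apply: curvature_lin_imageP => //.
exact: is_K0_compact.
Qed.

Lemma curvature_fun_lin_image (K : set 'rV[R]_n) : is_F0 K ->
  ae_eq sigma S (EFin \o curvature_lin_image T (curvature_fun K) : borelRn R n -> \bar R)
    (EFin \o curvature_fun (lin_image T K)).
Proof.
move=> FK; have [K0 _] := FK; have cK := is_K0_compact K0.
have Kf := curvature_funP FK.
apply: (@curvature_fun_unique _ _ (lin_image T K)).
- exact: curvature_lin_imageP.
- exact/curvature_funP/lin_image_F0.
- exact: (curvature_lin_image_lty sT cK Kf).
Qed.

Variables (phi : 'I_n -> R -> R) (K : 'I_n -> set 'rV[R]_n).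
Hypotheses (mphi : forall i, measurable_fun (`]0, +oo[%classic : set R) (phi i))
  (phi0 : forall i t, 0 < t -> 0 < phi i t) (FK : forall i, is_F0 (K i)).

(** The integrand of [V_gen], with the curvature functions as a separate argument so that one
    version can be exchanged for another. *)
Let X (K : 'I_n -> set 'rV[R]_n) (q : 'I_n -> 'rV[R]_n -> R)
    (f : 'I_n -> 'rV[R]_n -> R) (u : borelRn R n) : R :=
  \prod_(i < n) ((phi i (q i u) * support_fun (K i) u * f i u) `^ n%:R^-1).

Let mX (L : 'I_n -> set 'rV[R]_n) (q f : 'I_n -> 'rV[R]_n -> R) : (forall i, is_K0 (L i)) ->
  (forall i, measurable_fun S (q i)) -> (forall i u, S u -> 0 < q i u) ->
  (forall i, measurable_fun S (f i)) -> measurable_fun S (EFin \o X L q f).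
Proof.
move=> L0 mq q0 mf; apply/measurable_EFinP; apply: measurable_prod => i _.
apply: (measurableT_comp (measurable_powR _)); apply: measurable_funM => //.
apply: measurable_funM.
  apply: (@measurable_comp _ _ _ _ _ _ (`]0, +oo[%classic : set R)) => //.
  by move=> _ [u Su <-]; rewrite /= in_itv/= andbT q0.
apply: measurable_funTS; apply: continuous_measurable_rV.
apply: support_fun_continuous; first exact: is_K0_compact.
exact: is_K0_nonempty.
Qed.

Lemma V_gen_lin_image (q q' : 'I_n -> 'rV[R]_n -> R) :
  (forall i, measurable_fun S (q i)) -> (forall i u, S u -> 0 < q i u) ->
  (forall i u, S u -> q' i u = q i (dir (u *m T))) ->
  V_gen phi (fun i => lin_image T (K i)) q' = V_gen phi K q.
Proof.
move=> mq q0 q'E; have uT := SL_unitmx sT.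
have K0 i : is_K0 (K i) by have [] := FK i.
have cK i := is_K0_compact (K0 i).
have TK0 i : is_K0 (lin_image T (K i)) := lin_image_K0 uT (K0 i).
have Kf i := curvature_funP (FK i).
have TKf i := curvature_funP (lin_image_F0 (FK i)).
have gS u : S u -> S (dir (u *m T)) by exact: direction_mulmx_sphere.
have q'0 i u : S u -> 0 < q' i u by move=> Su; rewrite q'E// q0//; exact: gS.
have mq' i : measurable_fun S (q' i).
  apply: (@eq_measurable_fun _ _ _ _ _ (fun u : borelRn R n => q i (dir ((u : 'rV[R]_n) *m T)))).
    by move=> u /set_mem Su; rewrite q'E.
  exact: measurable_comp_direction_mulmx.
pose f i := curvature_fun (K i).
pose TK i := lin_image T (K i).
have VE L p : V_gen phi L p = (n%:R^-1%:E *
    \int[sigma]_(u in S) (X L p (fun i => curvature_fun (L i)) u)%:E)%E.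
  by rewrite /V_gen; congr (_ * _)%E; apply: eq_integral => u _; rewrite prodEFin.
rewrite (VE TK q') (VE K q).
apply: (congr1 (mule (n%:R^-1)%:E)).
(* The chosen curvature functions of the images give way to the explicit ones, which agree with them
   almost everywhere. *)
transitivity (\int[sigma]_(u in S)
    (X TK q' (fun i => curvature_lin_image T (f i)) u)%:E)%E.
  apply: ae_eq_integral.
  - exact: measurable_sphere.
  - by apply: mX => // i; have [] := TKf i.
  - apply: mX => // i.
    by have [] := curvature_lin_imageP sT (cK i) (Kf i).
  have := filter_forall (ae_filter_ringOfSetsType sigma) (fun i => curvature_fun_lin_image (FK i)).
  apply: filterS => u ae Su; congr EFin; apply: eq_bigr => i _.
  by have /= [->] := ae i Su.
transitivity (\int[sigma]_(u in S) ((X K q f (dir ((u : 'rV[R]_n) *m T)))%:E *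
    (enorm ((u : 'rV[R]_n) *m T) ^- n)%:E))%E; last first.
  rewrite -(@sphere_change_of_variables R n T sT S (EFin \o X K q f)); last first.
  - by move=> u _; rewrite lee_fin; apply: prodr_ge0 => i _; exact: powR_ge0.
  - by apply: mX => // i; have [] := Kf i.
  - by [].
  - exact: measurable_sphere.
  congr integral; apply: setIidl => v Sv; apply: direction_mulmx_sphere => //.
  by rewrite unitmx_inv.
apply: eq_integral => u /set_mem Su; rewrite -EFinM; congr EFin.
set e := enorm ((u : 'rV[R]_n) *m T).
have e0 : 0 < e by rewrite enorm_gt0 mulmx_neq0// sphere_neq0.
(* The Jacobian is shared out as one [e^-1] for each of the [n] factors. *)
have -> : e ^- n = \prod_(i < n) e^-1 by rewrite prodr_const card_ord exprVn.
rewrite /X -big_split/=; apply: eq_bigr => i _.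
rewrite q'E// support_fun_lin_image support_fun_direction//; last 2 first.
- exact: is_K0_nonempty.
- by rewrite mulmx_neq0// sphere_neq0.
rewrite /curvature_lin_image -/e.
set Y := phi i _ * support_fun (K i) _ * f i _.
have Y0 : 0 <= Y.
  rewrite !mulr_ge0//; first by rewrite ltW// phi0// q0//; exact: gS.
    rewrite ltW// support_fun_gt0//; first by have [] := K0 i.
    by apply: sphere_neq0; exact: gS.
  by have [_ h _] := Kf i; apply: h; exact: gS.
(* The support function contributes [e] and the curvature function [e ^- n.+1]; the n-th root of the
   product [e ^- n] is the [e^-1] just set aside. *)
rewrite [X in X `^ _](_ : _ = e ^- n * Y); last first.
  rewrite /Y -!exprVn exprS; set k := e^-1 ^+ n.
  have e_neq0 : e != 0 by rewrite gt_eqF.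
  rewrite -[RHS]mul1r -(divff e_neq0); ring.
rewrite powRM ?invr_ge0 ?exprn_ge0 ?(ltW e0)// mulrC; congr (_ * _).
rewrite -exprVn -powR_mulrn ?invr_ge0 ?(ltW e0)// -powRrM divff ?pnatr_eq0//.
by rewrite powRr1// invr_ge0 ltW.
Qed.

End curvature_fun_lin_image.

(** * Star bodies *)

Section star_bodies.
Context (R : realType) (n : nat).
Implicit Types (L : set 'rV[R]_n) (T : 'M[R]_n) (u x : 'rV[R]_n).
Local Notation S := (@sphere R n : set (borelRn R n)).
Local Notation dir := (@direction R n).

Lemma radial_eq L x (l : R) : L (l *: x) -> (forall t, L (t *: x) -> t <= l) ->
  radial L x = l.
Proof.
move=> Ll ub; apply/le_anti/andP; split; first by apply: ge_sup; [exists l|].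
by apply: ub_le_sup => //; exists l.
Qed.

Lemma radial_mulmx L T u :
  radial ((fun x : 'rV[R]_n => x *m T) @^-1` L) u = radial L (u *m T).
Proof. by congr (sup _); apply/seteqP; split => l /=; rewrite -scalemxAl. Qed.

Lemma le_radial L u (t : R) : is_S0 L -> S u -> L (t *: u) -> t <= radial L u.
Proof. by move=> [_ h _ _] Su Lt; have [_ ub] := h _ Su; exact: ub_le_sup. Qed.

Lemma mem_star_body L x : is_S0 L -> x != 0 ->
  L x <-> enorm x <= radial L (dir x).
Proof.
move=> SL x0; have Sx := enorm_direction x0.
split=> [Lx|xle]; first by apply: le_radial => //; rewrite directionK.
have [star /(_ _ Sx)[Lr _] _ /(_ _ Sx) r0] := SL.
have -> : x = (enorm x / radial L (dir x)) *: (radial L (dir x) *: (dir x : 'rV[R]_n)).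
  by rewrite scalerA divfK ?directionK// gt_eqF.
apply: star => //; apply/andP; split.
  by rewrite divr_ge0 ?enorm_ge0 ?(ltW r0).
by rewrite ler_pdivrMr// mul1r.
Qed.

Lemma radial_direction L x : is_S0 L -> x != 0 ->
  radial L x = (enorm x)^-1 * radial L (dir x).
Proof.
move=> SL x0; have Sx := enorm_direction x0.
have [_ /(_ _ Sx)[Lr _] _ _] := SL.
have e0 : 0 < enorm x by rewrite enorm_gt0.
have xE (t : R) : t *: x = (t * enorm x) *: (dir x : 'rV[R]_n).
  by rewrite -scalerA directionK.
apply: radial_eq => [|t]; rewrite xE; first by rewrite mulrAC mulVf ?mul1r// gt_eqF.
by move=> /(le_radial SL Sx); rewrite ler_pdivlMl// mulrC.
Qed.

Lemma direction_mulmx_continuous_at T x : x *m T != 0 ->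
  {for x, continuous (fun u : 'rV[R]_n => dir (u *m T) : 'rV[R]_n)}.
Proof.
move=> xT0; rewrite /prop_for /continuous_at.
apply: (@cvgZ _ _ _ (nbhs x) _ (fun u : 'rV[R]_n => (enorm (u *m T))^-1)
  (fun u : 'rV[R]_n => u *m T)); last exact: mulmxr_continuous.
apply: cvgV; first by rewrite enorm_eq0.
apply: (@continuous_comp _ _ _ (fun u : 'rV[R]_n => u *m T) (@enorm R n)).
  exact: mulmxr_continuous.
exact: enorm_continuous.
Qed.

Lemma star_body_mulmx L T : T \in unitmx -> is_S0 L ->
  is_S0 ((fun x : 'rV[R]_n => x *m T) @^-1` L).
Proof.
move=> uT SL; have [star Lr cr r0] := SL.
have uT0 u : S u -> u *m T != 0 by move=> Su; rewrite mulmx_neq0// sphere_neq0.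
have e0 u : S u -> 0 < (enorm (u *m T))^-1 by move=> Su; rewrite invr_gt0 enorm_gt0 uT0.
have Sd u : S u -> S (dir (u *m T)) by exact: direction_mulmx_sphere.
have radialE u : S u -> radial ((fun x : 'rV[R]_n => x *m T) @^-1` L) u =
    (enorm (u *m T))^-1 * radial L (dir (u *m T)).
  by move=> Su; rewrite radial_mulmx radial_direction// uT0.
split.
- by move=> x t /= Lx t01; rewrite -scalemxAl; exact: star.
- move=> u Su; rewrite radialE// /=; split.
    have [+ _] := Lr _ (Sd _ Su).
    by rewrite -scalemxAl mulrC -scalerA.
  exists ((enorm (u *m T))^-1 * radial L (dir (u *m T))) => t /=.
  rewrite -scalemxAl -[u *m T]directionK scalerA => /(le_radial SL (Sd _ Su)).
  by rewrite directionK ler_pdivlMl ?enorm_gt0 ?uT0// mulrC.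
- apply: (@subspace_eq_continuous _ _ _
      (fun u : 'rV[R]_n => (enorm (u *m T))^-1 * radial L (dir (u *m T)))).
    by move=> u /set_mem Su; rewrite /from_subspace radialE.
  apply/subspace_continuousP => x Sx; rewrite /from_subspace.
  apply: cvgM.
    apply: cvg_within_filter; apply: cvgV; first by rewrite enorm_eq0 uT0.
    apply: (@continuous_comp _ _ _ (fun u : 'rV[R]_n => u *m T) (@enorm R n)).
      exact: mulmxr_continuous.
    exact: enorm_continuous.
  (* [radial L] is continuous relative to the sphere only, and [u |-> dir (u *m T)] keeps the sphere
     within itself. *)
  have /subspace_continuousP/(_ _ (Sd _ Sx)) := cr.
  apply: cvg_comp => A /= SA.
  have := direction_mulmx_continuous_at (uT0 _ Sx) SA.
  rewrite !nbhs_simpl /within /=; apply: filterS => u /= h Su; apply: h; exact: Sd.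
- by move=> u Su; rewrite radialE// mulr_gt0 ?e0// r0//; exact: Sd.
Qed.

Lemma radial_measurable L : is_S0 L -> measurable_fun S (radial L).
Proof.
move=> [_ _ cr _]; apply: (measurability _ (RGenOpens.measurableE R)) => //.
move=> _ [_ [a [b ->]] <-].
have oab : open (`]a, b[%classic : set R) by exact: interval_open.
have /open_subspaceP[V oV VE] := (continuousP _).1 cr _ oab.
rewrite setIC -VE; apply: measurableI; last exact: measurable_sphere.
exact: sub_sigma_algebra.
Qed.

(** Away from the origin membership in [L] is the inequality [enorm x <= radial L (dir x)] between
    measurable functions; the origin is added as a point. Since [dir 0 = 0], the preimage [D] of the
    sphere is the complement of the origin. *)
Lemma star_body_measurable L : is_S0 L -> measurable (L : set (borelRn R n)).
Proof.
move=> SL; pose D : set (borelRn R n) := dir @^-1` S.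
have DE x : D x <-> x != 0.
  split; last exact: enorm_direction.
  apply: contraPneq => ->; rewrite /D/= /direction scaler0 /sphere/= enorm0.
  by move=> /esym/eqP; rewrite oner_eq0.
have mD : measurable D.
  rewrite -[D]setTI; apply: measurable_direction => //; exact: measurable_sphere.
pose g (x : borelRn R n) : R := radial L (dir x) - enorm (x : 'rV[R]_n).
have mg : measurable_fun D g.
  apply: measurable_funB; last by apply: measurable_funTS; exact: measurable_enorm.
  apply: (@measurable_comp _ _ _ _ _ _ S) => //; first exact: measurable_sphere.
  - by move=> _ [x Dx <-].
  - exact: radial_measurable.
  - by apply: measurable_funTS; exact: measurable_direction.
have -> : L = (D `&` g @^-1` `[0, +oo[%classic) `|` (L `&` [set 0]).
  apply/seteqP; split => [x Lx|x [[/DE x0]|[]//]].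
    have [x0|x0] := eqVneq x 0; first by right.
    left; split; first exact/DE.
    by rewrite /= in_itv/= andbT subr_ge0; apply/(mem_star_body SL x0).
  by rewrite /= in_itv/= andbT subr_ge0 => h; apply/(mem_star_body SL x0).
apply: measurableU; first exact: mg.
have [L0|L0] := pselect (L 0).
  rewrite (_ : L `&` _ = [set 0]); last by apply: setIidr => _ ->.
  by apply: closed_measurable_rV; apply: rV_compact_closed; exact: compact_set1.
rewrite (_ : L `&` _ = set0)//.
by apply/seteqP; split => // x [Lx x0]; apply: L0; rewrite -x0.
Qed.

End star_bodies.

Section value_sets.
Context (R : realType) (d : nat).
Local Notation n := d.+1.
Local Notation S := (@sphere R n : set (borelRn R n)).
Local Notation dir := (@direction R n).
Variable (phi : 'I_n -> R -> R).
Hypotheses (mphi : forall i, measurable_fun (`]0, +oo[%classic : set R) (phi i))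
  (phi0 : forall i t, 0 < t -> 0 < phi i t).
Implicit Types (T : 'M[R]_n) (K : 'I_n -> set 'rV[R]_n).

Let mV (f : borelRn R n -> R) : measurable_fun S f -> (forall u, S u -> 0 < f u) ->
  measurable_fun S (fun u => (f u)^-1).
Proof.
move=> mf f0.
apply: (@eq_measurable_fun _ _ _ _ _ ((@powR R)^~ (-1) \o f)).
  by move=> u /set_mem Su; rewrite /= powR_inv1// ltW// f0.
by apply: (measurableT_comp (measurable_powR _)).
Qed.

Let support_pos (K : set 'rV[R]_n) u : is_K0 K -> S u -> 0 < support_fun K u.
Proof.
move=> K0 Su; apply: support_fun_gt0; [exact: is_K0_compact|by case: K0|].
exact: sphere_neq0.
Qed.

Let support_measurable (K : set 'rV[R]_n) : is_K0 K -> measurable_fun S (support_fun K).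
Proof.
move=> K0; apply: measurable_funTS; apply: continuous_measurable_rV.
by apply: support_fun_continuous; [exact: is_K0_compact|exact: is_K0_nonempty].
Qed.

Let support_lin (K : set 'rV[R]_n) T u : SL T -> is_K0 K -> S u ->
  support_fun (lin_image T K) u = enorm (u *m T) * support_fun K (dir (u *m T)).
Proof.
move=> sT K0 Su; rewrite support_fun_lin_image support_fun_direction//.
- exact: is_K0_compact.
- exact: is_K0_nonempty.
- by rewrite mulmx_neq0 ?SL_unitmx// sphere_neq0.
Qed.

Let G_valuesS T K : SL T -> (forall i, is_F0 (K i)) ->
  G_values phi K `<=` G_values phi (fun i => lin_image T (K i)).
Proof.
move=> sT FK _ [Q QP <-]; have uT := SL_unitmx sT.
have K0 i : is_K0 (K i) by have [] := FK i.
(* The polar of TQ is a volume-preserving linear image of that of Q, so TQ is admissible, and the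
   factors [enorm (u *m T)] cancel in the quotient of support functions. *)
exists (fun i => lin_image T (Q i)) => [i|].
  have [Q0 Qv] := QP i; split; first exact: lin_image_K0.
  rewrite polar_lin_image lebesgue_rV_SL//.
  by apply: closed_measurable_rV; exact: polar_closed.
apply: (congr1 (mule _)); apply: V_gen_lin_image => //.
- move=> i; have [Q0 _] := QP i; apply: measurable_funM; first exact: support_measurable.
  by apply: mV => [|u Su]; [exact: support_measurable|exact: support_pos].
- by move=> i u Su; have [Q0 _] := QP i; rewrite divr_gt0// support_pos.
move=> i u Su; have [Q0 _] := QP i.
have e0 : enorm (u *m T) != 0.
  by rewrite enorm_eq0 mulmx_neq0// sphere_neq0.
by rewrite !support_lin// -mulf_div divff// mul1r.
Qed.

Let Omega_valuesS T K : SL T -> (forall i, is_F0 (K i)) ->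
  Omega_values phi K `<=` Omega_values phi (fun i => lin_image T (K i)).
Proof.
move=> sT FK _ [L LP <-]; have uT := SL_unitmx sT.
have K0 i : is_K0 (K i) by have [] := FK i.
(* This preimage is T^-t L. Its radial function carries the inverse of the factor carried by the
   support function of TK, so their product is transported without a factor. *)
exists (fun i => (fun x : 'rV[R]_n => x *m T) @^-1` L i) => [i|].
  have [L0 Lv] := LP i; split; first exact: star_body_mulmx.
  by rewrite lebesgue_rV_SL//; exact: star_body_measurable.
apply: (congr1 (mule _)).
have q0 i u : S u -> 0 < radial (L i) u * support_fun (K i) u.
  by move=> Su; have [[_ _ _ r0] _] := LP i; rewrite mulr_gt0 ?r0// support_pos.
apply: V_gen_lin_image => //.
- move=> i; have [L0 _] := LP i; under eq_fun do rewrite div1r.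
  apply: mV (q0 i); apply: measurable_funM; first exact: radial_measurable.
  exact: support_measurable.
- by move=> i u Su; rewrite div1r invr_gt0 q0.
move=> i u Su; have [L0 _] := LP i.
have e0 : enorm (u *m T) != 0.
  by rewrite enorm_eq0 mulmx_neq0// sphere_neq0.
rewrite support_lin// radial_mulmx radial_direction -?enorm_eq0//.
by congr (_ / _); rewrite mulrACA mulVf// mul1r.
Qed.

Let value_sets_eq (values : ('I_n -> set 'rV[R]_n) -> set (\bar R)) :
  (forall T K, SL T -> (forall i, is_F0 (K i)) ->
    values K `<=` values (fun i => lin_image T (K i))) ->
  forall T K, SL T -> (forall i, is_F0 (K i)) ->
    values (fun i => lin_image T (K i)) = values K.
Proof.
move=> sub T K sT FK; apply/seteqP; split; last exact: sub.
have := sub _ _ (SL_invmx sT) (fun i => lin_image_F0 sT (FK i)).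
rewrite [X in _ `<=` values X -> _](_ : _ = K)//.
by apply/funext => i; rewrite lin_imageK// SL_unitmx.
Qed.

Lemma G_values_lin_image T K : SL T -> (forall i, is_F0 (K i)) ->
  G_values phi (fun i => lin_image T (K i)) = G_values phi K.
Proof. by move: T K; apply: value_sets_eq => T K; exact: G_valuesS. Qed.

Lemma Omega_values_lin_image T K : SL T -> (forall i, is_F0 (K i)) ->
  Omega_values phi (fun i => lin_image T (K i)) = Omega_values phi K.
Proof. by move: T K; apply: value_sets_eq => T K; exact: Omega_valuesS. Qed.

End value_sets.

Theorem proposition4p2 (R : realType) (n : nat) (hn : (0 < n)%N)
  (phi : 'I_n -> R -> R) (K : 'I_n -> set 'rV[R]_n)
  (hK : forall i, is_F0 (K i)) :
  ((forall i, is_Phi n (phi i)) ->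
     forall T : 'M[R]_n, SL T ->
       Omega_inf phi (fun i => lin_image T (K i)) = Omega_inf phi K /\
       G_inf phi (fun i => lin_image T (K i)) = G_inf phi K) /\
  ((forall i, is_Psi n (phi i)) ->
     forall T : 'M[R]_n, SL T ->
       Omega_sup phi (fun i => lin_image T (K i)) = Omega_sup phi K /\
       G_sup phi (fun i => lin_image T (K i)) = G_sup phi K).
Proof.
case: n => [//|d] in hn phi K hK *.
split=> hphi T sT; have phi0 i t (t0 : 0 < t) : 0 < phi i t by
  have [h _] := hphi i; exact: h.
- have mphi i := is_Phi_measurable hn (hphi i).
  split; apply: (congr1 (@ereal_inf R)).
    exact: (Omega_values_lin_image mphi phi0 sT hK).
  exact: (G_values_lin_image mphi phi0 sT hK).
- have mphi i := is_Psi_measurable hn (hphi i).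
  split; apply: (congr1 (@ereal_sup R)).
    exact: (Omega_values_lin_image mphi phi0 sT hK).
  exact: (G_values_lin_image mphi phi0 sT hK).
Qed.
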